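(* Let $f\in A^2$ and, for $n\ge 0$, let $P_n f=\sum_{k=0}^n\sum_{\ell}\langle f,\psi_{k,\ell}\rangle\psi_{k,\ell}$ be the orthogonal projection of $f$ onto the resolution space $V_n$ (as defined in the context). Then: (i) for every $n$, $P_nf$ interpolates $f$ at the points $z_{k\ell}$ of levels $0,\dots,n$: $P_nf(z_{k\ell})=f(z_{k\ell})$ for all $z_{k\ell}\in\bigcup_{k=0}^n\mathcal{A}_k$; (ii) $\|f-P_nf\|\to 0$ as $n\to\infty$, where $\|\cdot\|$ is the norm of $A^2$; (iii) $P_nf\to f$ uniformly on every compact subset of the unit disc as $n\to\infty$; (iv) for every $n$, $P_nf$ is the solution of the minimal norm interpolation problem, i.e. $P_nf$ is the unique function of minimal $A^2$-norm among all $g\in A^2$ satisfying $g(z_{k\ell})=f(z_{k\ell})$ for all $z_{k\ell}\in\bigcup_{k=0}^n\mathcal{A}_k$.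
   Context: $\mathbb{D}=\{z\in\mathbb{C}:|z|<1\}$, $dA(z)=\frac1\pi\,dx\,dy$, and $A^2$ is the Bergman space of analytic functions $f:\mathbb{D}\to\mathbb{C}$ with $\int_{\mathbb{D}}|f|^2\,dA<\infty$, a Hilbert space with $\langle f,g\rangle=\int_{\mathbb{D}}f\overline{g}\,dA$ and norm $\|\cdot\|$. Its reproducing kernel is $K(z,w)=\frac{1}{(1-\overline{w}z)^2}$. Points: take $a=2$ and, for $k\ge 0$, $r_k=\frac{2^k-2^{-k}}{2^k+2^{-k}}$. Let $\mathcal{A}_0=\{z_{00}\}$ with $z_{00}=0$, and for $k\ge 1$ let $\mathcal{A}_k=\{z_{k\ell}=r_ke^{i\frac{2\pi\ell}{2^{2k+3}}}:\ \ell=0,1,\dots,2^{2k+3}-1\}$. (Thus level $0$ has the single index $\ell=0$, and level $k\ge1$ has the indices $\ell=0,\dots,2^{2k+3}-1$; all sums over $\ell$ at level $k$ are over these indices.) Resolution spaces: $\varphi_{k,\ell}(z)=\frac{1-r_k^2}{(1-\overline{z_{k\ell}}z)^2}$, and $V_n=\operatorname{span}\{\varphi_{k,\ell}: z_{k\ell}\in\mathcal{A}_k,\ k=0,\dots,n\}\subset A^2$. Orthonormal system: order the points level by level, $a_1=z_{00}$, $a_2=z_{10}$, $a_3=z_{11},\dots$ (increasing $k$, and increasing $\ell$ within each level). The functions $\psi_{k,\ell}$ are obtained by applying Gram–Schmidt orthonormalization in $A^2$ to $K(\cdot,a_1),K(\cdot,a_2),\dots$ in this order, $\psi_{k,\ell}$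 being the function corresponding to $a_m=z_{k\ell}$. Hence $\{\psi_{k,\ell}: z_{k\ell}\in\mathcal{A}_k,\ 0\le k\le n\}$ is an orthonormal basis of $V_n$. *)

(* Defs.v *)
From HB Require Import structures.
From mathcomp Require Import all_boot all_order all_algebra.
From mathcomp Require Import complex.
From mathcomp Require Import all_classical all_reals all_analysis.

Set Implicit Arguments.
Unset Strict Implicit.
Unset Printing Implicit Defensive.

Import Order.TTheory GRing.Theory Num.Theory.
Import ComplexField.Normc.
Import numFieldNormedType.Exports.

Local Open Scope classical_set_scope.
Local Open Scope complex_scope.
Local Open Scope ring_scope.

Section Bergman.
Context {R : realType}.
Implicit Types (f g h : R[i] -> R[i]) (z w : R[i]) (k l n : nat).

Definition unit_disc : set R[i] := [set z | normc z < 1].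

(* Analyticity is local expandability in a convergent power series.  The
   topology of the complex plane is that of the normed module R[i]^o. *)
Definition analytic_at f z0 :=
  exists2 rho : R, 0 < rho & exists c : nat -> R[i],
    forall z, normc (z - z0) < rho ->
      (series (fun m => c m * (z - z0) ^+ m) : nat -> R[i]^o) @ \oo
        --> (f z : R[i]^o).

Definition complex_of_pair (p : R * R) : R[i] := p.1 +i* p.2.

Lemma invpi_ge0 : 0 <= (pi : R)^-1.
Proof. by rewrite invr_ge0 pi_ge0. Qed.

Definition dA :
    {measure set (measurableTypeR R * measurableTypeR R) -> \bar R} :=
  mscale (NngNum invpi_ge0) (@lebesgue_measure R \x @lebesgue_measure R)%E.

Definition plane_disc : set (R * R) := complex_of_pair @^-1` unit_disc.

(* The functions are total; only their values on the unit disc matter, and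
   two of them are the same element of the Bergman space when they agree on
   the unit disc. *)
Definition bergman f :=
  (forall z, unit_disc z -> analytic_at f z) /\
  (\int[dA]_(p in plane_disc)
     ((normc (f (complex_of_pair p))) ^+ 2)%:E < +oo)%E.

Definition eq_on_disc f g := forall z, unit_disc z -> f z = g z.

Definition disc_integral f : R[i] :=
  Rintegral dA plane_disc (fun p => complex.Re (f (complex_of_pair p))) +i*
  Rintegral dA plane_disc (fun p => complex.Im (f (complex_of_pair p))).

Definition inner f g : R[i] := disc_integral (fun z => f z * (g z)^*).

Definition bnorm f : R := Num.sqrt (complex.Re (inner f f)).

Definition bergman_kernel w : R[i] -> R[i] :=
  fun z => 1 / (1 - w^* * z) ^+ 2.

Definition radius k : R := (2 ^+ k - 2 ^- k) / (2 ^+ k + 2 ^- k).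

Definition level_size k : nat := if k is 0 then 1%N else (2 ^ (2 * k + 3))%N.

(* radius 0 = 0, so that the only point of level 0 is 0. *)
Definition node k l : R[i] :=
  let theta : R := 2 * pi * l%:R / 2 ^+ (2 * k + 3) in
  (radius k)%:C * (cos theta +i* sin theta).

Definition phi k l : R[i] -> R[i] :=
  fun z => (1 - (radius k) ^+ 2)%:C / (1 - (node k l)^* * z) ^+ 2.

Definition resolution_space n g :=
  exists c : nat -> nat -> R[i],
    eq_on_disc g
      (fun z => \sum_(k < n.+1) \sum_(l < level_size k) c k l * phi k l z).

Definition gram_schmidt_step (es : seq (R[i] -> R[i]))
    (v : R[i] -> R[i]) :=
  let u := fun z => v z - \sum_(e <- es) inner v e * e z in
  rcons es (fun z => u z / (bnorm u)%:C).

Definition gram_schmidt (vs : seq (R[i] -> R[i])) : seq (R[i] -> R[i]) :=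
  foldl gram_schmidt_step [::] vs.

Definition nodes_upto n : seq R[i] :=
  flatten [seq [seq node k l | l <- iota 0 (level_size k)] | k <- iota 0 n.+1].

(* The first m outputs of Gram-Schmidt depend only on the first m inputs, so
   it is enough to orthonormalize the kernels up to level k. *)
Definition psi k l : R[i] -> R[i] :=
  nth (fun=> 0) (gram_schmidt [seq bergman_kernel a | a <- nodes_upto k])
    (\sum_(j < k) level_size j + l).

Definition bergman_proj n f : R[i] -> R[i] :=
  fun z => \sum_(k < n.+1) \sum_(l < level_size k)
    inner f (psi k l) * psi k l z.

Definition is_orthogonal_projection n f g :=
  resolution_space n g /\
  forall h, resolution_space n h -> inner (fun z => f z - g z) h = 0.

Definition interpolates n f g :=
  forall k l, (k <= n)%N -> (l < level_size k)%N -> g (node k l) = f (node k l).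

Definition is_min_norm_interpolant n f g :=
  [/\ bergman g, interpolates n f g &
    forall h, bergman h -> interpolates n f h -> bnorm g <= bnorm h].

End Bergman.

(* Main.v *)
(** A function that is locally a power series on the disc is the sum of its
    Taylor series there: the maximum principle, applied to averages of f over
    roots of unity, gives the Cauchy estimates.  Integrating monomials over discs
    turns the Bergman norm into sum |c_m|^2 / (m + 1), whence the reproducing
    property, which makes f - P_n f vanish at the nodes and gives the minimality.

    A function vanishing at the N_k equally spaced nodes of level k is divisible
    by z^(N_k) - r_k^(N_k).  Dividing out levels 1, ..., n costs, in the norm
    sup |c_m| rho^m with 1 - rho = 4^(-n-2), at most the product of the
    1 / (rho^(N_k) - r_k^(N_k)); multiplying back on a fixed disc |z| <= sigma
    costs the product of the sigma^(N_k) + r_k^(N_k).  Since r_k^(N_k) <= 1/256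
    and rho^(N_k) >= 1/2, each level with large k gains more than the factor 4 by
    which the bound 16 * 4^n ||f|| on the coefficients grows, so f - P_n f tends
    to 0 uniformly on compact sets.  Its squared norm is <f - P_n f, f>, where f
    may be replaced by a Taylor polynomial, and so tends to 0 as well. *)

Require Import Defs.
From mathcomp Require Import all_boot all_order all_algebra.
From mathcomp Require Import complex.
From mathcomp Require Import all_classical all_reals all_analysis.
From mathcomp Require Import measurable_realfun.
From mathcomp Require Import zify ring lra.
Import Order.TTheory GRing.Theory Num.Theory.
Import ComplexField.Normc.
Import numFieldNormedType.Exports.

Set Implicit Arguments.
Unset Strict Implicit.
Unset Printing Implicit Defensive.

Local Open Scope classical_set_scope.
Local Open Scope complex_scope.
Local Open Scope ring_scope.

(** * Moduli of complex numbers *)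

Section ComplexModulus.
Context {R : realType}.
Implicit Types (x y z : R[i]) (a b : R).

(** Analyticity is given point by point, through power series with unrelated radii, so a Taylor
    series valid on the whole disc has to be produced without contour integrals. Polynomial
    approximations of finite order replace the local series: they pass to products and to the
    quotient (f(z) - f(0)) / z without any re-expansion, and they still suffice for the maximum
    principle.

    Convergence is obtained quantitatively, because level k has 8 * 4^k nodes at distance of order
    4^-k from the unit circle, the same rate at which an outer radius must approach 1 to enclose n
    levels. Each high level then gains a constant factor, close to 1/127 for large k, against the
    factor 4 lost when the outer radius moves out by one level. The margin comes from the factor 8
    in the number of nodes, which turns the bound 1/2 for r_k^(4^k) into 1/256. Dividing coefficient
    sequences instead of functions makes each division an explicit recursion inside the residue
    classes modulo the number of nodes. *)

Lemma normc_ge0 z : 0 <= normc z.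
Proof. by case: z => a b /=; exact: sqrtr_ge0. Qed.

Lemma normc_triangle x y : normc (x + y) <= normc x + normc y.
Proof. exact: le_normcD. Qed.

Lemma normc_opp z : normc (- z) = normc z.
Proof. exact: normcN. Qed.

Lemma normc_distC x y : normc (x - y) = normc (y - x).
Proof. by rewrite -normc_opp opprB. Qed.

Lemma normc_triangleB x y : normc x <= normc (x - y) + normc y.
Proof. by rewrite -{1}(subrK y x) normc_triangle. Qed.

Lemma normc_sub_le x y : `|normc x - normc y| <= normc (x - y).
Proof.
rewrite ler_norml; apply/andP; split; last by rewrite lerBlDr normc_triangleB.
by rewrite lerNl opprB lerBlDr normc_distC normc_triangleB.
Qed.

Lemma normc_eq0 z : (normc z == 0) = (z == 0).
Proof. by apply/eqP/eqP => [/eq0_normc//|->]; rewrite normc0. Qed.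

Lemma normc_gt0 z : (0 < normc z) = (z != 0).
Proof. by rewrite lt0r normc_ge0 andbT normc_eq0. Qed.

Lemma normcX z n : normc (z ^+ n) = normc z ^+ n.
Proof. by elim: n => [|n IH]; rewrite ?normc1// !exprS normcM IH. Qed.

Lemma normc_real a : normc (a%:C) = `|a|.
Proof. by rewrite /= expr0n /= addr0 sqrtr_sqr. Qed.

Lemma normc_sum (I : Type) (s : seq I) (P : pred I) (F : I -> R[i]) :
  normc (\sum_(i <- s | P i) F i) <= \sum_(i <- s | P i) normc (F i).
Proof.
apply: (big_ind2 (fun u v => normc u <= v)) => //; first by rewrite normc0.
by move=> u v u' v' h h'; rewrite (le_trans (normc_triangle _ _)) ?lerD.
Qed.

Lemma normc_conj z : normc (z^*) = normc z.
Proof. by case: z => a b /=; rewrite sqrrN. Qed.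

Lemma normc_sqr z : normc z ^+ 2 = complex.Re z ^+ 2 + complex.Im z ^+ 2.
Proof. by case: z => a b /=; rewrite sqr_sqrtr// addr_ge0 ?sqr_ge0. Qed.

Lemma mul_conj z : z * z^* = (normc z ^+ 2)%:C.
Proof. by rewrite normc_sqr; case: z => a b; apply/eqP; rewrite eq_complex /=; apply/andP; split; apply/eqP; ring. Qed.

Lemma Re_normc z : `|complex.Re z| <= normc z.
Proof.
rewrite -(ler_pXn2r (n := 2)) ?nnegrE ?normc_ge0// normc_sqr real_normK ?num_real//.
by rewrite lerDl sqr_ge0.
Qed.

Lemma Im_normc z : `|complex.Im z| <= normc z.
Proof.
rewrite -(ler_pXn2r (n := 2)) ?nnegrE ?normc_ge0// normc_sqr real_normK ?num_real//.
by rewrite lerDr sqr_ge0.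
Qed.

Lemma normc_Re_Im z : normc z <= `|complex.Re z| + `|complex.Im z|.
Proof.
rewrite -(ler_pXn2r (n := 2)) ?nnegrE ?normc_ge0 ?addr_ge0// normc_sqr.
rewrite sqrrD !real_normK ?num_real// lerD2r lerDl mulrn_wge0 ?mulr_ge0//.
Qed.

Lemma cvgcP (u : nat -> R[i]) (l : R[i]) :
  ((u : nat -> R[i]^o) @ \oo --> (l : R[i]^o)) <->
  ((fun n => normc (u n - l)) @ \oo --> (0 : R)).
Proof.
split=> [|] /cvgrPdist_lt h; apply/cvgrPdist_lt => e e0.
  have e0' : (0 : R[i]) < e%:C by rewrite ltcR.
  have := h _ e0'; apply: filterS => n.
  rewrite -[`|l - u n|]/((normc (l - u n))%:C) ltcR => H.
  by rewrite sub0r normrN ger0_norm ?normc_ge0 // normc_distC.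
(* The norm of [R[i]^o] takes values in the complex field itself; a positive element there is real,
   so the tolerance reduces to its real part. *)
have e1 : e = (complex.Re e)%:C by rewrite RRe_real ?gtr0_real.
rewrite e1 in e0 *; rewrite ltcR in e0.
have := h _ e0; apply: filterS => n.
rewrite sub0r normrN ger0_norm ?normc_ge0 // normc_distC => H.
by rewrite -[`|l - u n|]/((normc (l - u n))%:C) ltcR.
Qed.

End ComplexModulus.

#[global] Hint Extern 0 (is_true (0 <= normc _)) => exact: normc_ge0 : core.

(** * Power series *)

Section PowerSeries.
Context {R : realType}.
Implicit Types (z l h : R[i]) (c b : nat -> R[i]) (q s B : R).

Definition psum c z n : R[i] := \sum_(m < n) c m * z ^+ m.

(** Phrased through the real-valued modulus, so that squeezing against real geometric sequences
    applies directly. *)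
Definition psum_cvg c z l := (fun n => normc (psum c z n - l)) @ \oo --> (0 : R).

Lemma psum_cvgP c z l :
  (series (fun m => c m * z ^+ m) : nat -> R[i]^o) @ \oo --> (l : R[i]^o) <->
  psum_cvg c z l.
Proof.
rewrite /psum_cvg; have -> : psum c z = series (fun m => c m * z ^+ m).
  by apply/funext => n; rewrite /psum /series /= big_mkord.
exact: cvgcP.
Qed.

Lemma geometric_tail q n M : 0 <= q -> q < 1 -> (n <= M)%N ->
  \sum_(n <= m < M) q ^+ m <= q ^+ n / (1 - q).
Proof.
move=> q0 q1 nM; have d0 : 0 < 1 - q by rewrite subr_gt0.
rewrite ler_pdivlMr // -(subnK nM) addnC.
elim: (M - n)%N => [|k IH]; first by rewrite addn0 big_geq// mul0r exprn_ge0.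
suff : (\sum_(n <= m < n + k.+1) q ^+ m) * (1 - q) = q ^+ n - q ^+ (n + k.+1).
  by move=> ->; rewrite lerBlDr lerDl exprn_ge0.
elim: k.+1 => [|j IHj]; first by rewrite addn0 big_geq// mul0r subrr.
rewrite addnS big_nat_recr /= ?leq_addr// mulrDl IHj exprS; ring.
Qed.

Lemma psum_tail c z n M : (n <= M)%N ->
  psum c z M - psum c z n = \sum_(n <= m < M) c m * z ^+ m.
Proof.
move=> nM; rewrite /psum -!(big_mkord xpredT (fun m => c m * z ^+ m)).
by rewrite (big_cat_nat (leq0n n) nM) /= addrAC subrr add0r.
Qed.

(** Abel's lemma: bounded terms at radius s make the series at a smaller |z| geometric of ratio |z|
    / s. *)
Lemma psum_cauchy_bound c z s B n M : 0 < s -> normc z < s ->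
  (forall m, normc (c m) * s ^+ m <= B) -> (n <= M)%N ->
  normc (psum c z M - psum c z n) <= B * (normc z / s) ^+ n / (1 - normc z / s).
Proof.
move=> s0 zs cB nM; rewrite psum_tail//.
apply: (le_trans (normc_sum _ _ _)).
have q0 : 0 <= normc z / s by rewrite divr_ge0 // ltW.
have q1 : normc z / s < 1 by rewrite ltr_pdivrMr // mul1r.
have B0 : 0 <= B by apply: le_trans (cB 0%N); rewrite mulr_ge0 ?exprn_ge0 // ltW.
rewrite -mulrA; apply: le_trans (ler_wpM2l B0 (geometric_tail q0 q1 nM)).
rewrite mulr_sumr; apply: ler_sum => m _.
have sm : s ^+ m != 0 by rewrite expf_neq0 // gt_eqF.
have -> : normc (c m * z ^+ m) = normc (c m) * s ^+ m * (normc z / s) ^+ m.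
  by rewrite normcM normcX expr_div_n; field.
by rewrite ler_wpM2r ?exprn_ge0.
Qed.

Lemma psum_cvg_le c z l a B n0 : psum_cvg c z l ->
  (forall n, (n0 <= n)%N -> normc (psum c z n - a) <= B) -> normc (l - a) <= B.
Proof.
move=> cl hB; apply/ler_addgt0Pr => e e0.
have /cvgrPdist_lt /(_ e e0)[N _ hN] := cl.
pose n := maxn N n0.
have /= := hN n (leq_maxl _ _); rewrite sub0r normrN ger0_norm // => H.
have := hB n (leq_maxr _ _) => H2.
rewrite normc_distC in H.
have -> : l - a = (l - psum c z n) + (psum c z n - a) by ring.
by rewrite (le_trans (normc_triangle _ _))// addrC lerD // ltW.
Qed.

Lemma psum_tail_bound c z l s B n : 0 < s -> normc z < s ->
  (forall m, normc (c m) * s ^+ m <= B) -> psum_cvg c z l ->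
  normc (l - psum c z n) <= B * (normc z / s) ^+ n / (1 - normc z / s).
Proof.
move=> s0 zs cB cl; apply: (psum_cvg_le (n0 := n) cl) => M nM.
exact: psum_cauchy_bound.
Qed.

Lemma bounded_seq_cvg0 (u : nat -> R) : u @ \oo --> (0 : R) ->
  exists2 B : R, 0 <= B & forall n, `|u n| <= B.
Proof.
move=> /cvgrPdist_lt /(_ 1 ltr01)[N _ hN].
exists (1 + \sum_(i < N) `|u i|); first by rewrite addr_ge0 ?sumr_ge0.
move=> n; have [nN|nN] := ltnP n N.
  by rewrite (bigD1 (Ordinal nN)) //= addrCA lerDl addr_ge0 ?sumr_ge0.
have /= := hN n nN; rewrite sub0r normrN => /ltW h.
by rewrite (le_trans h)// lerDl sumr_ge0.
Qed.

Lemma psum_cvg_terms c z l : psum_cvg c z l ->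
  (fun n => normc (c n * z ^+ n)) @ \oo --> (0 : R).
Proof.
move=> cl; have cl1 : (fun n => normc (psum c z n.+1 - l)) @ \oo --> (0 : R).
  by have := cl; rewrite /psum_cvg -(cvg_shiftS (fun n => normc (psum c z n - l))).
have h : (fun n => normc (psum c z n.+1 - l) + normc (psum c z n - l)) @ \oo --> (0 : R).
  by rewrite -[X in _ --> X](addr0 (0 : R)); exact: cvgD.
apply: (squeeze_cvgr (f := fun=> 0) _ _ h); last exact: cvg_cst.
near=> n; rewrite normc_ge0 /=.
have -> : c n * z ^+ n = (psum c z n.+1 - l) - (psum c z n - l).
  by rewrite /psum big_ord_recr /=; ring.
by rewrite (le_trans (normc_triangle _ _)) // normc_opp.
Unshelve. all: by end_near. Qed.

Lemma psum_cvg_bounded c z l : psum_cvg c z l ->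
  exists2 B, 0 <= B & forall m, normc (c m) * normc z ^+ m <= B.
Proof.
move=> /psum_cvg_terms/bounded_seq_cvg0[B B0 hB]; exists B => // m.
by have := hB m; rewrite ger0_norm // normcM normcX.
Qed.

End PowerSeries.

(** * Local polynomial expansions *)

Section Jets.
Context {R : realType}.
Implicit Types (f g : R[i] -> R[i]) (z w h : R[i]) (p q : {poly R[i]}) (C d : R).

(** Polynomial approximation to every order at one point, with no convergence and no link between
    the polynomials of different orders. The clause d <= 1 allows higher powers of |h| to be bounded
    by lower ones. *)
Definition jet_at f z0 := forall n, exists p : {poly R[i]}, exists C d : R,
  [/\ 0 <= C, 0 < d, d <= 1 &
    forall h, normc h < d -> normc (f (z0 + h) - p.[h]) <= C * normc h ^+ n].

Lemma analytic_jet f z0 : analytic_at f z0 -> jet_at f z0.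
Proof.
move=> [rho rho0 [c hc]] n; 
have [s s0 sr] : exists2 s : R, 0 < s & s < rho.
  by exists (rho / 2); [rewrite divr_gt0|rewrite ltr_pdivrMr // ltr_pMr // ltr1n].
have hc' h : normc h < rho -> psum_cvg c h (f (z0 + h)).
  by move=> hr; apply/psum_cvgP; have := hc (z0 + h); rewrite addrAC subrr add0r; exact.
have ns : normc (s%:C) = s by rewrite normc_real gtr0_norm.
have [|B B0 hB] := psum_cvg_bounded (hc' s%:C _); first by rewrite ns.
rewrite ns in hB.
(* Staying within s / 2 keeps the ratio |h| / s below 1/2, so the geometric tail costs only the
   factor 2. *)
exists (\poly_(j < n) c j), (2 * B / s ^+ n), (Num.min 1 (s / 2)).
split.
- by rewrite !mulr_ge0 // invr_ge0 exprn_ge0 // ltW.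
- by rewrite lt_min ltr01 divr_gt0.
- by rewrite ge_min lexx.
move=> h; rewrite lt_min => /andP[_ hs2].
have hs : normc h < s by rewrite (lt_trans hs2) // ltr_pdivrMr // ltr_pMr // ltr1n.
have hr : normc h < rho by rewrite (lt_trans hs).
rewrite horner_poly -/(psum c h n).
apply: le_trans (psum_tail_bound n s0 hs hB (hc' h hr)) _.
have q2 : normc h / s <= 1 / 2 by rewrite ler_pdivrMr // mulrC mulrA mulr1 ltW.
have -> : 2 * B / s ^+ n * normc h ^+ n = B * (normc h / s) ^+ n * 2.
  by rewrite expr_div_n; ring.
rewrite ler_wpM2l //.
  by rewrite mulr_ge0 // exprn_ge0 // divr_ge0 // ltW.
rewrite -[leRHS]invrK lef_pV2 ?posrE ?invr_gt0 //; lra.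
Qed.

Lemma poly_normc_bounded p : exists2 B : R, 0 <= B &
  forall h, normc h <= 1 -> normc p.[h] <= B.
Proof.
exists (\sum_(i < size p) normc p`_i); first by rewrite sumr_ge0.
move=> h h1; rewrite horner_coef (le_trans (normc_sum _ _ _)) //.
apply: ler_sum => i _; rewrite normcM normcX ler_piMr // exprn_ile1 //.
Qed.

Lemma jet_at_poly p z0 : jet_at (fun z => p.[z]) z0.
Proof.
move=> n; exists (p \Po (z0%:P + 'X)), 0, 1; split=> // h _.
by rewrite horner_comp !hornerE subrr normc0.
Qed.

Lemma jet_at_add f g z0 : jet_at f z0 -> jet_at g z0 ->
  jet_at (fun z => f z + g z) z0.
Proof.
move=> hf hg n; have [p [C [d [C0 d0 d1 hp]]]] := hf n.
have [q [C' [d' [C0' d0' d1' hq]]]] := hg n.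
exists (p + q), (C + C'), (Num.min d d'); split.
- exact: addr_ge0.
- by rewrite lt_min d0.
- by rewrite ge_min d1.
move=> h; rewrite lt_min => /andP[hd hd']; rewrite hornerD opprD addrACA.
by rewrite (le_trans (normc_triangle _ _)) // mulrDl lerD ?hp ?hq.
Qed.

Lemma jet_at_mul f g z0 : jet_at f z0 -> jet_at g z0 ->
  jet_at (fun z => f z * g z) z0.
Proof.
move=> hf hg n; have [p [C [d [C0 d0 d1 hp]]]] := hf n.
have [q [C' [d' [C0' d0' d1' hq]]]] := hg n.
have [B B0 hB] := poly_normc_bounded p.
have [B' B0' hB'] := poly_normc_bounded q.
exists (p * q), (C * (C' + B') + B * C'), (Num.min d d'); split.
- by rewrite addr_ge0 ?mulr_ge0 ?addr_ge0.
- by rewrite lt_min d0.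
- by rewrite ge_min d1.
move=> h; rewrite lt_min => /andP[hd hd']; rewrite hornerM.
have h1 : normc h <= 1 by rewrite (le_trans (ltW hd)).
have hn1 : normc h ^+ n <= 1 by rewrite exprn_ile1.
have -> : f (z0 + h) * g (z0 + h) - p.[h] * q.[h] =
  (f (z0 + h) - p.[h]) * g (z0 + h) + p.[h] * (g (z0 + h) - q.[h]) by ring.
apply: le_trans (normc_triangle _ _) _; rewrite !normcM mulrDl; apply: lerD.
  rewrite mulrAC; apply: ler_pM => //; first exact: hp.
  apply: le_trans (normc_triangleB _ q.[h]) _; apply: lerD; last exact: hB'.
  by apply: le_trans (hq _ hd') _; rewrite ler_piMr.
by rewrite -mulrA; apply: ler_pM => //; [exact: hB|exact: hq].
Qed.

Lemma jet_at_inv z0 : z0 != 0 -> jet_at (fun z => z^-1) z0.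
Proof.
move=> z0n0 n; have nz : 0 < normc z0 by rewrite normc_gt0.
(* Truncated geometric series of 1 / (z0 + h). Its exact defect is (- h / z0)^n / (z0 + h), and |h|
   < |z0| / 2 keeps the denominator at least |z0| / 2 in modulus. *)
pose p : {poly R[i]} := z0^-1 *: \sum_(i < n) (- z0^-1 *: 'X) ^+ i.
exists p, (2 / normc z0 ^+ n.+1), (Num.min 1 (normc z0 / 2)); split.
- by rewrite divr_ge0 // exprn_ge0 // ltW.
- by rewrite lt_min ltr01 divr_gt0.
- by rewrite ge_min lexx.
move=> h; rewrite lt_min => /andP[_ hz].
have zh : normc z0 / 2 <= normc (z0 + h).
  have := normc_triangleB z0 (- h); rewrite opprK normc_opp; lra.
have zhn0 : z0 + h != 0.
  by rewrite -normc_gt0 (lt_le_trans _ zh) // divr_gt0.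
have ph : (z0 + h) * p.[h] = 1 - (- h / z0) ^+ n.
  rewrite /p hornerZ horner_sum.
  under eq_bigr => i _ do rewrite horner_exp hornerZ hornerX.
  rewrite mulrA mulrDl mulfV //.
  have -> : - h / z0 = - z0^-1 * h by rewrite mulNr mulrC mulNr.
  by rewrite -[RHS]opprB subrX1 -mulNr opprB mulNr opprK [h * _]mulrC.
have -> : (z0 + h)^-1 - p.[h] = (- h / z0) ^+ n / (z0 + h).
  apply: (mulfI zhn0); rewrite mulrBr ph mulfV // mulrCA mulfV // mulr1; ring.
rewrite normcM normcX !normcM !normcV normc_opp expr_div_n exprSr.
have -> : 2 / (normc z0 ^+ n * normc z0) * normc h ^+ n =
   normc h ^+ n / normc z0 ^+ n * (normc z0 / 2)^-1.
  by field; rewrite gt_eqF //= expf_neq0 // gt_eqF.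
rewrite ler_wpM2l ?divr_ge0 ?exprn_ge0 // lef_pV2 ?posrE ?divr_gt0 //.
by rewrite (lt_le_trans _ zh) ?divr_gt0.
Qed.

Lemma jet_at_comp_scale f w z0 : normc w <= 1 -> jet_at f (w * z0) ->
  jet_at (fun z => f (w * z)) z0.
Proof.
move=> w1 hf n; have [p [C [d [C0 d0 d1 hp]]]] := hf n.
exists (p \Po (w *: 'X)), C, d; split=> // h hd.
have wh : normc (w * h) <= normc h by rewrite normcM ler_piMl.
rewrite horner_comp !hornerE mulrDr (le_trans (hp _ (le_lt_trans wh hd))) //.
by rewrite ler_wpM2l // lerXn2r ?nnegrE.
Qed.

Lemma jet_at_eq f g z0 e : 0 < e ->
  (forall h, normc h < e -> f (z0 + h) = g (z0 + h)) -> jet_at f z0 -> jet_at g z0.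
Proof.
move=> e0 fg hf n; have [p [C [d [C0 d0 d1 hp]]]] := hf n.
exists p, C, (Num.min d e); split=> //.
- by rewrite lt_min d0.
- by rewrite ge_min d1.
by move=> h; rewrite lt_min => /andP[hd he]; rewrite -fg // hp.
Qed.

(* The polynomials of all orders agree at 0, so a single value removes the
   singularity of the difference quotient. *)
Lemma jet_at_divX f : jet_at f 0 -> exists a,
  jet_at (fun z => if z == 0 then a else (f z - f 0) / z) 0.
Proof.
move=> hf.
have hq n : exists q : {poly R[i]}, exists C d : R, [/\ 0 <= C, 0 < d, d <= 1 &
  forall h, normc h < d -> h != 0 ->
    normc ((f h - f 0) / h - q.[h]) <= C * normc h ^+ n].
  have [p [C [d [C0 d0 d1 hp]]]] := hf n.+1.
  have p0 : p.[0] = f 0.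
    have := hp 0; rewrite normc0 addr0 => /(_ d0); rewrite exprS mul0r mulr0.
    by move=> h0; apply/esym/subr0_eq/eq0_normc/le_anti; rewrite h0 normc_ge0.
  have /factor_theorem[q pq] : root (p - (f 0)%:P) 0.
    by rewrite /root !hornerE p0 subrr.
  rewrite subr0 in pq.
  exists q, C, d; split=> // h hd hn0.
  have hq : h * q.[h] = p.[h] - f 0.
    by have := congr1 (horner^~ h) pq; rewrite !hornerE => ->; rewrite mulrC.
  have nh : 0 < normc h by rewrite normc_gt0.
  have -> : (f h - f 0) / h - q.[h] = (f h - p.[h]) / h.
    by apply: (mulfI hn0); rewrite mulrBr hq; field.
  rewrite normcM normcV ler_pdivrMr // -mulrA -exprSr.
  by have := hp h hd; rewrite add0r.
have [q1 [C1 [d1 [C10 d10 d11 hq1]]]] := hq 1%N.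
exists (q1.[0]) => n.
have [q [C [d [C0 d0 dle1 hqn]]]] := hq n.+1.
(* Both polynomials lie within O(e) of the same quotient at h = e. A gap D at 0 would give D <= (C +
   C1 + B) e, contradicting the choice of e below D / K. *)
have q0 : q.[0] = q1.[0].
  apply/eqP/negPn/negP => ne.
  have /factor_theorem[r qr] : root (q - q1 - (q.[0] - q1.[0])%:P) 0.
    by rewrite /root !hornerE subrr.
  have [B B0 hB] := poly_normc_bounded r.
  pose D := normc (q.[0] - q1.[0]).
  have D0 : 0 < D by rewrite normc_gt0 subr_eq0.
  pose K := C + C1 + B + 1; have K0 : 0 < K by rewrite ltr_wpDl // !addr_ge0.
  pose e := Num.min (Num.min d d1) (D / K) / 2.
  have m0 : 0 < Num.min (Num.min d d1) (D / K) by rewrite !lt_min d0 d10 divr_gt0.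
  have e0 : 0 < e by rewrite divr_gt0.
  have : e < Num.min (Num.min d d1) (D / K) by rewrite ltr_pdivrMr // ltr_pMr // ltr1n.
  rewrite !lt_min -andbA => /and3P[ed ed1]; rewrite ltr_pdivlMr // => eK.
  have ne0 : normc (e%:C) = e by rewrite normc_real gtr0_norm.
  have en0 : e%:C != 0 by rewrite -normc_gt0 ne0.
  have e1 : e <= 1 by rewrite (le_trans (ltW ed)).
  have h1 := hqn e%:C; rewrite ne0 in h1; have {h1} := h1 ed en0 => h1.
  have h2 := hq1 e%:C; rewrite ne0 in h2; have {h2} := h2 ed1 en0; rewrite expr1 => h2.
  have h1' : normc ((f e%:C - f 0) / e%:C - q.[e%:C]) <= C * e.
    by rewrite (le_trans h1) // ler_wpM2l // exprS ler_piMr ?exprn_ile1 // ltW.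
  have h3 : q.[e%:C] - q1.[e%:C] - (q.[0] - q1.[0]) = r.[e%:C] * e%:C.
    by have := congr1 (horner^~ e%:C) qr; rewrite subr0 !hornerE => ->.
  have h4 : D <= C * e + C1 * e + B * e.
    rewrite /D; set a := q.[0] - q1.[0] in h3 *; set u := (f e%:C - f 0) / e%:C in h1' h2.
    have -> : a = - (u - q.[e%:C]) + (u - q1.[e%:C]) + - (r.[e%:C] * e%:C).
      by rewrite -h3; ring.
    apply: le_trans (normc_triangle _ _) _; apply: lerD.
      by apply: le_trans (normc_triangle _ _) _; apply: lerD; rewrite ?normc_opp.
    by rewrite normc_opp normcM ne0; apply: ler_wpM2r; [exact: ltW|apply: hB; rewrite ne0].
  suff : D < D by rewrite ltxx.
  apply: le_lt_trans h4 _; rewrite -!mulrDl; apply: le_lt_trans eK.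
  by rewrite mulrC; apply: ler_wpM2l; [exact: ltW|rewrite /K lerDl].
exists q, C, d; split=> // h hd; rewrite add0r.
have [->|hn0] := eqVneq h 0; first by rewrite q0 subrr normc0 mulr_ge0 ?exprn_ge0.
apply: le_trans (hqn h hd hn0) _; rewrite ler_wpM2l // exprS ler_piMl ?exprn_ge0 //.
exact: le_trans (ltW hd) dle1.
Qed.

Lemma jet_at_continuous f z0 : jet_at f z0 ->
  forall e : R, 0 < e -> exists2 d : R, 0 < d &
    forall h, normc h < d -> normc (f (z0 + h) - f z0) < e.
Proof.
move=> hf e e0; have [p [C [d [C0 d0 d1 hp]]]] := hf 1%N.
have p0 : p.[0] = f z0.
  have := hp 0; rewrite normc0 addr0 => /(_ d0); rewrite expr1 mulr0.
  by move=> h0; apply/esym/subr0_eq/eq0_normc/le_anti; rewrite h0 normc_ge0.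
have /factor_theorem[r pr] : root (p - (f z0)%:P) 0.
  by rewrite /root !hornerE p0 subrr.
have [B B0 hB] := poly_normc_bounded r.
have K0 : 0 < C + B + 1 by rewrite ltr_wpDl // addr_ge0.
exists (Num.min d (e / (C + B + 1))); first by rewrite lt_min d0 divr_gt0.
move=> h; rewrite lt_min ltr_pdivlMr // => /andP[hd hK].
have hr : p.[h] - f z0 = r.[h] * h.
  by have := congr1 (horner^~ h) pr; rewrite !hornerE subr0 => ->.
have -> : f (z0 + h) - f z0 = (f (z0 + h) - p.[h]) + r.[h] * h by rewrite -hr; ring.
apply: le_lt_trans (normc_triangle _ _) _.
apply: (@le_lt_trans _ _ (C * normc h + B * normc h)).
  apply: lerD; first by have := hp _ hd; rewrite expr1.
  by rewrite normcM ler_wpM2r // hB // (le_trans (ltW hd)).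
by rewrite -mulrDl; apply: le_lt_trans hK; rewrite mulrC ler_wpM2l // lerDl.
Qed.

End Jets.

(** * The maximum principle *)

Section MaximumPrinciple.
Context {R : realType}.
Implicit Types (f g G : R[i] -> R[i]) (z w h : R[i]) (r B C d e t : R).

(** Taken in [R * R], where compactness follows from that of a product of segments. *)
Definition plane_disc_closed r : set (R * R) :=
  [set p | p.1 ^+ 2 + p.2 ^+ 2 <= r ^+ 2].

Lemma sqsum_continuous : continuous (fun p : R * R => p.1 ^+ 2 + p.2 ^+ 2).
Proof.
move=> p; apply: cvgD.
  apply: (@continuous_comp _ _ _ fst (fun x : R => x ^+ 2)); first exact: cvg_fst.
  exact: exprn_continuous.
apply: (@continuous_comp _ _ _ snd (fun x : R => x ^+ 2)); first exact: cvg_snd.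
exact: exprn_continuous.
Qed.

Lemma plane_disc_closed_compact r : 0 <= r -> compact (plane_disc_closed r).
Proof.
move=> r0; apply: (@subclosed_compact _ _ (`[-r, r] `*` `[-r, r])).
- rewrite (_ : plane_disc_closed r = (fun p : R * R => p.1 ^+ 2 + p.2 ^+ 2) @^-1` `]-oo, r ^+ 2]).
    apply: closed_comp; last exact: lray_closed.
    by move=> p _; exact: sqsum_continuous.
  by apply/seteqP; split => p /=; rewrite /plane_disc_closed /= in_itv.
- by apply: compact_setX; exact: segment_compact.
move=> [x y] /= ; rewrite /plane_disc_closed /= !in_itv /= => h.
have hx : x ^+ 2 <= r ^+ 2 by rewrite (le_trans _ h) // lerDl sqr_ge0.
have hy : y ^+ 2 <= r ^+ 2 by rewrite (le_trans _ h) // lerDr sqr_ge0.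
by split; rewrite -ler_norml -(ler_pXn2r (n := 2)) ?nnegrE ?real_normK ?num_real.
Qed.

Lemma complex_of_pairE z : complex_of_pair (complex.Re z, complex.Im z) = z.
Proof. by case: z. Qed.

Lemma jet_at_normc_continuous G (p : R * R) : jet_at G (complex_of_pair p) ->
  {for p, continuous (fun q => normc (G (complex_of_pair q)))}.
Proof.
move=> jG; apply/cvgrPdist_lt => e e0.
have [d d0 hd] := jet_at_continuous jG e0.
have d20 : 0 < d / 2 by rewrite divr_gt0.
exists (ball p.1 (d / 2), ball p.2 (d / 2)).
  by split; exact: nbhsx_ballx.
move=> q [/= b1 b2].
pose h := complex_of_pair q - complex_of_pair p.
have hE : complex_of_pair q = complex_of_pair p + h by rewrite /h addrC subrK.
have nh : normc h < d.
  apply: le_lt_trans (normc_Re_Im _) _; rewrite [ltRHS]splitr.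
  by rewrite /h /complex_of_pair /=; apply: ltrD; rewrite distrC.
have := hd h nh; rewrite -hE => H; apply: le_lt_trans H.
by rewrite distrC normc_sub_le.
Qed.

(** For e > 0 the term in |z|^2 is the perturbation that will exclude an interior maximum; e = 0
    gives boundedness on smaller discs. *)
Lemma unit_disc_continuous_max G r e : 0 <= r -> r < 1 ->
  (forall z, unit_disc z -> jet_at G z) ->
  exists2 z0, normc z0 <= r & forall z, normc z <= r ->
    normc (G z) + e * normc z ^+ 2 <= normc (G z0) + e * normc z0 ^+ 2.
Proof.
move=> r0 r1 jG.
pose u (p : R * R) := normc (G (complex_of_pair p)) + e * (p.1 ^+ 2 + p.2 ^+ 2).
have inK z : (plane_disc_closed r (complex.Re z, complex.Im z)) <-> (normc z <= r).
  rewrite /plane_disc_closed /= -normc_sqr; split => [|h].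
    by rewrite ler_pXn2r ?nnegrE.
  by rewrite ler_pXn2r ?nnegrE.
have [||p0 p0K hmax] := @compact_EVT_max _ R u _ _ (plane_disc_closed_compact r0).
- by exists (0, 0); rewrite /plane_disc_closed /= expr0n /= addr0 sqr_ge0.
- apply: continuous_in_subspaceT => p; rewrite inE => pK.
  apply: cvgD; last first.
    by apply: cvgMr; exact: sqsum_continuous.
  apply: jet_at_normc_continuous; apply: jG; apply: le_lt_trans r1; apply/inK.
  by case: p pK.
rewrite inE in p0K.
exists (complex_of_pair p0); first by apply/inK; case: p0 p0K {hmax}.
move=> z /inK zK; have := hmax _ (mem_set zK).
by rewrite /u complex_of_pairE !normc_sqr; case: (p0).
Qed.

Lemma jet_at_quadratic f z0 : jet_at f z0 -> exists a1 a2 C d,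
  [/\ 0 <= C, 0 < d & forall h, normc h < d ->
    normc (f (z0 + h) - (f z0 + a1 * h + a2 * h ^+ 2)) <= C * normc h ^+ 3].
Proof.
move=> hf; have [p [C [d [C0 d0 d1 hp]]]] := hf 3%N.
have [B B0 hB] := poly_normc_bounded (drop_poly 3 p).
have pE h : p.[h] = p`_0 + p`_1 * h + p`_2 * h ^+ 2 + (drop_poly 3 p).[h] * h ^+ 3.
  rewrite -{1}(poly_take_drop 3 p) hornerD hornerM hornerXn /take_poly horner_poly.
  by rewrite !big_ord_recr big_ord0 /= add0r expr0 expr1 mulr1.
have p0 : p`_0 = f z0.
  have := hp 0; rewrite normc0 addr0 => /(_ d0); rewrite pE !exprS !mul0r !mulr0 !addr0.
  by move=> h0; apply/esym/subr0_eq/eq0_normc/le_anti; rewrite h0 normc_ge0.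
exists p`_1, p`_2, (C + B), d; split=> // [|h hd]; first exact: addr_ge0.
have -> : f (z0 + h) - (f z0 + p`_1 * h + p`_2 * h ^+ 2) =
  (f (z0 + h) - p.[h]) + (drop_poly 3 p).[h] * h ^+ 3 by rewrite pE p0; ring.
apply: le_trans (normc_triangle _ _) _; rewrite mulrDl; apply: lerD; first exact: hp.
by rewrite normcM normcX ler_wpM2r ?exprn_ge0 // hB // (le_trans (ltW hd)).
Qed.

(* Averaging over h, ih, -h, -ih kills the linear and quadratic terms of G,
   while it raises [|z|^2] by exactly [|h|^2]. *)
Lemma maximum_principle G r B : 0 <= r -> r < 1 ->
  (forall z, unit_disc z -> jet_at G z) ->
  (forall z, normc z = r -> normc (G z) <= B) ->
  forall z, normc z <= r -> normc (G z) <= B.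
Proof.
move=> r0 r1 jG hB z zr; apply/ler_addgt0Pr => e e0.
have [z0 z0r hmax] := unit_disc_continuous_max e r0 r1 jG.
have hz := hmax z zr.
have ez : 0 <= e * normc z ^+ 2 by rewrite mulr_ge0 ?exprn_ge0 // ltW.
have [z0eq|z0lt] := eqVneq (normc z0) r.
  have h1 := hB _ z0eq.
  have h2 : e * normc z0 ^+ 2 <= e.
    by apply: ler_piMr; [exact: ltW|apply: exprn_ile1; rewrite // z0eq ltW].
  lra.
(* At an interior maximum the average over four points gives e t^2 <= C t^3, where C bounds the
   cubic error; t is chosen with (C + 1) t < e, which makes this impossible. *)
exfalso; have {}z0lt : normc z0 < r by rewrite lt_neqAle z0lt.
have [a1 [a2 [C [d [C0 d0 hq]]]]] := jet_at_quadratic (jG z0 (lt_trans z0lt r1)).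
have C1 : 0 < C + 1 by rewrite ltr_wpDl.
pose m := Num.min (Num.min d (r - normc z0)) (e / (C + 1)).
have m0 : 0 < m by rewrite !lt_min d0 subr_gt0 z0lt divr_gt0.
have [t t0 tm] : exists2 t : R, 0 < t & t < m.
  by exists (m / 2); [rewrite divr_gt0|rewrite ltr_pdivrMr // ltr_pMr // ltr1n].
move: tm; rewrite !lt_min ltr_pdivlMr // -andbA => /and3P[td tr te].
have point w : normc w = t ->
    normc (G (z0 + w)) + e * normc (z0 + w) ^+ 2 <= normc (G z0) + e * normc z0 ^+ 2.
  move=> wt; apply: hmax; apply: le_trans (normc_triangle _ _) _; lra.
have quad w : normc w = t ->
    normc (G (z0 + w) - (G z0 + a1 * w + a2 * w ^+ 2)) <= C * t ^+ 3.
  by move=> wt; have := hq w; rewrite wt; apply.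
pose w1 : R[i] := t +i* 0; pose w2 : R[i] := 0 +i* t.
have n1 : normc w1 = t by rewrite /= expr0n addr0 sqrtr_sqr gtr0_norm.
have n2 : normc w2 = t by rewrite /= expr0n add0r sqrtr_sqr gtr0_norm.
have n3 : normc (- w1) = t by rewrite normc_opp.
have n4 : normc (- w2) = t by rewrite normc_opp.
have w22 : w2 ^+ 2 = - w1 ^+ 2.
  by rewrite !expr2; apply/eqP; rewrite eq_complex /=; apply/andP; split; apply/eqP; ring.
pose E w := G (z0 + w) - (G z0 + a1 * w + a2 * w ^+ 2).
have G4 : G z0 *+ 4 = (G (z0 + w1) + G (z0 + w2) + G (z0 - w1) + G (z0 - w2)) -
  (E w1 + E w2 + E (- w1) + E (- w2)).
  by rewrite /E !sqrrN w22; ring.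
have N4 : normc (G z0) *+ 4 = normc (G z0 *+ 4).
  exact/esym/normcMn.
have {}N4 : normc (G z0) *+ 4 <= normc (G (z0 + w1)) + normc (G (z0 + w2)) +
   normc (G (z0 - w1)) + normc (G (z0 - w2)) + (C * t ^+ 3) *+ 4.
  rewrite N4 G4; apply: le_trans (normc_triangle _ _) _; rewrite normc_opp.
  apply: lerD.
    do 2! (apply: le_trans (normc_triangle _ _) _; rewrite lerD2r).
    exact: normc_triangle.
  have -> : (C * t ^+ 3) *+ 4 = C * t ^+ 3 + C * t ^+ 3 + C * t ^+ 3 + C * t ^+ 3 by ring.
  do 3! (apply: le_trans (normc_triangle _ _) _; apply: lerD; last exact: quad).
  exact: quad.
have S4 : normc (z0 + w1) ^+ 2 + normc (z0 + w2) ^+ 2 + normc (z0 - w1) ^+ 2 +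
   normc (z0 - w2) ^+ 2 = (normc z0 ^+ 2 + t ^+ 2) *+ 4.
  by rewrite !normc_sqr /w1 /w2; case: (z0) => x y /=; ring.
have P1 := point _ n1; have P2 := point _ n2.
have P3 := point _ n3; have P4 := point _ n4.
have et : e * t ^+ 2 <= C * t ^+ 3.
  have S4e := congr1 ( *%R e) S4; rewrite !mulrDr in S4e; lra.
have : e * t ^+ 2 < e * t ^+ 2; last by rewrite ltxx.
apply: le_lt_trans et _; rewrite exprS mulrA ltr_pM2r ?exprn_gt0 //.
by apply: le_lt_trans te; rewrite mulrC ler_wpM2l ?(ltW t0) // lerDl.
Qed.

End MaximumPrinciple.

(** * Taylor expansion on the disc *)

Section RootsOfUnity.
Context {R : realType}.
Implicit Types (s t : R).

Definition cis t : R[i] := cos t +i* sin t.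

Lemma cisD s t : cis (s + t) = cis s * cis t.
Proof.
by apply/eqP; rewrite eq_complex /= cosD sinD; apply/andP; split; apply/eqP; ring.
Qed.

Lemma cis0 : cis 0 = 1 :> R[i].
Proof. by rewrite /cis cos0 sin0. Qed.

Lemma cisMn t n : cis (n%:R * t) = cis t ^+ n.
Proof.
elim: n => [|n IH]; first by rewrite mul0r cis0.
by rewrite exprS -IH -cisD mulrSr mulrDl mul1r addrC.
Qed.

Lemma normc_cis t : normc (cis t) = 1.
Proof. by rewrite /= cos2Dsin2 sqrtr1. Qed.

Lemma cis_2pi : cis (2 * pi) = 1 :> R[i].
Proof. by rewrite mulr_natl /cis cos2pi sin2pi. Qed.

Lemma cis_neq1 t : 0 < t -> t < 2 * pi -> cis t != 1.
Proof.
move=> t0 t2; apply/eqP => -[ct _].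
have s0 : 0 < sin (t / 2) by apply: sin_gt0_pi; rewrite ?divr_gt0 // ltr_pdivrMr // mulrC.
have : cos t = 1 - 2 * sin (t / 2) ^+ 2.
  rewrite {1}(splitr t) cosD -!expr2.
  have := cos2Dsin2 (t / 2); lra.
have : 0 < sin (t / 2) ^+ 2 by rewrite exprn_gt0.
rewrite ct; lra.
Qed.

Definition unity_root N : R[i] := cis (2 * pi / N%:R).

Lemma unity_rootX N : (0 < N)%N -> unity_root N ^+ N = 1.
Proof.
by move=> N0; rewrite -cisMn mulrC divfK ?cis_2pi // pnatr_eq0 -lt0n.
Qed.

Lemma sum_unity_root N k : (0 < N)%N ->
  \sum_(j < N) unity_root N ^+ (j * k) = if (N %| k)%N then N%:R else 0.
Proof.
move=> N0; have uN := unity_rootX N0.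
under eq_bigr => j _ do rewrite mulnC exprM.
case: ifP => [/dvdnP[q ->]|ndiv].
  under eq_bigr => j _ do rewrite mulnC exprM uN !expr1n.
  by rewrite sumr_const card_ord.
have u1 : unity_root N ^+ k != 1.
  rewrite (divn_eq k N) exprD mulnC exprM uN expr1n mul1r /unity_root -cisMn.
  have Nr : 0 < N%:R :> R by rewrite ltr0n.
  apply: cis_neq1.
    by rewrite !mulr_gt0 ?invr_gt0 ?pi_gt0 // ltr0n lt0n -/(dvdn N k) ndiv.
  rewrite mulrCA gtr_pMr ?mulr_gt0 ?pi_gt0 //.
  by rewrite ltr_pdivrMr // mul1r ltr_nat ltn_pmod.
have /eqP : (unity_root N ^+ k - 1) * (\sum_(j < N) (unity_root N ^+ k) ^+ j) = 0.
  by rewrite -subrX1 -exprM mulnC exprM uN expr1n subrr.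
by rewrite mulf_eq0 subr_eq0 (negbTE u1) => /eqP.
Qed.

Lemma normc_unity_root N : normc (unity_root N) = 1.
Proof. exact: normc_cis. Qed.

End RootsOfUnity.

(** * Iterated division by z and convergence of the Taylor series *)

Section TaylorSeries.
Context {R : realType}.
Implicit Types (f g : R[i] -> R[i]) (z w : R[i]) (r M : R).

Definition jet_disc f := forall z, unit_disc z -> jet_at f z.

Lemma unit_disc0 : unit_disc (0 : R[i]).
Proof. by rewrite /unit_disc /mkset normc0 ltr01. Qed.

Lemma jet_at_cst a z : jet_at (fun=> a) z.
Proof.
have := jet_at_poly (a%:P) z; rewrite (_ : (fun z => _) = fun=> a) //.
by apply/funext => y; rewrite hornerC.
Qed.

Lemma jet_at_id z : jet_at (fun z => z) z.
Proof.
have := jet_at_poly 'X z; rewrite (_ : (fun z => _) = fun z => z) //.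
by apply/funext => y; rewrite hornerX.
Qed.

Lemma jet_at_sum N (F : nat -> R[i] -> R[i]) z :
  (forall j, jet_at (F j) z) -> jet_at (fun z => \sum_(j < N) F j z) z.
Proof.
move=> hF; elim: N => [|N IH].
  by rewrite (_ : (fun z => _) = fun=> 0);
    [exact: jet_at_cst|apply/funext => y; rewrite big_ord0].
rewrite (_ : (fun z => _) = fun z => \sum_(j < N) F j z + F N z).
  exact: jet_at_add.
by apply/funext => y; rewrite big_ord_recr.
Qed.

Lemma jet_disc_divX f : jet_disc f -> exists g, jet_disc g /\
  forall z, f z = f 0 + z * g z.
Proof.
move=> hf; have [a ha] := jet_at_divX (hf 0 unit_disc0).
set g := (fun z => _) in ha; exists g; split; last first.
  move=> z; rewrite /g; case: eqVneq => [->|z0]; first by rewrite mul0r addr0.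
  by rewrite mulrC divfK // addrC subrK.
move=> z zD; have [->//|z0] := eqVneq z 0.
have nz : 0 < normc z by rewrite normc_gt0.
(* The ball of radius |z| about z avoids 0, the only point where the two expressions may differ. *)
apply: (@jet_at_eq _ (fun y => (f y + (- f 0)) * y^-1) _ _ _ nz).
  move=> h hz; rewrite /g; case: eqVneq => // zh.
  by move: hz; rewrite -(addr0_eq zh) normc_opp ltxx.
apply: jet_at_mul; last exact: jet_at_inv.
by apply: jet_at_add; [exact: hf|exact: jet_at_cst].
Qed.

(** G n is the n-th iterate of division by z, so G m 0 is the m-th Taylor coefficient and z^n G n
    the exact remainder; nothing is said yet about its size. *)
Lemma jet_disc_taylor f : jet_disc f -> exists G : nat -> R[i] -> R[i],
  (forall n, jet_disc (G n)) /\
  forall z n, f z = psum (fun m => G m 0) z n + z ^+ n * G n z.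
Proof.
move=> hf.
have [T hT] : exists T : (R[i] -> R[i]) -> (R[i] -> R[i]), forall g, jet_disc g ->
    jet_disc (T g) /\ forall z, g z = g 0 + z * T g z.
  have /choice[T hT] : forall g, exists g', jet_disc g ->
      jet_disc g' /\ forall z, g z = g 0 + z * g' z.
    move=> g; have [/jet_disc_divX[g' hg']|ng] := pselect (jet_disc g).
      by exists g'.
    by exists g.
  by exists T.
exists (fun n => iter n T f).
have hG n : jet_disc (iter n T f) by elim: n => //= n IH; have [] := hT _ IH.
split=> // z; elim=> [|n IH]; first by rewrite /psum big_ord0 add0r expr0 mul1r.
rewrite {1}IH /psum big_ord_recr /= -addrA; congr (_ + _).
have [_ /(_ z) {1}->] := hT _ (hG n); rewrite exprSr; ring.
Qed.

(* Averaging over the (n+1)-st roots of unity isolates the coefficient of order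
   n, up to terms of order larger than n. *)
Lemma cauchy_estimate f (G : nat -> R[i] -> R[i]) r M n : 0 < r -> r < 1 ->
  (forall n, jet_disc (G n)) ->
  (forall z n, f z = psum (fun m => G m 0) z n + z ^+ n * G n z) ->
  (forall z, normc z = r -> normc (f z) <= M) ->
  normc (G n 0) * r ^+ n <= M.
Proof.
move=> r0 r1 hG fG hM; set c := fun m => G m 0.
pose w : R[i] := unity_root n.+1.
have nw j : normc (w ^+ j) = 1 by rewrite normcX normc_unity_root expr1n.
(* The weight w^j selects the indices m with m + 1 divisible by n + 1, hence only m = n among m <=
   n. K is the weighted average of f divided by z^n, written so that it makes sense at 0, where it
   equals c n. *)
pose K z := c n + n.+1%:R^-1 * (z * \sum_(j < n.+1) w ^+ j * G n.+1 (w ^+ j * z)).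
have Nn0 : n.+1%:R != 0 :> R[i] by rewrite pnatr_eq0.
have KE z : z ^+ n * K z = n.+1%:R^-1 * \sum_(j < n.+1) w ^+ j * f (w ^+ j * z).
  have -> : \sum_(j < n.+1) w ^+ j * f (w ^+ j * z) =
      \sum_(j < n.+1) \sum_(m < n.+1) c m * z ^+ m * w ^+ (j * m.+1) +
      z ^+ n.+1 * \sum_(j < n.+1) w ^+ j * G n.+1 (w ^+ j * z).
    rewrite mulr_sumr -big_split /=; apply: eq_bigr => j _.
    rewrite (fG _ n.+1) mulrDr; congr (_ + _).
      rewrite /psum mulr_sumr; apply: eq_bigr => m _.
      by rewrite exprMn mulnS exprD [w ^+ (j * m)]exprM /c; ring.
    rewrite exprMn -exprM mulnC exprM unity_rootX // expr1n mul1r; ring.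
  rewrite exchange_big /= (bigD1 ord_max) //= [X in _ + X + _]big1 ?addr0.
    rewrite -mulr_sumr sum_unity_root // dvdnn /K exprSr mulrDr; field.
    by rewrite addrC natr1.
  move=> m mn; rewrite -mulr_sumr sum_unity_root //.
  case: ifP => [|_]; last by rewrite mulr0.
  move=> /dvdn_leq; move=> /(_ isT); rewrite ltnS => nm.
  case/negP: mn; rewrite -val_eqE /= eqn_leq; apply/andP; split; last exact: nm.
  by have := ltn_ord m; rewrite ltnS.
have KJ : jet_disc K.
  move=> z zD; apply: jet_at_add; first exact: jet_at_cst.
  apply: jet_at_mul; first exact: jet_at_cst.
  apply: jet_at_mul; first exact: jet_at_id.
  apply: (@jet_at_sum _ (fun j z => w ^+ j * G n.+1 (w ^+ j * z))) => j.
  apply: jet_at_mul; first exact: jet_at_cst.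
  apply: jet_at_comp_scale; first by rewrite nw.
  by apply: hG; rewrite /unit_disc /= normcM nw mul1r.
have := @maximum_principle _ K r (M / r ^+ n) (ltW r0) r1 KJ.
move=> /(_ _ 0); rewrite normc0 => H.
rewrite -ler_pdivlMr ?exprn_gt0 //.
have -> : G n 0 = K 0 by rewrite /K mul0r mulr0 addr0.
apply: H; last exact: ltW.
move=> z zr; rewrite ler_pdivlMr ?exprn_gt0 //.
have -> : normc (K z) * r ^+ n = normc (z ^+ n * K z).
  by rewrite normcM normcX zr mulrC.
rewrite KE normcM normcV -[n.+1%:R](rmorph_nat (real_complex R)) normc_real.
rewrite ger0_norm // mulrC ler_pdivrMr ?ltr0n //.
apply: le_trans (normc_sum _ _ _) _.
have -> : M * n.+1%:R = \sum_(j < n.+1) M by rewrite sumr_const card_ord mulr_natr.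
apply: ler_sum => j _; rewrite normcM nw mul1r; apply: hM.
by rewrite normcM nw mul1r.
Qed.

Lemma jet_disc_bounded f r : 0 <= r -> r < 1 -> jet_disc f ->
  exists2 M, 0 <= M & forall z, normc z <= r -> normc (f z) <= M.
Proof.
move=> r0 r1 hf; have [z0 _ hz0] := unit_disc_continuous_max 0 r0 r1 hf.
exists (normc (f z0)) => // z zr.
by have := hz0 z zr; rewrite !mul0r !addr0.
Qed.

(** With s the square root of q, n s^n is at most a geometric sum, so n q^n <= s^n / (1 - s). *)
Lemma natmul_geometric_cvg0 (q : R) : 0 <= q -> q < 1 ->
  (fun n => n%:R * q ^+ n) @ \oo --> (0 : R).
Proof.
move=> q0 q1; pose s := Num.sqrt q.
have s0 : 0 <= s by exact: sqrtr_ge0.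
have s1 : s < 1 by rewrite -sqrtr1 ltr_sqrt.
have qs : q = s * s by rewrite -expr2 sqr_sqrtr.
have d0 : 0 < 1 - s by rewrite subr_gt0.
have bnd n : n%:R * q ^+ n <= (1 - s)^-1 * s ^+ n.
  rewrite qs exprMn mulrA ler_wpM2r ?exprn_ge0 //.
  have := geometric_tail s0 s1 (leq0n n); rewrite expr0 div1r big_mkord.
  apply: le_trans; have -> : n%:R * s ^+ n = \sum_(j < n) s ^+ n.
    by rewrite sumr_const card_ord mulr_natl.
  by apply: ler_sum => j _; apply: ler_wiXn2l; [exact: s0|exact: ltW|exact: ltnW].
have B : (fun n => (1 - s)^-1 * s ^+ n) @ \oo --> (0 : R).
  by rewrite -(mulr0 (1 - s)^-1); apply: cvgMr; apply: cvg_expr; rewrite ger0_norm.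
apply: (squeeze_cvgr (f := fun=> 0) _ _ B); last exact: cvg_cst.
by near=> n; rewrite mulr_ge0 ?exprn_ge0 //= bnd.
Unshelve. all: by end_near. Qed.

(** On a circle of radius r the remainder z^n G n is at most (n + 1) M by the Cauchy estimates. The
    maximum principle carries the resulting bound on G n inside, where z^n gains (|z| / r)^n against
    the linear growth. *)
Theorem analytic_disc_series f : (forall z, unit_disc z -> analytic_at f z) ->
  exists c, forall z, unit_disc z -> psum_cvg c z (f z).
Proof.
move=> af; have hf : jet_disc f by move=> z zD; exact/analytic_jet/af.
have [G [hG fG]] := jet_disc_taylor hf.
exists (fun m => G m 0) => z zD; set c := fun m => G m 0.
have [r zr r1] : exists2 r, normc z < r & r < 1.
  by exists ((normc z + 1) / 2); move: zD; rewrite /unit_disc /= => zD; lra.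
have r0 : 0 < r by rewrite (le_lt_trans _ zr).
have [M M0 hM] := jet_disc_bounded (ltW r0) r1 hf.
have hc n : normc (c n) * r ^+ n <= M.
  by apply: (cauchy_estimate (f := f)) => // y yr; apply: hM; rewrite yr.
have rem n : normc (psum c z n - f z) <= M * (n.+1%:R * (normc z / r) ^+ n).
  rewrite normc_distC (fG z n) addrAC subrr add0r normcM normcX.
  suff : normc (G n z) <= n.+1%:R * M / r ^+ n.
    move=> h; apply: le_trans (ler_wpM2l (exprn_ge0 n (normc_ge0 z)) h) _.
    by rewrite le_eqVlt; apply/orP; left; apply/eqP; rewrite expr_div_n; ring.
  apply: (maximum_principle (ltW r0) r1 (hG n)) (ltW zr) => y yr.
  rewrite ler_pdivlMr ?exprn_gt0 // mulrC -yr -normcX -normcM.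
  have -> : y ^+ n * G n y = f y - psum c y n by rewrite (fG y n) addrAC subrr add0r.
  apply: le_trans (normc_triangle _ _) _; rewrite normc_opp mulrS mulrDl mul1r.
  apply: lerD; first by apply: hM; rewrite yr.
  apply: le_trans (normc_sum _ _ _) _.
  have -> : n%:R * M = \sum_(j < n) M by rewrite sumr_const card_ord mulr_natl.
  by apply: ler_sum => j _; rewrite normcM normcX yr.
have q0 : 0 <= normc z / r by rewrite divr_ge0 // ltW.
have q1 : normc z / r < 1 by rewrite ltr_pdivrMr // mul1r.
have B : (fun n => M * (n.+1%:R * (normc z / r) ^+ n)) @ \oo --> (0 : R).
  have B0 : (fun n => (normc z / r) ^+ n + n%:R * (normc z / r) ^+ n) @ \oo --> (0 : R).
    rewrite -[X in _ --> X](addr0 (0 : R)); apply: cvgD; last exact: natmul_geometric_cvg0.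
    by apply: cvg_expr; rewrite ger0_norm.
  rewrite -[X in _ --> X](mulr0 M); apply: cvgMr.
  by under eq_fun => n do rewrite mulrS mulrDl mul1r.
apply: (squeeze_cvgr (f := fun=> 0) _ _ B); last exact: cvg_cst.
by near=> n; rewrite normc_ge0 rem.
Unshelve. all: by end_near. Qed.

End TaylorSeries.

(** * Rotations and discs in the plane *)

Section PlaneMeasure.
Context {R : realType}.
Local Notation lebR := (@lebesgue_measure R).
Local Notation mR := (measurableTypeR R).
Local Notation leb2 := (lebR \x lebR)%E.

Lemma lebesgue_measure_translate (a : R) (A : set mR) : measurable A ->
  lebR ((fun x : mR => x + a : mR) @^-1` A) = lebR A.
Proof.
move=> mA; apply/esym.
rewrite -[RHS]/(pushforward lebR (fun x : mR => x + a : mR) A).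
apply/lebesgue_measure_unique => //=; first exact: measurable_funD.
move=> mf _ [[x y]] _ <-; rewrite /pushforward.
have -> : (fun x : mR => x + a : mR) @^-1` `]x, y]%classic = `]x - a, y - a]%classic.
  by apply/seteqP; split => z /=; rewrite !in_itv /= ltrBlDr lerBrDr.
rewrite !lebesgue_measure_itv /= !lte_fin ltrD2r.
by case: ifP => // _; rewrite -!EFinB; congr EFin; ring.
Qed.

Definition shear_snd (g : mR -> mR) (p : mR * mR) : mR * mR := (p.1, p.2 + g p.1).
Definition shear_fst (g : mR -> mR) (p : mR * mR) : mR * mR := (p.1 + g p.2, p.2).

Lemma shear_snd_measure (g : mR -> mR) (A : set (mR * mR)) : measurable A ->
  leb2 (shear_snd g @^-1` A) = leb2 A.
Proof.
move=> mA; rewrite /= /product_measure1; apply: eq_integral => x _ /=.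
rewrite -[in RHS](@lebesgue_measure_translate (g x)); last exact: measurable_xsection.
by congr (lebR _); apply/seteqP; split => y /=; rewrite /xsection /= !inE.
Qed.

(** A horizontal shear translates the sections at a fixed second coordinate, so its invariance is
    read off from the product taken in the other order. *)
Lemma leb2_ysections (A : set (mR * mR)) : measurable A ->
  leb2 A = (lebR \x^ lebR)%E A.
Proof.
move=> mA; apply: product_measure_unique => // B C mB mC.
exact: product_measure2E.
Qed.

Lemma measurable_shear_fst (g : mR -> mR) : measurable_fun setT g ->
  measurable_fun setT (shear_fst g).
Proof.
move=> mg; apply: measurable_fun_pair => //.
by apply: measurable_funD => //; exact: measurableT_comp.
Qed.

Lemma measurable_shear_snd (g : mR -> mR) : measurable_fun setT g ->
  measurable_fun setT (shear_snd g).
Proof.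
move=> mg; apply: measurable_fun_pair => //.
by apply: measurable_funD => //; exact: measurableT_comp.
Qed.

Lemma shear_fst_measure (g : mR -> mR) (A : set (mR * mR)) :
  measurable_fun setT g -> measurable A -> leb2 (shear_fst g @^-1` A) = leb2 A.
Proof.
move=> mg mA; rewrite !leb2_ysections //; last first.
  by rewrite -[X in measurable X]setTI; apply: measurable_shear_fst.
rewrite /= /product_measure2; apply: eq_integral => y _ /=.
rewrite -[in RHS](@lebesgue_measure_translate (g y)); last exact: measurable_ysection.
by congr (lebR _); apply/seteqP; split => x /=; rewrite /ysection /= !inE.
Qed.

Definition rotation (c s : R) (p : mR * mR) : mR * mR :=
  (c * p.1 - s * p.2, s * p.1 + c * p.2).

(* A rotation of angle other than pi is a product of three shears. *)
Lemma rotation_measure (c s : R) (A : set (mR * mR)) : c ^+ 2 + s ^+ 2 = 1 ->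
  1 + c != 0 -> measurable A -> leb2 (rotation c s @^-1` A) = leb2 A.
Proof.
(* This is the tangent of half the angle. *)
move=> cs c1 mA; pose t := s / (1 + c).
pose gx (y : mR) : mR := - t * y; pose gy (x : mR) : mR := s * x.
have mgx : measurable_fun setT gx by exact: measurable_funM.
have mgy : measurable_fun setT gy by exact: measurable_funM.
have E : rotation c s = shear_fst gx \o (shear_snd gy \o shear_fst gx).
  have ts : t * s = 1 - c.
    have -> : t * s = s ^+ 2 / (1 + c) by rewrite /t; ring.
    by apply: (mulIf c1); rewrite divfK //; move: cs => /(canRL (addKr _)) ->; ring.
  have tc : t * (1 + c) = s by rewrite /t divfK.
  have cE : 1 - t * s = c by rewrite ts; ring.
  apply/funext => -[x y]; rewrite /rotation /shear_fst /shear_snd /gx /gy /=.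
  congr (_, _).
    have -> : x + - t * y + - t * (y + s * (x + - t * y)) =
      (1 - t * s) * x - t * (1 + (1 - t * s)) * y by ring.
    by rewrite cE tc.
  have -> : y + s * (x + - t * y) = s * x + (1 - t * s) * y by ring.
  by rewrite cE.
rewrite E !comp_preimage shear_fst_measure //; last first.
  rewrite -[X in measurable X]setTI; apply: measurable_shear_snd => //.
  by rewrite -[X in measurable X]setTI; exact: measurable_shear_fst.
rewrite shear_snd_measure ?shear_fst_measure //.
by rewrite -[X in measurable X]setTI; exact: measurable_shear_fst.
Qed.

Lemma measurable_rotation (c s : R) : measurable_fun setT (rotation c s).
Proof.
by apply: measurable_fun_pair; [apply: measurable_funB|apply: measurable_funD];
  apply: measurable_funM.
Qed.

Definition open_disc (r : R) : set (mR * mR) := [set p | p.1 ^+ 2 + p.2 ^+ 2 < r ^+ 2].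

Lemma measurable_open_disc r : measurable (open_disc r).
Proof.
have m : measurable_fun setT (fun p : mR * mR => p.1 ^+ 2 + p.2 ^+ 2).
  by apply: measurable_funD; apply: measurable_funX.
have -> : open_disc r = (fun p : mR * mR => p.1 ^+ 2 + p.2 ^+ 2) @^-1` `]-oo, r ^+ 2[.
  by apply/seteqP; split => p /=; rewrite /open_disc /= in_itv.
by rewrite -[X in measurable X]setTI; apply: m.
Qed.

Lemma integral_semicircle (r : R) : 0 < r ->
  (\int[lebR]_(x in `[(- r)%R, r]) (2 * Num.sqrt (r ^+ 2 - x ^+ 2))%:E)%E = (pi * r ^+ 2)%:E.
Proof.
move=> r0; pose F (t : R) := r * sin t; pose G (x : R) := 2 * Num.sqrt (r ^+ 2 - x ^+ 2).
have pi2 : - (pi / 2) < pi / 2 :> R by have := pi_gt0 R; lra.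
have dF t : is_derive t (1 : R) F (r * cos t) by apply: is_derive_eq.
have F' : F^`()%classic = (fun t => r * cos t).
  by apply/funext => t; rewrite derive1E derive_val.
have cF t : {for t, continuous F}.
  by apply: differentiable_continuous; apply/derivable1_diffP.
have cF' t : {for t, continuous F^`()%classic}.
  by rewrite F'; apply: cvgMr; exact: continuous_cos.
have Fa : F (- (pi / 2)) = - r by rewrite /F sinN sin_pihalf mulrN1.
have Fb : F (pi / 2) = r by rewrite /F sin_pihalf mulr1.
have cG : continuous G.
  move=> x; have cs : {for x, continuous (@Num.sqrt R \o (fun x => r ^+ 2 - x ^+ 2))}.
    apply: continuous_comp; last exact: sqrt_continuous.
    by apply: cvgB; [exact: cvg_cst|exact: exprn_continuous].
  by apply: cvgMr; exact: cs.
have := @integration_by_substitution_increasing R F G _ _ (ltW pi2).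
rewrite Fa Fb => ->.
(* A primitive of 2 r^2 cos^2 t, the integrand after the substitution x = r sin t. *)
- pose K (t : R) := r ^+ 2 * (t + sin t * cos t).
  have dK t : is_derive t (1 : R) K (r ^+ 2 * (1 + (sin t * - sin t + cos t * cos t))).
    by apply: is_derive_eq.
  transitivity (\int[lebR]_(t in `[(- (pi / 2))%R, (pi / 2)%R]) (2 * r ^+ 2 * cos t ^+ 2)%:E)%E.
    apply: eq_integral => t; rewrite inE /= in_itv /= => ht; congr EFin.
    rewrite F' /G /F /= fctE /=.
    have -> : r ^+ 2 - (r * sin t) ^+ 2 = (r * cos t) ^+ 2.
      by have := cos2Dsin2 t; rewrite !exprMn => /(canRL (addrK _)) ->; ring.
    rewrite sqrtr_sqr ger0_norm; first by ring.
    by rewrite mulr_ge0 ?(ltW r0) // cos_ge0_pihalf.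
  rewrite (@continuous_FTC2 R (fun t : R => 2 * r ^+ 2 * cos t ^+ 2) K _ _ pi2).
  + rewrite /K sinN cosN sin_pihalf cos_pihalf -EFinB; congr EFin; field=> //.
  + have cc : continuous ((fun x => x ^+ 2) \o @cos R).
      by move=> t; apply: continuous_comp; [exact: continuous_cos|exact: exprn_continuous].
    have cc2 : continuous (fun t : R => 2 * r ^+ 2 * cos t ^+ 2).
      by move=> t; apply: cvgMr; exact: cc.
    exact: continuous_subspaceT.
  + have cK t : {for t, continuous K}.
      by apply: differentiable_continuous; apply/derivable1_diffP.
    split=> [t _|//|].
    * by have [] := dK t.
    * exact/cvg_at_right_filter/cK.
    * exact/cvg_at_left_filter/cK.
  + move=> t _; rewrite derive1E derive_val.
    by rewrite mulrN -!expr2 sin2cos2; ring.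
- by move=> x y hx hy xy; rewrite /F ltr_pM2l // ltr_sin.
- by move=> t _; exact: cF'.
- by apply/cvg_ex; eexists; apply/cvg_at_right_filter/cF'.
- by apply/cvg_ex; eexists; apply/cvg_at_left_filter/cF'.
- split=> [t _||].
  + by have [] := dF t.
  + exact/cvg_at_right_filter/cF.
  + exact/cvg_at_left_filter/cF.
- exact: continuous_subspaceT.
Qed.

Lemma area_open_disc r : 0 <= r -> leb2 (open_disc r) = (pi * r ^+ 2)%:E.
Proof.
rewrite le_eqVlt => /predU1P[<-|r0].
  rewrite (_ : open_disc 0 = set0) ?measure0 ?expr0n ?mulr0 //.
  apply/seteqP; split => // p; rewrite /open_disc /= expr0n /= ltNge.
  by rewrite addr_ge0 ?sqr_ge0.
rewrite -integral_semicircle // /= /product_measure1 [RHS]integral_mkcond.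
apply: eq_integral => x _ /=.
have -> : xsection (open_disc r) x =
    `](- Num.sqrt (r ^+ 2 - x ^+ 2)), (Num.sqrt (r ^+ 2 - x ^+ 2))[%classic.
  apply/seteqP; split => y; rewrite /xsection /= inE /open_disc /= in_itv /= -ltr_norml.
    rewrite addrC -ltrBrDr => h; rewrite -sqrtr_sqr ltr_sqrt //.
    exact: le_lt_trans (sqr_ge0 y) h.
  rewrite -sqrtr_sqr => h; rewrite addrC -ltrBrDr.
  have [h0|h0] := leP (r ^+ 2 - x ^+ 2) 0.
    by move: h; rewrite (ler0_sqrtr h0) ltNge sqrtr_ge0.
  by move: h; rewrite ltr_sqrt.
rewrite lebesgue_measure_itv /= lte_fin.
set S := Num.sqrt (r ^+ 2 - x ^+ 2).
have s0 : 0 <= S by exact: sqrtr_ge0.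
have -> : (if - S < S then (S%:E + (- - S)%:E)%E else 0%E) = (2 * S)%:E.
  case: ifPn => [_|]; first by rewrite -EFinD opprK -mulr2n mulr_natl.
  by rewrite -leNgt => h; congr EFin; lra.
(* Outside the segment the section is empty, in agreement with the value 0 of the square root at a
   negative number. *)
rewrite patchE; case: ifPn => // /negP xr.
rewrite /S ler0_sqrtr ?mulr0 //.
rewrite subr_le0 leNgt; apply/negP => h; apply: xr; rewrite inE /= in_itv /=.
by rewrite -ler_norml -(ler_pXn2r (n := 2)) ?nnegrE ?real_normK ?num_real ?(ltW r0) ?(ltW h).
Qed.

End PlaneMeasure.

(** * Complex-valued integrals *)

Section ComplexIntegral.
Context d (T : measurableType d) (R : realType).
Implicit Types (D : set T) (F G : T -> R[i]) (g : T -> R).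
Local Notation Re := (@complex.Re R).
Local Notation Im := (@complex.Im R).

Definition cmeasurable D F :=
  measurable_fun D (fun x => Re (F x)) /\ measurable_fun D (fun x => Im (F x)).

Lemma cReD (x y : R[i]) : Re (x + y) = Re x + Re y. Proof. by case: x y => ? ? []. Qed.
Lemma cImD (x y : R[i]) : Im (x + y) = Im x + Im y. Proof. by case: x y => ? ? []. Qed.
Lemma cReM (x y : R[i]) : Re (x * y) = Re x * Re y - Im x * Im y.
Proof. by case: x y => ? ? []. Qed.
Lemma cImM (x y : R[i]) : Im (x * y) = Re x * Im y + Im x * Re y.
Proof. by case: x y => ? ? []. Qed.
Lemma cRe_conj (x : R[i]) : Re (x^*) = Re x. Proof. by case: x. Qed.
Lemma cIm_conj (x : R[i]) : Im (x^*) = - Im x. Proof. by case: x. Qed.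

Lemma complex_ext (x y : R[i]) : Re x = Re y -> Im x = Im y -> x = y.
Proof. by case: x y => a b [a' b'] /= -> ->. Qed.

Lemma cmeasurable_cst D (a : R[i]) : cmeasurable D (fun=> a).
Proof. by split; exact: measurable_cst. Qed.

Lemma cmeasurable_add D F G : cmeasurable D F -> cmeasurable D G ->
  cmeasurable D (fun x => F x + G x).
Proof.
move=> [h1 h2] [h3 h4]; split.
  by under eq_fun => x do rewrite cReD; exact: measurable_funD.
by under eq_fun => x do rewrite cImD; exact: measurable_funD.
Qed.

Lemma cmeasurable_mul D F G : cmeasurable D F -> cmeasurable D G ->
  cmeasurable D (fun x => F x * G x).
Proof.
move=> [h1 h2] [h3 h4]; split.
  by under eq_fun => x do rewrite cReM; apply: measurable_funB; exact: measurable_funM.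
by under eq_fun => x do rewrite cImM; apply: measurable_funD; exact: measurable_funM.
Qed.

Lemma cmeasurable_conj D F : cmeasurable D F -> cmeasurable D (fun x => (F x)^*).
Proof.
move=> [h1 h2]; split; first by under eq_fun => x do rewrite cRe_conj.
by under eq_fun => x do rewrite cIm_conj; exact: measurable_funN.
Qed.

Lemma cmeasurable_sum D n (F : nat -> T -> R[i]) :
  (forall i, cmeasurable D (F i)) -> cmeasurable D (fun x => \sum_(i < n) F i x).
Proof.
move=> hF; elim: n => [|n IH].
  by under eq_fun => x do rewrite big_ord0; exact: cmeasurable_cst.
by under eq_fun => x do rewrite big_ord_recr /=; exact: cmeasurable_add.
Qed.

Lemma cmeasurable_exp D F n : cmeasurable D F -> cmeasurable D (fun x => F x ^+ n).
Proof.
move=> hF; elim: n => [|n IH].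
  by under eq_fun => x do rewrite expr0; exact: cmeasurable_cst.
by under eq_fun => x do rewrite exprS; exact: cmeasurable_mul.
Qed.

Lemma cmeasurable_normc D F : cmeasurable D F ->
  measurable_fun D (fun x => normc (F x) ^+ 2).
Proof.
move=> [h1 h2]; under eq_fun => x do rewrite normc_sqr.
by apply: measurable_funD; exact: measurable_funX.
Qed.

Lemma cvgc_Re (u : nat -> R[i]) l : (fun n => normc (u n - l)) @ \oo --> (0 : R) ->
  (fun n => Re (u n)) @ \oo --> Re l.
Proof.
move=> h; apply/cvgrPdist_lt => e e0; have /cvgrPdist_lt /(_ e e0) := h.
apply: filterS => n; rewrite sub0r normrN ger0_norm // => H.
rewrite distrC; apply: le_lt_trans H.
by apply: le_trans (Re_normc _); case: (u n) l {h} => a b [].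
Qed.

Lemma cvgc_Im (u : nat -> R[i]) l : (fun n => normc (u n - l)) @ \oo --> (0 : R) ->
  (fun n => Im (u n)) @ \oo --> Im l.
Proof.
move=> h; apply/cvgrPdist_lt => e e0; have /cvgrPdist_lt /(_ e e0) := h.
apply: filterS => n; rewrite sub0r normrN ger0_norm // => H.
rewrite distrC; apply: le_lt_trans H.
by apply: le_trans (Im_normc _); case: (u n) l {h} => a b [].
Qed.

Lemma cvgc_Re_Im (u : nat -> R[i]) l : (fun n => Re (u n)) @ \oo --> Re l ->
  (fun n => Im (u n)) @ \oo --> Im l ->
  (fun n => normc (u n - l)) @ \oo --> (0 : R).
Proof.
move=> h1 h2.
have h : (fun n => `|Re (u n) - Re l| + `|Im (u n) - Im l|) @ \oo --> (0 : R).
  have -> : (0 : R) = `|Re l - Re l| + `|Im l - Im l| by rewrite !subrr !normr0 addr0.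
  by apply: cvgD; apply: cvg_norm; apply: cvgB => //; exact: cvg_cst.
apply: (squeeze_cvgr (f := fun=> 0) _ _ h); last exact: cvg_cst.
near=> n; rewrite normc_ge0 /=.
by apply: le_trans (normc_Re_Im _) _; case: (u n) l {h1 h2 h} => a b [].
Unshelve. all: by end_near. Qed.

Lemma cmeasurable_cvg D (F : nat -> T -> R[i]) G :
  (forall n, cmeasurable D (F n)) ->
  (forall x, D x -> (fun n => normc (F n x - G x)) @ \oo --> (0 : R)) ->
  cmeasurable D G.
Proof.
move=> hF hc; split.
  apply: (measurable_fun_cvg (h := fun n x => Re (F n x))) => [n|x Dx].
    by case: (hF n).
  exact/cvgc_Re/hc.
apply: (measurable_fun_cvg (h := fun n x => Im (F n x))) => [n|x Dx].
  by case: (hF n).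
exact/cvgc_Im/hc.
Qed.

Variable mu : {measure set T -> \bar R}.

Definition cintegrable D F :=
  mu.-integrable D (EFin \o (fun x => Re (F x))) /\
  mu.-integrable D (EFin \o (fun x => Im (F x))).

Definition cintegral D F : R[i] :=
  Rintegral mu D (fun x => Re (F x)) +i* Rintegral mu D (fun x => Im (F x)).

Lemma cintegrable_dominated D F g : measurable D -> cmeasurable D F ->
  mu.-integrable D (EFin \o g) -> (forall x, D x -> normc (F x) <= g x) ->
  cintegrable D F.
Proof.
move=> mD [m1 m2] ig hg; split.
  apply: (le_integrable mD _ _ ig) => [|x Dx]; first exact/measurable_EFinP.
  rewrite /= lee_fin (le_trans (Re_normc _)) //.
  by rewrite (le_trans (hg x Dx)) // ler_norm.
apply: (le_integrable mD _ _ ig) => [|x Dx]; first exact/measurable_EFinP.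
rewrite /= lee_fin (le_trans (Im_normc _)) //.
by rewrite (le_trans (hg x Dx)) // ler_norm.
Qed.

Lemma eq_cintegral D F G : (forall x, D x -> F x = G x) ->
  cintegral D F = cintegral D G.
Proof.
by move=> h; rewrite /cintegral; congr (_ +i* _); apply: eq_Rintegral => x;
  rewrite inE => Dx; rewrite h.
Qed.

Lemma eq_cintegrable D F G : measurable D -> (forall x, D x -> F x = G x) ->
  cintegrable D F -> cintegrable D G.
Proof.
move=> mD h [h1 h2]; split; [apply: eq_integrable h1|apply: eq_integrable h2] => // x;
  by rewrite inE /= => Dx; rewrite h.
Qed.

Lemma cintegrableD D F G : measurable D -> cintegrable D F -> cintegrable D G ->
  cintegrable D (fun x => F x + G x).
Proof.
move=> mD [h1 h2] [h3 h4]; split.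
  apply: (eq_integrable mD _ _ _ (integrableD mD h1 h3)) => x _ /=.
  by rewrite cReD EFinD.
apply: (eq_integrable mD _ _ _ (integrableD mD h2 h4)) => x _ /=.
by rewrite cImD EFinD.
Qed.

Lemma cintegralD D F G : measurable D -> cintegrable D F -> cintegrable D G ->
  cintegral D (fun x => F x + G x) = cintegral D F + cintegral D G.
Proof.
move=> mD [h1 h2] [h3 h4]; apply: complex_ext; rewrite ?cReD ?cImD /=.
  rewrite -RintegralD //; apply: eq_Rintegral => x _; exact: cReD.
rewrite -RintegralD //; apply: eq_Rintegral => x _; exact: cImD.
Qed.

Lemma cintegral_conj D F : measurable D -> cintegrable D F ->
  cintegral D (fun x => (F x)^*) = (cintegral D F)^*.
Proof.
move=> mD [h1 h2]; apply: complex_ext; rewrite ?cRe_conj ?cIm_conj /=.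
  by apply: eq_Rintegral => x _; exact: cRe_conj.
rewrite -mulN1r -RintegralZl //; apply: eq_Rintegral => x _.
by rewrite cIm_conj mulN1r.
Qed.

Lemma integrable_lincomb D (a b : R) (u v : T -> R) : measurable D ->
  mu.-integrable D (EFin \o u) -> mu.-integrable D (EFin \o v) ->
  mu.-integrable D (EFin \o (fun x => a * u x + b * v x)) /\
  Rintegral mu D (fun x => a * u x + b * v x) = a * Rintegral mu D u + b * Rintegral mu D v.
Proof.
move=> mD hu hv.
have h1 : mu.-integrable D (EFin \o (fun x => a * u x)).
  by apply: (eq_integrable mD _ _ _ (integrableZl mD a hu)) => x _; rewrite /= EFinM.
have h2 : mu.-integrable D (EFin \o (fun x => b * v x)).
  by apply: (eq_integrable mD _ _ _ (integrableZl mD b hv)) => x _; rewrite /= EFinM.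
split; last by rewrite RintegralD // !RintegralZl.
by apply: (eq_integrable mD _ _ _ (integrableD mD h1 h2)) => x _; rewrite /= EFinD.
Qed.

Lemma cintegrableZ_cintegralZ D F (a : R[i]) : measurable D -> cintegrable D F ->
  cintegrable D (fun x => a * F x) /\ cintegral D (fun x => a * F x) = a * cintegral D F.
Proof.
move=> mD [h1 h2].
have [i1 e1] := integrable_lincomb (Re a) (- Im a) mD h1 h2.
have [i2 e2] := integrable_lincomb (Im a) (Re a) mD h1 h2.
split; first split.
- by apply: (eq_integrable mD _ _ _ i1) => x _ /=; rewrite cReM mulNr.
- by apply: (eq_integrable mD _ _ _ i2) => x _ /=; rewrite cImM addrC.
apply: complex_ext; rewrite ?cReM ?cImM /=.
  rewrite -mulNr -e1; apply: eq_Rintegral => x _; by rewrite cReM mulNr.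
by rewrite [RHS]addrC -e2; apply: eq_Rintegral => x _; rewrite cImM addrC.
Qed.

Lemma cintegrableZ D F a : measurable D -> cintegrable D F ->
  cintegrable D (fun x => a * F x).
Proof. by move=> mD h; have [] := cintegrableZ_cintegralZ a mD h. Qed.

Lemma cintegralZ D F a : measurable D -> cintegrable D F ->
  cintegral D (fun x => a * F x) = a * cintegral D F.
Proof. by move=> mD h; have [] := cintegrableZ_cintegralZ a mD h. Qed.

Lemma cintegrable0 D : cintegrable D (fun=> 0).
Proof. by split; exact: integrable0. Qed.

Lemma cintegral0 D : cintegral D (fun=> 0) = 0.
Proof. by rewrite /cintegral /Rintegral /= integral0. Qed.

Lemma cintegrable_sum D n (F : nat -> T -> R[i]) : measurable D ->
  (forall i, (i < n)%N -> cintegrable D (F i)) ->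
  cintegrable D (fun x => \sum_(i < n) F i x).
Proof.
move=> mD; elim: n => [|n IH] hF.
  by under eq_fun => x do rewrite big_ord0; exact: cintegrable0.
under eq_fun => x do rewrite big_ord_recr /=.
by apply: cintegrableD => //; [apply: IH => i /ltnW; exact: hF|exact: hF].
Qed.

Lemma cintegral_sum D n (F : nat -> T -> R[i]) : measurable D ->
  (forall i, (i < n)%N -> cintegrable D (F i)) ->
  cintegral D (fun x => \sum_(i < n) F i x) = \sum_(i < n) cintegral D (F i).
Proof.
move=> mD; elim: n => [|n IH] hF.
  by rewrite big_ord0; under eq_fun => x do rewrite big_ord0; exact: cintegral0.
under eq_fun => x do rewrite big_ord_recr /=.
rewrite cintegralD ?IH ?big_ord_recr //.
- by move=> i /ltnW; exact: hF.
- by apply: cintegrable_sum => // i /ltnW; exact: hF.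
- exact: hF.
Qed.

Lemma Rintegral_dominated_cvg D (u : nat -> T -> R) (v g : T -> R) : measurable D ->
  (forall n, measurable_fun D (u n)) -> measurable_fun D v ->
  (forall x, D x -> (fun n => u n x) @ \oo --> v x) ->
  mu.-integrable D (EFin \o g) -> (forall n x, D x -> `|u n x| <= g x) ->
  (fun n => Rintegral mu D (u n)) @ \oo --> Rintegral mu D v.
Proof.
move=> mD mu_ mv uv ig ug.
have [] := @dominated_convergence _ _ _ mu D mD (fun n => EFin \o u n) (EFin \o v) (EFin \o g).
- by move=> n; exact/measurable_EFinP.
- exact/measurable_EFinP.
- by apply: aeW => x Dx; apply: cvg_EFin; [exact: nearW|exact: uv].
- exact: ig.
- by apply: aeW => x n Dx /=; rewrite lee_fin ug.
move=> iv _ h; apply: fine_cvg; rewrite fineK //; exact: (integrable_fin_num mD iv).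
Qed.

Lemma cintegral_dominated_cvg D (F : nat -> T -> R[i]) G g : measurable D ->
  (forall n, cmeasurable D (F n)) ->
  (forall x, D x -> (fun n => normc (F n x - G x)) @ \oo --> (0 : R)) ->
  mu.-integrable D (EFin \o g) -> (forall n x, D x -> normc (F n x) <= g x) ->
  (fun n => normc (cintegral D (F n) - cintegral D G)) @ \oo --> (0 : R).
Proof.
move=> mD mF FG ig Fg; have [mG1 mG2] := cmeasurable_cvg mF FG.
apply: cvgc_Re_Im => /=.
  apply: (Rintegral_dominated_cvg (g := g)) => // [n|x Dx|n x Dx].
  - by case: (mF n).
  - exact/cvgc_Re/FG.
  - by apply: le_trans (Re_normc _) _; exact: Fg.
apply: (Rintegral_dominated_cvg (g := g)) => // [n|x Dx|n x Dx].
- by case: (mF n).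
- exact/cvgc_Im/FG.
- by apply: le_trans (Im_normc _) _; exact: Fg.
Qed.

End ComplexIntegral.

(** * Integrals of monomials over discs *)

Section MonomialIntegrals.
Context {R : realType}.
Local Notation mR := (measurableTypeR R).
Local Notation mu := (@dA R).
Implicit Types (r : R) (p : R * R).

Lemma dAE (A : set (mR * mR)) :
  mu A = ((pi^-1)%:E * (@lebesgue_measure R \x @lebesgue_measure R) A)%E.
Proof. by []. Qed.

Lemma dA_open_disc r : 0 <= r -> mu (open_disc r) = (r ^+ 2)%:E.
Proof.
move=> r0; rewrite dAE area_open_disc // -EFinM mulrA mulVf ?mul1r //.
by rewrite gt_eqF ?pi_gt0.
Qed.

Lemma integrable_cst_open_disc r (k : R) : 0 <= r ->
  mu.-integrable (open_disc r) (EFin \o (fun=> k)).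
Proof.
move=> r0; apply/integrableP; split; first exact: measurable_cst.
under eq_integral => x _ do rewrite /=.
rewrite integral_cst; last exact: measurable_open_disc.
by rewrite dA_open_disc // -EFinM ltry.
Qed.

Lemma normc_open_disc r p : 0 <= r -> open_disc r p <-> normc (complex_of_pair p) < r.
Proof.
move=> r0; rewrite -[X in _ <-> is_true X](ltr_pXn2r (n := 2)) ?nnegrE //.
by rewrite normc_sqr.
Qed.

Lemma plane_disc_open_disc : @plane_disc R = open_disc 1.
Proof.
apply/seteqP; split => p; rewrite /plane_disc /unit_disc /=.
  by move=> h; apply/normc_open_disc.
by move=> /normc_open_disc; exact.
Qed.

Lemma open_disc_sub r s : 0 <= r -> r <= s -> open_disc r `<=` (open_disc s : set (R * R)).
Proof.
move=> r0 rs p; rewrite /open_disc /= => h; apply: lt_le_trans h _.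
by rewrite ler_pXn2r ?nnegrE // (le_trans r0).
Qed.

Lemma cmeasurable_complex_of_pair (D : set (mR * mR)) :
  cmeasurable D (@complex_of_pair R : mR * mR -> R[i]).
Proof.
split; apply: measurable_funTS.
  exact: (measurable_fst : measurable_fun setT (fst : mR * mR -> mR)).
exact: (measurable_snd : measurable_fun setT (snd : mR * mR -> mR)).
Qed.

Definition monomial m n (p : mR * mR) : R[i] :=
  complex_of_pair p ^+ m * (complex_of_pair p)^* ^+ n.

Lemma cmeasurable_monomial D m n : cmeasurable D (monomial m n).
Proof.
have h := cmeasurable_complex_of_pair D.
apply: cmeasurable_mul; first exact: cmeasurable_exp.
by apply: cmeasurable_exp; exact: cmeasurable_conj.
Qed.

Lemma normc_monomial m n p : normc (monomial m n p) = normc (complex_of_pair p) ^+ (m + n).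
Proof. by rewrite normcM !normcX normc_conj exprD. Qed.

Lemma conjc_monomial m n p : (monomial m n p)^* = monomial n m p.
Proof.
rewrite /monomial; move: (complex_of_pair p) => z.
by rewrite rmorphM !rmorphXn /= !conjCK mulrC.
Qed.

Lemma cintegrable_monomial r m n : 0 <= r -> cintegrable mu (open_disc r) (monomial m n).
Proof.
move=> r0.
apply: (cintegrable_dominated _ _ (integrable_cst_open_disc (r ^+ (m + n)) r0)).
- exact: measurable_open_disc.
- exact: cmeasurable_monomial.
move=> p /(normc_open_disc _ r0) h; rewrite normc_monomial.
by rewrite lerXn2r ?nnegrE // ltW.
Qed.

Lemma complex_of_pair_rotation (c s : R) p :
  complex_of_pair (rotation c s p) = (c +i* s) * complex_of_pair p.
Proof. by apply: complex_ext => //=; rewrite addrC. Qed.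

Lemma preimage_rotation_open_disc (c s r : R) : c ^+ 2 + s ^+ 2 = 1 ->
  rotation c s @^-1` open_disc r = open_disc r.
Proof.
move=> cs; apply/seteqP; split => -[x y]; rewrite /open_disc /rotation /=.
  have -> : (c * x - s * y) ^+ 2 + (s * x + c * y) ^+ 2 = (c ^+ 2 + s ^+ 2) * (x ^+ 2 + y ^+ 2) by ring.
  by rewrite cs mul1r.
have -> : (c * x - s * y) ^+ 2 + (s * x + c * y) ^+ 2 = (c ^+ 2 + s ^+ 2) * (x ^+ 2 + y ^+ 2) by ring.
by rewrite cs mul1r.
Qed.

Lemma Rintegral_rotation (c s r : R) (u : mR * mR -> R) : c ^+ 2 + s ^+ 2 = 1 ->
  1 + c != 0 -> measurable_fun setT u ->
  mu.-integrable (open_disc r) (EFin \o (u \o rotation c s)) ->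
  Rintegral mu (open_disc r) (u \o rotation c s) = Rintegral mu (open_disc r) u.
Proof.
move=> cs c1 mf iu; congr fine; apply/esym.
transitivity (\int[pushforward mu (rotation c s)]_(y in open_disc r) (u y)%:E)%E.
  apply: eq_measure_integral; first exact: measurable_rotation.
  move=> mrot A mA _.
  have := rotation_measure cs c1 mA; rewrite /pushforward !dAE => h.
  by rewrite -h.
rewrite (@integral_pushforward _ _ _ _ _ _ (measurable_rotation c s)).
- by rewrite preimage_rotation_open_disc.
- exact/measurable_EFinP.
- by rewrite preimage_rotation_open_disc.
- exact: measurable_open_disc.
Qed.

(** For m > n, rotation by pi / (2 (m - n)) preserves the disc and multiplies the monomial by i, so
    the integral equals i times itself. The angle is at most pi / 2, hence 1 + cos t is nonzero as
    the factorization into shears requires. *)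
Lemma cintegral_monomial_neq r m n : 0 <= r -> m != n ->
  cintegral mu (open_disc r) (monomial m n) = 0.
Proof.
move=> r0 mn.
wlog {mn} lt_nm : m n / (n < m)%N.
  move=> W; case: (ltngtP m n) mn => // mn _; last exact: W.
  have -> : cintegral mu (open_disc r) (monomial m n) =
      (cintegral mu (open_disc r) (monomial n m))^*.
    rewrite -cintegral_conj; [|exact: measurable_open_disc|exact: cintegrable_monomial].
    by apply: eq_cintegral => p _; rewrite conjc_monomial.
  by rewrite W // conjC0.
pose k := (m - n)%N; have k0 : (0 < k)%N by rewrite subn_gt0.
pose t : R := pi / 2 / k%:R.
have tpi : 0 <= t <= pi / 2.
  rewrite divr_ge0 ?divr_ge0 ?pi_ge0 //= ler_pdivrMr ?ltr0n //.
  by rewrite ler_peMr ?divr_ge0 ?pi_ge0 // ler1n.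
have c0 : 0 <= cos t.
  apply: cos_ge0_pihalf; case/andP: tpi => t0 ->; rewrite andbT.
  by apply: le_trans t0; rewrite oppr_le0 divr_ge0 ?pi_ge0.
have cs := cos2Dsin2 t.
have c1 : 1 + cos t != 0 by rewrite gt_eqF // ltr_pwDl.
have uc : cis t * (cis t)^* = 1 by rewrite mul_conj normc_cis expr1n.
have wk : cis t ^+ m * (cis t)^* ^+ n = 'i%C.
  rewrite -(subnK (ltnW lt_nm)) exprD -mulrA -exprMn uc expr1n mulr1 -cisMn.
  by rewrite mulrC divfK ?pnatr_eq0 -?lt0n // /cis cos_pihalf sin_pihalf.
have rotE p : monomial m n (rotation (cos t) (sin t) p) = 'i%C * monomial m n p.
  rewrite /monomial complex_of_pair_rotation -/(cis t).
  by move: (complex_of_pair p) => z; rewrite rmorphM !exprMn -wk; ring.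
have ii : cintegrable mu (open_disc r) (fun p => 'i%C * monomial m n p).
  by apply: cintegrableZ; [exact: measurable_open_disc|exact: cintegrable_monomial].
have E : cintegral mu (open_disc r) (monomial m n) =
    cintegral mu (open_disc r) (fun p => 'i%C * monomial m n p).
  have [m1 m2] := cmeasurable_monomial setT m n.
  have [i1 i2] : cintegrable mu (open_disc r) (monomial m n \o rotation (cos t) (sin t)).
    by apply: eq_cintegrable ii => [|p _]; [exact: measurable_open_disc|rewrite /= rotE].
  transitivity (cintegral mu (open_disc r) (monomial m n \o rotation (cos t) (sin t))).
    exact: (f_equal2 (@Complex R) (esym (Rintegral_rotation cs c1 m1 i1))
      (esym (Rintegral_rotation cs c1 m2 i2))).
  by apply: eq_cintegral => p _; rewrite /= rotE.
have := E; rewrite cintegralZ; [|exact: measurable_open_disc|exact: cintegrable_monomial].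
move=> /eqP; rewrite -subr_eq0 -{1}[cintegral _ _ _]mul1r -mulrBl mulf_eq0.
case/orP=> [|/eqP //]; rewrite subr_eq0 => /eqP [] /eqP.
by rewrite oner_eq0.
Qed.

(** The difference h between g and u^(n+1) / (n+1) satisfies |h b - h a| <= (b^n - a^n) (b - a).
    Over N + 1 equal steps these bounds telescope to u^(n+1) / (N + 1), so h vanishes without any
    differentiability of g. *)
Lemma primitive_monomial n (g : R -> R) : g 0 = 0 ->
  (forall a b, 0 <= a -> a <= b ->
     a ^+ n * (b - a) <= g b - g a /\ g b - g a <= b ^+ n * (b - a)) ->
  forall u, 0 <= u -> g u = u ^+ n.+1 / n.+1%:R.
Proof.
move=> g0 hg u u0; pose G (u : R) := u ^+ n.+1 / n.+1%:R.
have hG a b : 0 <= a -> a <= b ->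
     a ^+ n * (b - a) <= G b - G a /\ G b - G a <= b ^+ n * (b - a).
  move=> a0 ab; have b0 := le_trans a0 ab; have ba0 : 0 <= b - a by rewrite subr_ge0.
  rewrite /G -mulrBl subrXX ler_pdivlMr ?ltr0n // ler_pdivrMr ?ltr0n //.
  have h1 : n.+1%:R * a ^+ n <= \sum_(i < n.+1) b ^+ (n.+1.-1 - i) * a ^+ i.
    have -> : n.+1%:R * a ^+ n = \sum_(i < n.+1) a ^+ n.
      by rewrite sumr_const card_ord mulr_natl.
    apply: ler_sum => i _; have ile : (i <= n)%N by rewrite -ltnS.
    rewrite -[X in a ^+ X <= _](subnK ile) exprD.
    by rewrite ler_wpM2r ?exprn_ge0 // lerXn2r ?nnegrE.
  have h2 : \sum_(i < n.+1) b ^+ (n.+1.-1 - i) * a ^+ i <= n.+1%:R * b ^+ n.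
    have -> : n.+1%:R * b ^+ n = \sum_(i < n.+1) b ^+ n.
      by rewrite sumr_const card_ord mulr_natl.
    apply: ler_sum => i _; have ile : (i <= n)%N by rewrite -ltnS.
    rewrite -[X in _ <= b ^+ X](subnK ile) exprD.
    by rewrite ler_wpM2l ?exprn_ge0 // lerXn2r ?nnegrE.
  split.
    by apply: le_trans (ler_wpM2l ba0 h1); rewrite le_eqVlt; apply/orP; left; apply/eqP; ring.
  by apply: le_trans (ler_wpM2l ba0 h2) _; rewrite le_eqVlt; apply/orP; left; apply/eqP; ring.
pose h x := g x - G x.
have hh a b : 0 <= a -> a <= b -> `|h b - h a| <= (b ^+ n - a ^+ n) * (b - a).
  move=> a0 ab; have [g1 g2] := hg a b a0 ab; have [G1 G2] := hG a b a0 ab.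
  by rewrite /h ler_norml; apply/andP; split; lra.
have bound N : `|h u| <= u ^+ n.+1 / N.+1%:R.
  pose x (j : nat) := u * j%:R / N.+1%:R.
  have x0 j : 0 <= x j by rewrite divr_ge0 // mulr_ge0.
  have xS j : x j.+1 - x j = u / N.+1%:R by rewrite /x -mulrBl -mulrBr mulrS; ring.
  have xle j : x j <= x j.+1 by rewrite -subr_ge0 xS divr_ge0.
  have step j : `|h (x j)| <= x j ^+ n * (u / N.+1%:R).
    elim: j => [|j IH].
      rewrite /x mulr0 mul0r /h g0 /G exprS !mul0r subrr normr0.
      by rewrite mulr_ge0 ?exprn_ge0 // divr_ge0.
    have := hh _ _ (x0 j) (xle j); rewrite xS => H.
    have -> : h (x j.+1) = (h (x j.+1) - h (x j)) + h (x j) by ring.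
    apply: le_trans (ler_normD _ _) _.
    by apply: le_trans (lerD H IH) _; rewrite -mulrDl subrK.
  have := step N.+1; rewrite /x mulfK ?pnatr_eq0 //.
  by rewrite mulrA -exprSr.
apply/eqP; rewrite -subr_eq0 -/(G u) -/(h u) -normr_eq0; apply/negPn/negP => hn.
have hp : 0 < `|h u| by rewrite lt0r hn normr_ge0.
have := bound (Num.truncn (u ^+ n.+1 / `|h u|)).
rewrite ler_pdivlMr ?ltr0n // mulrC -ler_pdivlMr // leNgt.
by rewrite truncnS_gt.
Qed.

(** Parametrized by the squared radius, the annulus between a and b has [dA]-measure b - a, and
    |z|^(2n) lies between a^n and b^n on it. This replaces polar coordinates. *)
Lemma Rintegral_normc_open_disc n r : 0 <= r ->
  Rintegral mu (open_disc r) (fun p => normc (complex_of_pair p) ^+ (n + n)) =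
  r ^+ (2 * n.+1) / n.+1%:R.
Proof.
move=> r0.
pose q (p : mR * mR) : R := normc (complex_of_pair p) ^+ (n + n).
pose g u := Rintegral mu (open_disc (Num.sqrt u)) q.
have qE p : q p = complex.Re (monomial n n p).
  rewrite /q /monomial -exprMn mul_conj -rmorphXn /= -exprM; congr (_ ^+ _); lia.
have qi s : 0 <= s -> mu.-integrable (open_disc s) (EFin \o q).
  move=> s0; have [h _] := cintegrable_monomial n n s0.
  by apply: eq_integrable h; [exact: measurable_open_disc|move=> p _ /=; rewrite -qE].
suff H : g (r ^+ 2) = (r ^+ 2) ^+ n.+1 / n.+1%:R.
  by move: H; rewrite /g sqrtr_sqr ger0_norm // -exprM.
apply: primitive_monomial; last exact: sqr_ge0.
  rewrite /g sqrtr0 (_ : open_disc 0 = set0) ?Rintegral_set0 //.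
  apply/seteqP; split => // p; rewrite /open_disc /= expr0n /= ltNge.
  by rewrite addr_ge0 ?sqr_ge0.
move=> a b a0 ab; set A := open_disc (Num.sqrt a); set B := open_disc (Num.sqrt b).
have b0 := le_trans a0 ab.
have AB : A `<=` B by apply: open_disc_sub; [exact: sqrtr_ge0|rewrite ler_sqrt].
have mA : measurable A by exact: measurable_open_disc.
have mB : measurable B by exact: measurable_open_disc.
have mBA : measurable (B `\` A) by exact: measurableD.
have BE : B = A `|` (B `\` A) by rewrite setDUK.
have dis : [disjoint A & B `\` A] by apply/disj_setPS => p [pA [_]].
have split_int (u : mR * mR -> R) : mu.-integrable B (EFin \o u) ->
    Rintegral mu B u = Rintegral mu A u + Rintegral mu (B `\` A) u.
  by move=> iu; rewrite {1}BE Rintegral_setU // -BE.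
have one : Rintegral mu (B `\` A) (fun=> 1) = b - a.
  have := split_int (fun=> 1) (integrable_cst_open_disc 1 (sqrtr_ge0 b)).
  rewrite !Rintegral_cst // !dA_open_disc ?sqrtr_ge0 // !sqr_sqrtr //= !mul1r.
  by move=> ->; rewrite addrC addKr.
have cst k : Rintegral mu (B `\` A) (fun=> k) = k * (b - a).
  by rewrite -one !Rintegral_cst // mul1r.
have sub : B `\` A `<=` B by move=> p [].
have ci k : mu.-integrable (B `\` A) (EFin \o (fun=> k)).
  exact: integrableS mB mBA sub (integrable_cst_open_disc k (sqrtr_ge0 b)).
have qBA : mu.-integrable (B `\` A) (EFin \o q).
  exact: integrableS mB mBA sub (qi _ (sqrtr_ge0 b)).
have -> : g b - g a = Rintegral mu (B `\` A) q.
  by have := split_int q (qi _ (sqrtr_ge0 b)); rewrite /g => ->; rewrite addrC addKr.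
have qn p : q p = (normc (complex_of_pair p) ^+ 2) ^+ n.
  by rewrite /q -exprM; congr (_ ^+ _); lia.
split; rewrite -cst.
  apply: (le_Rintegral mBA (ci _) qBA) => p [pB pA].
  rewrite qn lerXn2r ?nnegrE ?exprn_ge0 // leNgt; apply/negP => h; apply: pA.
  by rewrite /A /open_disc /mkset sqr_sqrtr //; move: h; rewrite normc_sqr.
apply: (le_Rintegral mBA qBA (ci _)) => p [pB pA].
rewrite qn lerXn2r ?nnegrE ?exprn_ge0 // ltW //.
by move: pB; rewrite /B /open_disc /mkset sqr_sqrtr // normc_sqr.
Qed.

Lemma cintegral_monomial r m n : 0 <= r ->
  cintegral mu (open_disc r) (monomial m n) =
  if m == n then (r ^+ (2 * n.+1) / n.+1%:R)%:C else 0.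
Proof.
move=> r0; case: eqVneq => [->|mn]; last exact: cintegral_monomial_neq.
have mE p : monomial n n p = (normc (complex_of_pair p) ^+ (n + n))%:C.
  by rewrite /monomial -exprMn mul_conj -rmorphXn /= -exprM; congr ((_ ^+ _)%:C); lia.
apply: complex_ext => /=.
  rewrite -Rintegral_normc_open_disc //; apply: eq_Rintegral => p _.
  by rewrite mE.
under eq_Rintegral => p _ do rewrite mE /=.
by rewrite Rintegral_cst ?mul0r //; exact: measurable_open_disc.
Qed.

End MonomialIntegrals.

(** * The Bergman kernel as a power series *)

Section AnalyticFunctions.
Context {R : realType}.
Implicit Types (f g : R[i] -> R[i]) (z w q h : R[i]).

Lemma psum_cvgD c b z l k : psum_cvg c z l -> psum_cvg b z k ->
  psum_cvg (fun m => c m + b m) z (l + k : R[i]).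
Proof.
move=> hl hk.
have h : (fun n => normc (psum c z n - l) + normc (psum b z n - k)) @ \oo --> (0 : R).
  by rewrite -[X in _ --> X](addr0 (0 : R)); exact: cvgD.
apply: (squeeze_cvgr (f := fun=> 0) _ _ h); last exact: cvg_cst.
near=> n; rewrite normc_ge0 /=.
have -> : psum (fun m => c m + b m) z n - (l + k) = (psum c z n - l) + (psum b z n - k).
  rewrite /psum (_ : \sum_(m < n) _ = \sum_(m < n) c m * z ^+ m + \sum_(m < n) b m * z ^+ m).
    ring.
  by rewrite -big_split /=; apply: eq_bigr => m _; rewrite mulrDl.
exact: normc_triangle.
Unshelve. all: by end_near. Qed.

Lemma psum_cvgZ a c z l : psum_cvg c z l -> psum_cvg (fun m => a * c m) z (a * l : R[i]).
Proof.
move=> hl; rewrite /psum_cvg.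
have E n : normc (psum (fun m => a * c m) z n - a * l) = normc a * normc (psum c z n - l).
  rewrite -normcM mulrBr /psum mulr_sumr; congr (normc (_ - _)).
  by apply: eq_bigr => m _; rewrite mulrA.
rewrite (funext E) -[X in _ --> X](mulr0 (normc a)); exact: cvgMr.
Qed.

Lemma analytic_atD f g z0 : analytic_at f z0 -> analytic_at g z0 ->
  analytic_at (fun z => f z + g z) z0.
Proof.
move=> [r r0 [c hc]] [s s0 [b hb]]; exists (Num.min r s); first by rewrite lt_min r0.
exists (fun m => c m + b m) => z; rewrite lt_min => /andP[zr zs].
by apply/psum_cvgP/psum_cvgD; apply/psum_cvgP; [exact: hc|exact: hb].
Qed.

Lemma analytic_atZ a f z0 : analytic_at f z0 -> analytic_at (fun z => a * f z) z0.
Proof.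
move=> [r r0 [c hc]]; exists r => //; exists (fun m => a * c m) => z zr.
by apply/psum_cvgP/psum_cvgZ; apply/psum_cvgP; exact: hc.
Qed.

(** The derivative of a finite geometric sum with the denominator cleared; the general ring serves
    both the complex series and its real majorant. *)
Lemma sum_geometric_deriv (A : comNzRingType) (q : A) n :
  (\sum_(m < n) m.+1%:R * q ^+ m) * (1 - q) ^+ 2 =
  1 - n.+1%:R * q ^+ n + n%:R * q ^+ n.+1.
Proof.
elim: n => [|n IH]; first by rewrite big_ord0 mul0r expr0 !mul0r addr0 mulr1 subrr.
rewrite big_ord_recr /= mulrDl IH !exprS -!natr1; ring.
Qed.

Lemma unit_disc_sub1_neq0 q : normc q < 1 -> 1 - q != 0.
Proof.
move=> q1; rewrite subr_eq0; apply/eqP => e.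
by move: q1; rewrite -e normc1 ltxx.
Qed.

Lemma geometric_deriv_cvg q : normc q < 1 ->
  (fun n => normc (\sum_(m < n) m.+1%:R * q ^+ m - ((1 - q) ^+ 2)^-1)) @ \oo --> (0 : R).
Proof.
move=> q1; have q0 := unit_disc_sub1_neq0 q1.
pose C := normc ((1 - q) ^+ 2)^-1.
have h : (fun n => C * (normc q ^+ n + (n%:R * normc q ^+ n) * 2)) @ \oo --> (0 : R).
  rewrite -[X in _ --> X](mulr0 C); apply: cvgMr.
  rewrite -[X in _ --> X](addr0 (0 : R)); apply: cvgD.
    by apply: cvg_expr; rewrite ger0_norm.
  rewrite -[X in _ --> X](mul0r 2); apply: cvgMl.
  exact: natmul_geometric_cvg0.
apply: (squeeze_cvgr (f := fun=> 0) _ _ h); last exact: cvg_cst.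
near=> n; rewrite normc_ge0 /=.
have nn (k : nat) : normc (k%:R : R[i]) = k%:R.
  by rewrite -(rmorph_nat (real_complex R)) normc_real ger0_norm.
have -> : \sum_(m < n) m.+1%:R * q ^+ m - ((1 - q) ^+ 2)^-1 =
   ((1 - q) ^+ 2)^-1 * (- (q ^+ n) + - (n%:R * q ^+ n) + n%:R * q ^+ n.+1).
  have q2 : (1 - q) ^+ 2 != 0 by rewrite expf_neq0.
  apply: (mulIf q2); rewrite mulrBl sum_geometric_deriv mulVf // mulrAC mulVf // -natr1; ring.
rewrite normcM ler_wpM2l // mulr_natr mulr2n addrA.
apply: le_trans (normc_triangle _ _) _; apply: lerD.
  apply: le_trans (normc_triangle _ _) _; rewrite !normc_opp normcX; apply: lerD => //.
  by rewrite normcM nn normcX.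
rewrite normcM nn normcX ler_wpM2l // exprS ler_piMl ?exprn_ge0 // ltW.
by [].
Unshelve. all: by end_near. Qed.

(** Applied to the conjugate of the kernel's parameter: a = 1 gives the expansion of the kernel at
    0, and a = 1 - w z0 the expansion around z0, which is its analyticity. *)
Lemma psum_cvg_inv_sqr a w h : a != 0 -> normc (w * h) < normc a ->
  psum_cvg (fun m => m.+1%:R * w ^+ m / a ^+ m.+2) h (1 / (a - w * h) ^+ 2).
Proof.
move=> a0 wh; pose q := w * h / a.
have na : 0 < normc a by rewrite normc_gt0.
have q1 : normc q < 1 by rewrite normcM normcV ltr_pdivrMr // mul1r.
have := geometric_deriv_cvg q1; rewrite /psum_cvg => H.
have q0 := unit_disc_sub1_neq0 q1.
have E n : normc (psum (fun m => m.+1%:R * w ^+ m / a ^+ m.+2) h n - 1 / (a - w * h) ^+ 2)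
    = normc (a ^+ 2)^-1 * normc (\sum_(m < n) m.+1%:R * q ^+ m - ((1 - q) ^+ 2)^-1).
  rewrite -normcM mulrBr /psum mulr_sumr; congr (normc (_ - _)).
    apply: eq_bigr => m _; rewrite /q !exprMn exprVn !exprS.
    rewrite !invfM expr0 invr1.
    ring.
  by rewrite -invfM -exprMn mulrBr mulr1 /q mulrCA mulfV // mulr1 div1r.
rewrite (funext E) -[X in _ --> X](mulr0 (normc (a ^+ 2)^-1)); exact: cvgMr.
Qed.

Lemma bergman_kernel_analytic w z0 : normc w < 1 -> normc z0 < 1 ->
  analytic_at (bergman_kernel w) z0.
Proof.
move=> w1 z01; pose a := 1 - w^* * z0.
have wz : normc (w^* * z0) < 1.
  rewrite normcM normc_conj; apply: le_lt_trans w1.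
  by rewrite ler_piMr // ltW.
have a0 : a != 0 by exact: unit_disc_sub1_neq0.
have na : 0 < normc a by rewrite normc_gt0.
exists (normc a) => //; exists (fun m => m.+1%:R * w^* ^+ m / a ^+ m.+2) => z za.
apply/psum_cvgP; have -> : bergman_kernel w z = 1 / (a - w^* * (z - z0)) ^+ 2.
  by rewrite /bergman_kernel /a; congr (1 / _ ^+ 2); ring.
apply: psum_cvg_inv_sqr => //; rewrite normcM normc_conj; apply: le_lt_trans za.
by rewrite ler_piMl // ltW.
Qed.

Lemma bergman_kernel_series w z : normc w < 1 -> normc z <= 1 ->
  psum_cvg (fun m => m.+1%:R * w^* ^+ m) z (bergman_kernel w z).
Proof.
move=> w1 z1; have := @psum_cvg_inv_sqr 1 (w^*) z (oner_neq0 _).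
rewrite normc1 normcM normc_conj (le_lt_trans _ w1) ?ler_piMr // => /(_ isT).
by under [X in psum_cvg X]eq_fun => m do rewrite expr1n divr1.
Qed.

(** Uniformity in z and M is the point: it bounds the kernel itself and supplies the majorant for
    dominated convergence in the reproducing formula. *)
Lemma bergman_kernel_partial_bound w z M : normc w < 1 -> normc z <= 1 ->
  normc (psum (fun m => m.+1%:R * w^* ^+ m) z M) <= ((1 - normc w) ^+ 2)^-1.
Proof.
move=> w1 z1; have d0 : 0 < 1 - normc w by rewrite subr_gt0.
apply: (@le_trans _ _ (\sum_(m < M) m.+1%:R * normc w ^+ m)).
  apply: le_trans (normc_sum _ _ _) _; apply: ler_sum => m _.
  rewrite !normcM !normcX normc_conj -(rmorph_nat (real_complex R)) normc_real ger0_norm //.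
  by rewrite ler_piMr ?mulr_ge0 ?exprn_ge0 // exprn_ile1.
rewrite -[leRHS]mul1r ler_pdivlMr ?exprn_gt0 // sum_geometric_deriv.
rewrite -natr1 mulrDl mul1r exprS.
have h1 : M%:R * (normc w * normc w ^+ M) <= M%:R * normc w ^+ M.
  by rewrite ler_wpM2l // ler_piMl ?exprn_ge0 // ltW.
have h2 : 0 <= normc w ^+ M by rewrite exprn_ge0.
lra.
Qed.

End AnalyticFunctions.

(** * The inner product *)

Section DiscL2.
Context {R : realType}.
Local Notation mR := (measurableTypeR R).
Local Notation mu := (@dA R).
Local Notation D := (@plane_disc R : set (mR * mR)).
Local Notation cop := (@complex_of_pair R : mR * mR -> R[i]).
Implicit Types (f g e : R[i] -> R[i]) (z w a : R[i]) (c : nat -> R[i]).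

Lemma measurable_plane_disc : measurable D.
Proof. rewrite plane_disc_open_disc; exact: measurable_open_disc. Qed.

Lemma integrable_cst_plane_disc (k : R) : mu.-integrable D (EFin \o (fun=> k)).
Proof. by rewrite plane_disc_open_disc; exact: integrable_cst_open_disc. Qed.

(** Square integrability without analyticity is all that the rules for the inner product use;
    partial sums satisfy it without being shown analytic. *)
Definition disc_L2 f := cmeasurable D (fun p => f (cop p)) /\
  mu.-integrable D (EFin \o (fun p => normc (f (cop p)) ^+ 2)).

Lemma disc_L2_dominated f (u : mR * mR -> R) : cmeasurable D (fun p => f (cop p)) ->
  mu.-integrable D (EFin \o u) -> (forall p, D p -> normc (f (cop p)) ^+ 2 <= u p) ->
  disc_L2 f.
Proof.
move=> mf iu fu; split=> //; apply: (le_integrable measurable_plane_disc _ _ iu).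
  by apply/measurable_EFinP; exact: cmeasurable_normc.
move=> p Dp /=; rewrite lee_fin ger0_norm ?exprn_ge0 //.
exact: le_trans (fu p Dp) (ler_norm _).
Qed.

Lemma disc_L2_bounded f (B : R) : cmeasurable D (fun p => f (cop p)) ->
  (forall z, unit_disc z -> normc (f z) <= B) -> disc_L2 f.
Proof.
move=> mf fB; apply: (disc_L2_dominated mf (integrable_cst_plane_disc (B ^+ 2))).
move=> p Dp; have h := fB _ Dp.
by rewrite lerXn2r ?nnegrE // (le_trans _ h).
Qed.

Lemma disc_L2D f g : disc_L2 f -> disc_L2 g -> disc_L2 (fun z => f z + g z).
Proof.
move=> [mf i1] [mg i2].
have [iu _] := integrable_lincomb 2 2 measurable_plane_disc i1 i2.
apply: (disc_L2_dominated _ iu); first exact: cmeasurable_add.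
move=> p _; set x := normc (f (cop p)); set y := normc (g (cop p)).
have h : normc (f (cop p) + g (cop p)) ^+ 2 <= (x + y) ^+ 2.
  by rewrite lerXn2r ?nnegrE ?addr_ge0 ?normc_ge0 ?normc_triangle.
apply: le_trans h _; have := sqr_ge0 (x - y); lra.
Qed.

Lemma disc_L2Z a f : disc_L2 f -> disc_L2 (fun z => a * f z).
Proof.
move=> [mf i1]; have [iu _] := integrable_lincomb (normc a ^+ 2) 0 measurable_plane_disc i1 i1.
apply: (disc_L2_dominated _ iu); first exact: cmeasurable_mul (cmeasurable_cst _ _) mf.
by move=> p _; rewrite normcM exprMn mul0r addr0.
Qed.

Lemma disc_L20 : disc_L2 (fun=> 0).
Proof.
by apply: (disc_L2_bounded (B := 0)); [exact: cmeasurable_cst|move=> z _; rewrite normc0].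
Qed.

Lemma disc_L2_sum n (F : nat -> R[i] -> R[i]) :
  (forall i, disc_L2 (F i)) -> disc_L2 (fun z => \sum_(i < n) F i z).
Proof.
move=> hF; elim: n => [|n IH].
  by under eq_fun => z do rewrite big_ord0; exact: disc_L20.
by under eq_fun => z do rewrite big_ord_recr /=; exact: disc_L2D.
Qed.

Lemma disc_L2_product f g : disc_L2 f -> disc_L2 g ->
  cintegrable mu D (fun p => f (cop p) * (g (cop p))^*).
Proof.
move=> [mf i1] [mg i2]; have [iu _] := integrable_lincomb 1 1 measurable_plane_disc i1 i2.
apply: (cintegrable_dominated measurable_plane_disc _ iu).
  by apply: cmeasurable_mul => //; exact: cmeasurable_conj.
move=> p _; rewrite normcM normc_conj !mul1r.
set x := normc (f _); set y := normc (g _).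
have x0 : 0 <= x by exact: normc_ge0.
have y0 : 0 <= y by exact: normc_ge0.
have := sqr_ge0 (x - y); have := mulr_ge0 x0 y0; lra.
Qed.

Lemma conj_mul (x y : R[i]) : (x * y)^* = x^* * y^*.
Proof. exact: rmorphM. Qed.

Lemma conj_add (x y : R[i]) : (x + y)^* = x^* + y^*.
Proof. exact: rmorphD. Qed.

Lemma innerE f g : inner f g = cintegral mu D (fun p => f (cop p) * (g (cop p))^*).
Proof. by []. Qed.

Lemma eq_inner f f' g g' : eq_on_disc f f' -> eq_on_disc g g' -> inner f g = inner f' g'.
Proof.
by move=> hf hg; rewrite !innerE; apply: eq_cintegral => p Dp; rewrite hf ?hg.
Qed.

Lemma inner_conj f g : disc_L2 f -> disc_L2 g -> inner g f = (inner f g)^*.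
Proof.
move=> hf hg; rewrite !innerE -cintegral_conj; last exact: disc_L2_product.
  by apply: eq_cintegral => p _; rewrite conj_mul conjCK mulrC.
exact: measurable_plane_disc.
Qed.

Lemma innerDl f g e : disc_L2 f -> disc_L2 g -> disc_L2 e ->
  inner (fun z => f z + g z) e = inner f e + inner g e.
Proof.
move=> hf hg he; rewrite !innerE -cintegralD; first by apply: eq_cintegral => p _; rewrite mulrDl.
- exact: measurable_plane_disc.
- exact: disc_L2_product.
- exact: disc_L2_product.
Qed.

Lemma innerZl a f e : disc_L2 f -> disc_L2 e ->
  inner (fun z => a * f z) e = a * inner f e.
Proof.
move=> hf he; rewrite !innerE -cintegralZ; first by apply: eq_cintegral => p _; rewrite mulrA.
- exact: measurable_plane_disc.
- exact: disc_L2_product.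
Qed.

Lemma innerDr f g e : disc_L2 f -> disc_L2 g -> disc_L2 e ->
  inner e (fun z => f z + g z) = inner e f + inner e g.
Proof.
move=> hf hg he.
rewrite (inner_conj (disc_L2D hf hg) he) innerDl // conj_add.
by rewrite -!inner_conj.
Qed.

Lemma innerZr a f e : disc_L2 f -> disc_L2 e ->
  inner e (fun z => a * f z) = a^* * inner e f.
Proof.
by move=> hf he; rewrite (inner_conj (disc_L2Z a hf) he) innerZl // conj_mul -inner_conj.
Qed.

Lemma inner0l e : inner (fun=> 0) e = 0.
Proof.
rewrite innerE; transitivity (cintegral mu D (fun=> 0)); last exact: cintegral0.
by apply: eq_cintegral => p _; rewrite mul0r.
Qed.

Lemma inner0r e : inner e (fun=> 0) = 0.
Proof.
rewrite innerE; transitivity (cintegral mu D (fun=> 0)); last exact: cintegral0.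
by apply: eq_cintegral => p _; rewrite conjC0 mulr0.
Qed.

Lemma innerBl f g e : disc_L2 f -> disc_L2 g -> disc_L2 e ->
  inner (fun z => f z - g z) e = inner f e - inner g e.
Proof.
move=> hf hg he; rewrite -mulN1r -innerZl // -innerDl //; last exact: disc_L2Z.
by apply: eq_inner => // z _; rewrite mulN1r.
Qed.

Lemma inner_suml n (F : nat -> R[i] -> R[i]) e : (forall i, disc_L2 (F i)) -> disc_L2 e ->
  inner (fun z => \sum_(i < n) F i z) e = \sum_(i < n) inner (F i) e.
Proof.
move=> hF he; elim: n => [|n IH].
  rewrite big_ord0; transitivity (inner (fun=> 0) e); last exact: inner0l.
  by apply: eq_inner => // z _; rewrite big_ord0.
rewrite big_ord_recr /= -IH -innerDl //; last exact: disc_L2_sum.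
by apply: eq_inner => // z _; rewrite big_ord_recr.
Qed.

Lemma inner_sumr n (F : nat -> R[i] -> R[i]) e : (forall i, disc_L2 (F i)) -> disc_L2 e ->
  inner e (fun z => \sum_(i < n) F i z) = \sum_(i < n) inner e (F i).
Proof.
move=> hF he; rewrite (inner_conj _ he); last exact: disc_L2_sum.
rewrite inner_suml // rmorph_sum; apply: eq_bigr => i _; exact/esym/inner_conj.
Qed.

Lemma inner_diag f : inner f f = (Rintegral mu D (fun p => normc (f (cop p)) ^+ 2))%:C.
Proof.
rewrite innerE; apply: complex_ext => /=.
  by apply: eq_Rintegral => p _; rewrite mul_conj.
under eq_Rintegral => p _ do rewrite mul_conj /=.
by rewrite Rintegral_cst ?mul0r //; exact: measurable_plane_disc.
Qed.

Lemma bnorm_ge0 f : 0 <= bnorm f.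
Proof. exact: sqrtr_ge0. Qed.

Lemma sqr_bnorm f : bnorm f ^+ 2 = Rintegral mu D (fun p => normc (f (cop p)) ^+ 2).
Proof.
rewrite /bnorm inner_diag sqr_sqrtr //.
by apply: Rintegral_ge0 => p _; exact: exprn_ge0.
Qed.

Lemma inner_sqr_bnorm f : inner f f = (bnorm f ^+ 2)%:C.
Proof. by rewrite inner_diag sqr_bnorm. Qed.

Lemma sqr_bnormD f g : disc_L2 f -> disc_L2 g ->
  bnorm (fun z => f z + g z) ^+ 2 = bnorm f ^+ 2 + bnorm g ^+ 2 + 2 * complex.Re (inner f g).
Proof.
move=> hf hg; apply: complexI; rewrite -inner_sqr_bnorm.
have hfg := disc_L2D hf hg.
rewrite innerDl // !innerDr // (inner_conj hf hg) !inner_sqr_bnorm.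
case: (inner f g) => x y; apply: complex_ext => /=; rewrite ?cReD ?cImD /=; ring.
Qed.

Lemma sqr_bnormZ a f : disc_L2 f -> bnorm (fun z => a * f z) ^+ 2 = normc a ^+ 2 * bnorm f ^+ 2.
Proof.
move=> hf; apply: complexI; rewrite -inner_sqr_bnorm innerZl ?innerZr //; last exact: disc_L2Z.
by rewrite inner_sqr_bnorm mulrA mul_conj -rmorphM.
Qed.

Lemma cmeasurable_series f c :
  (forall z, unit_disc z -> psum_cvg c z (f z)) -> cmeasurable D (fun p => f (cop p)).
Proof.
move=> hc; apply: (@cmeasurable_cvg _ _ _ _ (fun n p => psum c (cop p) n)).
  move=> n; apply: (@cmeasurable_sum _ _ _ _ _ (fun m p => c m * cop p ^+ m)) => m.
  apply: cmeasurable_mul; first exact: cmeasurable_cst.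
  exact/cmeasurable_exp/cmeasurable_complex_of_pair.
by move=> p Dp; exact: hc.
Qed.

Lemma bergman_series f : bergman f ->
  exists c, forall z, unit_disc z -> psum_cvg c z (f z).
Proof. by move=> [af _]; exact: analytic_disc_series. Qed.

Lemma bergman_disc_L2 f : bergman f -> disc_L2 f.
Proof.
move=> hf; have [c hc] := bergman_series hf; have mf := cmeasurable_series hc.
split=> //; apply/integrableP; split.
  by apply/measurable_EFinP; exact: cmeasurable_normc.
case: hf => _; congr (_ < _)%E; apply: eq_integral => p _ /=.
by rewrite ger0_norm // exprn_ge0.
Qed.

Lemma analytic_disc_L2_bergman f : (forall z, unit_disc z -> analytic_at f z) ->
  disc_L2 f -> bergman f.
Proof.
move=> af [_ /integrableP[_ h]]; split=> //.
move: h; congr (_ < _)%E; apply: eq_integral => p _ /=.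
by rewrite ger0_norm // exprn_ge0.
Qed.

Lemma bergmanD f g : bergman f -> bergman g -> bergman (fun z => f z + g z).
Proof.
move=> hf hg; apply: analytic_disc_L2_bergman.
  by move=> z zD; apply: analytic_atD; [case: hf => h _; exact: h|case: hg => h _; exact: h].
by apply: disc_L2D; exact: bergman_disc_L2.
Qed.

Lemma bergmanZ a f : bergman f -> bergman (fun z => a * f z).
Proof.
move=> hf; apply: analytic_disc_L2_bergman.
  by move=> z zD; apply: analytic_atZ; case: hf => h _; exact: h.
by apply: disc_L2Z; exact: bergman_disc_L2.
Qed.

Lemma bergman_kernel_bergman w : unit_disc w -> bergman (bergman_kernel w).
Proof.
move=> w1; apply: analytic_disc_L2_bergman.
  by move=> z z1; exact: bergman_kernel_analytic.
apply: (disc_L2_bounded (B := ((1 - normc w) ^+ 2)^-1)).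
  apply: (@cmeasurable_series _ (fun m => m.+1%:R * w^* ^+ m)) => z z1.
  by apply: bergman_kernel_series => //; exact: ltW.
move=> z z1; rewrite -[X in normc X]subr0.
apply: (psum_cvg_le (bergman_kernel_series w1 (ltW z1)) (n0 := 0)) => n _.
by rewrite subr0; apply: bergman_kernel_partial_bound => //; exact: ltW.
Qed.

Lemma bergman0 : bergman (fun=> 0 : R[i]).
Proof.
have h : bergman (fun z => 0 * bergman_kernel 0 z).
  by apply: bergmanZ; apply: bergman_kernel_bergman; exact: unit_disc0.
by rewrite (_ : (fun=> _) = (fun z => 0 * bergman_kernel 0 z)) //; apply/funext => z; rewrite mul0r.
Qed.

Lemma bergmanB f g : bergman f -> bergman g -> bergman (fun z => f z - g z).
Proof.
move=> hf hg; have := bergmanD hf (bergmanZ (-1) hg).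
by rewrite (_ : (fun z => f z + _) = (fun z => f z - g z)) //; apply/funext => z; rewrite mulN1r.
Qed.

End DiscL2.

(** * Taylor coefficients and the reproducing property *)

Section BergmanCoefficients.
Context {R : realType}.
Local Notation mR := (measurableTypeR R).
Local Notation mu := (@dA R).
Local Notation D := (@plane_disc R : set (mR * mR)).
Local Notation cop := (@complex_of_pair R : mR * mR -> R[i]).
Implicit Types (f g e : R[i] -> R[i]) (z w a : R[i]) (c : nat -> R[i]).

Lemma normc_cvg_unique (u : nat -> R[i]) (a b : R[i]) :
  (fun n => normc (u n - a)) @ \oo --> (0 : R) ->
  (fun n => normc (u n - b)) @ \oo --> (0 : R) -> a = b.
Proof.
move=> ha hb; apply/eqP; rewrite -subr_eq0 -normc_eq0 eq_le normc_ge0 andbT.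
have h : (fun n => normc (u n - a) + normc (u n - b)) @ \oo --> (0 : R).
  by rewrite -[X in _ --> X](addr0 (0 : R)); exact: cvgD.
apply/ler_addgt0Pr => e e0; move/cvgrPdist_lt: h => /(_ e e0)[N _ hN].
have := hN N (leqnn N); rewrite sub0r normrN ger0_norm ?addr_ge0 ?normc_ge0 // add0r => /ltW.
apply: le_trans; have -> : a - b = - (u N - a) + (u N - b) by ring.
by rewrite (le_trans (normc_triangle _ _)) // normc_opp.
Qed.

Lemma disc_uniform_approx f c r (e : R) : 0 <= r -> r < 1 -> 0 < e ->
  (forall z, unit_disc z -> psum_cvg c z (f z)) ->
  exists N0, forall N z, (N0 <= N)%N -> normc z <= r ->
    normc (f z - psum c z N) <= e.
Proof.
move=> r0 r1 e0 hc; pose s := (r + 1) / 2.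
have rs : r < s by rewrite /s; lra.
have s1 : s < 1 by rewrite /s; lra.
have s0 : 0 < s by exact: le_lt_trans rs.
have ns : normc (s%:C) = s by rewrite normc_real gtr0_norm.
have [|B B0 hB] := psum_cvg_bounded (hc s%:C _); first by rewrite /unit_disc /mkset ns.
rewrite ns in hB.
pose q := r / s; have q0 : 0 <= q by rewrite divr_ge0 // ltW.
have q1 : q < 1 by rewrite ltr_pdivrMr // mul1r.
have d0 : 0 < 1 - q by rewrite subr_gt0.
have : (fun n => q ^+ n * (B / (1 - q))) @ \oo --> (0 : R).
  rewrite -[X in _ --> X](mul0r (B / (1 - q))); apply: cvgMl.
  by apply: cvg_expr; rewrite ger0_norm.
move=> /cvgrPdist_lt /(_ e e0) [N0 _ hN]; exists N0 => N z NN zr.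
have := hN N NN; rewrite sub0r normrN ger0_norm; last first.
  by rewrite !mulr_ge0 ?exprn_ge0 // invr_ge0 ltW.
move=> /ltW; apply: le_trans.
have zs : normc z < s by exact: le_lt_trans rs.
have zD : unit_disc z by exact: lt_trans s1.
apply: le_trans (psum_tail_bound N s0 zs hB (hc z zD)) _.
rewrite mulrAC mulrC; apply: ler_pM.
- by rewrite exprn_ge0 // divr_ge0 // ltW.
- by rewrite divr_ge0 // subr_ge0 ltW // ltr_pdivrMr // mul1r.
- apply: lerXn2r; rewrite ?nnegrE //; first by rewrite divr_ge0 // ltW.
  by rewrite /q ler_pM2r ?invr_gt0.
- rewrite ler_wpM2l // lef_pV2 ?posrE ?subr_gt0 //; last by rewrite ltr_pdivrMr // mul1r.
  by rewrite lerD2l lerN2 /q ler_pM2r ?invr_gt0.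
Qed.

Definition power m : R[i] -> R[i] := fun z => z ^+ m.

Lemma cmeasurable_power (E : set (mR * mR)) m : cmeasurable E (fun p => power m (cop p)).
Proof. exact/cmeasurable_exp/cmeasurable_complex_of_pair. Qed.

Lemma disc_L2_power m : disc_L2 (power m).
Proof.
apply: (disc_L2_bounded (B := 1)); first exact: cmeasurable_power.
by move=> z z1; rewrite normcX exprn_ile1 // ltW.
Qed.

Lemma disc_L2_psum c n : disc_L2 (fun z => psum c z n).
Proof.
apply: (@disc_L2_sum _ _ (fun m z => c m * power m z)) => m.
by apply: disc_L2Z; exact: disc_L2_power.
Qed.

Lemma conj_power m p : (power m (cop p))^* = (cop p)^* ^+ m.
Proof. exact: rmorphXn. Qed.

Lemma inner_power m n : inner (power m) (power n) = if m == n then n.+1%:R^-1 else 0 :> R[i].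
Proof.
transitivity (cintegral mu (open_disc 1) (monomial m n)).
  by rewrite innerE plane_disc_open_disc; apply: eq_cintegral => p _; rewrite conj_power.
rewrite cintegral_monomial // expr1n div1r; case: ifP => // _.
by rewrite fmorphV rmorph_nat.
Qed.

Lemma inner_psum_power c n m : inner (fun z => psum c z n) (power m) =
  if (m < n)%N then c m / m.+1%:R else 0.
Proof.
rewrite (@inner_suml _ n (fun j z => c j * power j z)); last 2 first.
- by move=> j; apply: disc_L2Z; exact: disc_L2_power.
- exact: disc_L2_power.
have E j : inner (fun z => c j * power j z) (power m) = c j * (if j == m then m.+1%:R^-1 else 0).
  by rewrite innerZl ?inner_power //; exact: disc_L2_power.
under eq_bigr => j _ do rewrite E.
case: ifP => [mn|/negbT]; last first.
  rewrite -leqNgt => nm; apply: big1 => j _; case: eqP => [jm|_]; last by rewrite mulr0.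
  by move: (ltn_ord j); rewrite jm ltnNge nm.
rewrite (bigD1 (Ordinal mn)) //= eqxx big1 ?addr0 // => j jm.
by rewrite ifN ?mulr0 //; move: jm; rewrite -val_eqE.
Qed.

Lemma cintegral_indic (A : set (mR * mR)) (F : mR * mR -> R[i]) : A `<=` D ->
  cintegral mu D (fun p => (\1_A p)%:C * F p) = cintegral mu A F.
Proof.
move=> AD; have E (u : mR * mR -> R) : Rintegral mu D (fun p => \1_A p * u p) = Rintegral mu A u.
  rewrite -[in RHS](setIidr AD) Rintegral_mkcondr; apply: eq_Rintegral => p _.
  by rewrite patchE indicE; case: ifP => h; rewrite ?mul1r ?mul0r.
apply: complex_ext => /=.
  by rewrite -E; apply: eq_Rintegral => p _; rewrite cReM /= mul0r subr0.
by rewrite -E; apply: eq_Rintegral => p _; rewrite cImM /= mul0r addr0.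
Qed.

Lemma integrable_normc_sqr_add f (k : R) : disc_L2 f ->
  mu.-integrable D (EFin \o (fun p => normc (f (cop p)) ^+ 2 + k)).
Proof.
move=> [_ h].
have [i _] := integrable_lincomb 1 1 measurable_plane_disc h (integrable_cst_plane_disc k).
by apply: eq_integrable i => [|p _]; [exact: measurable_plane_disc|rewrite /= !mul1r].
Qed.

(* The integrals over the disc are limits of integrals, over discs of radius
   tending to 1, of partial sums long enough to stay within 1 of f there. *)
Lemma inner_power_coef f c m : disc_L2 f ->
  (forall z, unit_disc z -> psum_cvg c z (f z)) -> inner f (power m) = c m / m.+1%:R.
Proof.
move=> fL hc.
pose r (k : nat) : R := 1 - (k.+2%:R)^-1.
have r0 k : 0 <= r k by rewrite subr_ge0 invf_le1 ?ltr0n // ler1n.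
have r1 k : r k < 1 by rewrite ltrBlDr ltrDl invr_gt0 ltr0n.
have k0 k : 0 < (k.+1%:R)^-1 :> R by rewrite invr_gt0 ltr0n.
have /choice[N0 hN0] := fun k => disc_uniform_approx (r0 k) (r1 k) (k0 k) hc.
(* At least m + 1 terms, so that the coefficient c m occurs in the partial sum. *)
pose N k := maxn (N0 k) m.+1.
have hN k z : normc z <= r k -> normc (f z - psum c z (N k)) <= (k.+1%:R)^-1.
  by apply: hN0; exact: leq_maxl.
pose A k : set (mR * mR) := open_disc (r k).
have AD k : A k `<=` D.
  by rewrite plane_disc_open_disc; apply: open_disc_sub => //; exact: ltW.
pose F k (p : mR * mR) : R[i] := (\1_(A k) p)%:C * (psum c (cop p) (N k) * (power m (cop p))^*).
have inv_cvg : (fun k : nat => (k.+1%:R)^-1 : R) @ \oo --> (0 : R) by exact: cvg_harmonic.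
have inv_cvg2 : (fun k : nat => (k.+2%:R)^-1 : R) @ \oo --> (0 : R).
  by have := inv_cvg; rewrite -(cvg_shiftS (fun k : nat => (k.+1%:R)^-1 : R)).
have r_cvg : r @ \oo --> (1 : R).
  rewrite -[X in _ --> X](subr0 (1 : R)); apply: cvgB; [exact: cvg_cst|exact: inv_cvg2].
have FE k : cintegral mu D (F k) = (r k ^+ (2 * m.+1))%:C * (c m / m.+1%:R).
  rewrite /F (cintegral_indic _ (AD k)).
  transitivity (cintegral mu (A k) (fun p => \sum_(j < N k) c j * monomial j m p)).
    apply: eq_cintegral => p _; rewrite /psum mulr_suml; apply: eq_bigr => j _.
    by rewrite conj_power mulrA.
  have mA : measurable (A k) by exact: measurable_open_disc.
  have iA j : cintegrable mu (A k) (monomial j m) by exact: cintegrable_monomial.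
  rewrite (@cintegral_sum _ _ _ _ _ (N k) (fun j p => c j * monomial j m p)) //; last first.
    by move=> j _; exact: cintegrableZ.
  have mN : (m < N k)%N by rewrite /N leq_maxr.
  rewrite (bigD1 (Ordinal mN)) //= big1 ?addr0; last first.
    by move=> j jm; rewrite cintegralZ // cintegral_monomial // ifN ?mulr0.
  rewrite cintegralZ // cintegral_monomial // eqxx rmorphM /= fmorphV rmorph_nat; ring.
have pow_cvg : (fun k => r k ^+ (2 * m.+1)) @ \oo --> (1 : R).
  rewrite -[X in _ --> X](expr1n _ (2 * m.+1)).
  by apply: (@cvg_comp _ _ _ r (fun x : R => x ^+ (2 * m.+1)) _ _ _ r_cvg); exact: exprn_continuous.
have C1 : (fun k => normc (cintegral mu D (F k) - c m / m.+1%:R)) @ \oo --> (0 : R).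
  have E k : normc (cintegral mu D (F k) - c m / m.+1%:R) =
      `|r k ^+ (2 * m.+1) - 1| * normc (c m / m.+1%:R).
    by rewrite FE -normc_real -normcM rmorphB mulrBl mul1r.
  rewrite (funext E) -[X in _ --> X](mul0r (normc (c m / m.+1%:R))); apply: cvgMl.
  rewrite -(normr0 R) -(subrr (1 : R)); apply: cvg_norm.
  by apply: cvgB => //; exact: cvg_cst.
have C2 : (fun k => normc (cintegral mu D (F k) - inner f (power m))) @ \oo --> (0 : R).
  (* On the disc of radius r k the partial sum is within 1 of f, hence at most |f| + 1 <= |f|^2 + 2
     in modulus. *)
  rewrite innerE; apply: (cintegral_dominated_cvg (g := fun p => normc (f (cop p)) ^+ 2 + 2)).
  - exact: measurable_plane_disc.
  - move=> k; apply: cmeasurable_mul.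
      by split; [exact: measurable_indic (measurable_open_disc _)|exact: measurable_cst].
    apply: cmeasurable_mul; first by have [] := disc_L2_psum c (N k).
    exact/cmeasurable_conj/cmeasurable_power.
  - move=> p pD; have zr : \forall k \near \oo, normc (cop p) < r k.
      by move: r_cvg => /cvgr_gt; apply.
    apply: (squeeze_cvgr (f := fun=> 0) _ _ inv_cvg); last exact: cvg_cst.
    near=> k; rewrite normc_ge0 /=.
    have pr : normc (cop p) < r k by near: k.
    have pA : A k p by apply/normc_open_disc.
    rewrite /F indicE mem_set // mul1r -mulrBl normcM normc_conj normc_distC.
    apply: le_trans (ler_wpM2l (normc_ge0 _) (_ : _ <= 1)) _.
      by rewrite normcX exprn_ile1 // ltW.
    by rewrite mulr1 hN // ltW.
  - exact: integrable_normc_sqr_add.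
  move=> k p pD; rewrite /F indicE.
  case: (boolP (p \in A k)) => [|_]; last by rewrite mul0r normc0 addr_ge0 ?exprn_ge0.
  rewrite inE => /normc_open_disc - /(_ (r0 k)) pr; rewrite mul1r normcM normc_conj.
  apply: le_trans (ler_wpM2l (normc_ge0 _) (_ : _ <= 1)) _.
    by rewrite normcX exprn_ile1 // ltW.
  rewrite mulr1; have := hN k (cop p) (ltW pr); rewrite normc_distC => h1.
  have h2 := normc_triangleB (psum c (cop p) (N k)) (f (cop p)).
  have h3 : (k.+1%:R)^-1 <= 1 :> R by rewrite invf_le1 ?ltr0n // ler1n.
  move: h1 h2 h3; move: (normc (_ - _)) (normc (psum _ _ _)) (normc (f _)) (_^-1) => x y t v.
  have := sqr_ge0 (t - 1); have := sqr_ge0 t; lra.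
exact: normc_cvg_unique C2 C1.
Unshelve. all: by end_near. Qed.

(** Pairing f with a partial sum of the kernel gives the same partial sum of f at w, the weights m +
    1 cancelling the 1 / (m + 1) of the monomials; dominated convergence does the rest. *)
Lemma bergman_reproducing f w : bergman f -> unit_disc w -> inner f (bergman_kernel w) = f w.
Proof.
move=> hf w1; have [c hc] := bergman_series hf; have fL := bergman_disc_L2 hf.
pose k m : R[i] := m.+1%:R * w^* ^+ m.
have E M : inner f (fun z => psum k z M) = psum c w M.
  rewrite (@inner_sumr _ M (fun m z => k m * power m z)) //; last first.
    by move=> m; apply: disc_L2Z; exact: disc_L2_power.
  apply: eq_bigr => m _; rewrite innerZr //; last exact: disc_L2_power.
  rewrite (inner_power_coef _ fL hc) /k conj_mul rmorphXn /= conjCK rmorph_nat.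
  by field; rewrite addrC natr1 pnatr_eq0.
pose B := ((1 - normc w) ^+ 2)^-1.
have B0 : 0 <= B by rewrite invr_ge0 sqr_ge0.
have h : (fun M => normc (inner f (fun z => psum k z M) - inner f (bergman_kernel w))) @ \oo --> (0 : R).
  rewrite innerE.
  have ig := integrable_normc_sqr_add 1 fL.
  have [iBg _] := integrable_lincomb B 0 measurable_plane_disc ig ig.
  apply: (cintegral_dominated_cvg _ _ _ iBg).
  - exact: measurable_plane_disc.
  - move=> M; apply: cmeasurable_mul; first by case: fL.
    by apply: cmeasurable_conj; have [] := disc_L2_psum k M.
  - move=> p pD; have /= kc := bergman_kernel_series w1 (ltW pD).
    have E2 M : normc (f (cop p) * (psum k (cop p) M)^* - f (cop p) * (bergman_kernel w (cop p))^*)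
       = normc (f (cop p)) * normc (psum k (cop p) M - bergman_kernel w (cop p)).
      by rewrite -mulrBr normcM -rmorphB normc_conj.
    rewrite (funext E2) -[X in _ --> X](mulr0 (normc (f (cop p)))).
    by apply: cvgMr; exact: kc.
  - move=> M p pD; rewrite normcM normc_conj mul0r addr0 mulrC.
    apply: ler_pM => //; first by apply: bergman_kernel_partial_bound => //; exact: ltW.
    have := sqr_ge0 (normc (f (cop p)) - 1); have := sqr_ge0 (normc (f (cop p))); lra.
apply: (normc_cvg_unique h); rewrite (_ : (fun M => _) = fun M => normc (psum c w M - f w)).
  exact: hc.
by apply/funext => M; rewrite E.
Qed.

Lemma real_complex_divn (x : R) n : (x / n%:R)%:C = x%:C / n%:R.
Proof. by rewrite (rmorphM (real_complex R)) (fmorphV (real_complex R)) rmorph_nat. Qed.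

Definition coef_energy c M : R := \sum_(m < M) normc (c m) ^+ 2 / m.+1%:R.

Lemma sqr_bnorm_psum c M : bnorm (fun z => psum c z M) ^+ 2 = coef_energy c M.
Proof.
apply: complexI; rewrite -inner_sqr_bnorm.
rewrite [in LHS](@inner_sumr _ M (fun m z => c m * power m z)); last 2 first.
- by move=> m; apply: disc_L2Z; exact: disc_L2_power.
- exact: disc_L2_psum.
rewrite /coef_energy (rmorph_sum (real_complex R)); apply: eq_bigr => m _; rewrite [RHS]real_complex_divn.
rewrite innerZr; [|exact: disc_L2_power|exact: disc_L2_psum].
by rewrite inner_psum_power ltn_ord mulrCA mulrA mul_conj.
Qed.

Lemma sqr_bnorm_sub_psum f c M : disc_L2 f ->
  (forall z, unit_disc z -> psum_cvg c z (f z)) ->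
  bnorm (fun z => f z - psum c z M) ^+ 2 = bnorm f ^+ 2 - coef_energy c M.
Proof.
move=> fL hc; have sL := disc_L2_psum c M.
have fs : inner f (fun z => psum c z M) = (coef_energy c M)%:C.
  rewrite (@inner_sumr _ M (fun m z => c m * power m z)) //; last first.
    by move=> m; apply: disc_L2Z; exact: disc_L2_power.
  rewrite /coef_energy (rmorph_sum (real_complex R)); apply: eq_bigr => m _; rewrite [RHS]real_complex_divn.
  rewrite innerZr //; last exact: disc_L2_power.
  by rewrite (inner_power_coef _ fL hc) mulrCA mulrA mul_conj.
have -> : (fun z => f z - psum c z M) = (fun z => f z + (-1) * psum c z M).
  by apply/funext => z; rewrite mulN1r.
rewrite (sqr_bnormD fL (disc_L2Z _ sL)) (sqr_bnormZ _ sL) (innerZr _ sL fL) sqr_bnorm_psum fs.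
have -> : (-1 : R[i])^* = -1 by rewrite rmorphN1.
rewrite mulN1r normc_opp normc1 expr1n mul1r /=; ring.
Qed.

Lemma bessel f c M : disc_L2 f ->
  (forall z, unit_disc z -> psum_cvg c z (f z)) -> coef_energy c M <= bnorm f ^+ 2.
Proof. by move=> fL hc; rewrite -subr_ge0 -sqr_bnorm_sub_psum // exprn_ge0 // bnorm_ge0. Qed.

(** Bessel's inequality kills every Taylor coefficient, so f vanishes at each point of the disc and
    not merely almost everywhere. *)
Lemma bnorm0_eq0 f : bergman f -> bnorm f = 0 -> forall z, unit_disc z -> f z = 0.
Proof.
move=> hf f0 z zD; have [c hc] := bergman_series hf.
have c0 m : c m = 0.
  apply: eq0_normc; apply/eqP; rewrite -sqrf_eq0 eq_le sqr_ge0 andbT.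
  have := bessel m.+1 (bergman_disc_L2 hf) hc; rewrite f0 expr0n /= /coef_energy.
  rewrite big_ord_recr /= => h.
  have : normc (c m) ^+ 2 / m.+1%:R <= 0.
    apply: le_trans h; rewrite lerDr; apply: sumr_ge0 => i _.
    by rewrite divr_ge0 // exprn_ge0.
  by rewrite pmulr_lle0 // invr_gt0 ltr0n.
apply: (@normc_cvg_unique (psum c z)); first exact: hc.
rewrite (_ : (fun n => _) = fun=> 0); first exact: cvg_cst.
by apply/funext => n; rewrite /psum big1 ?subrr ?normc0 // => m _; rewrite c0 mul0r.
Qed.

(** The half of Parseval opposite to Bessel, by Fatou's lemma for the squared moduli of the partial
    sums. *)
Lemma parseval_le f c (C : R) : disc_L2 f ->
  (forall z, unit_disc z -> psum_cvg c z (f z)) ->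
  (forall M, coef_energy c M <= C) -> bnorm f ^+ 2 <= C.
Proof.
move=> fL hc hC; have mD := @measurable_plane_disc R.
pose u M (p : mR * mR) : \bar R := (normc (psum c (cop p) M) ^+ 2)%:E.
have mu_ M : measurable_fun D (u M).
  by apply/measurable_EFinP; have [_ /measurable_int/measurable_EFinP] := disc_L2_psum c M.
have fin (h : R[i] -> R[i]) : disc_L2 h ->
    (\int[mu]_(p in D) (normc (h (cop p)) ^+ 2)%:E)%E = (bnorm h ^+ 2)%:E.
  move=> [_ ih]; rewrite sqr_bnorm /Rintegral fineK //; exact: integrable_fin_num.
have H : (\int[mu]_(p in D) limn_einf (u^~ p) <= limn_einf (fun M => \int[mu]_(p in D) u M p))%E.
  by apply: fatou => // M p _; rewrite lee_fin exprn_ge0.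
have nd : {homo coef_energy c : n m / (n <= m)%N >-> n <= m}.
  apply: homo_leq => [x|y x z|n]; [exact: lexx|exact: le_trans|].
  by rewrite /coef_energy big_ord_recr /= lerDl divr_ge0 // exprn_ge0.
have bd : has_ubound (range (coef_energy c)) by exists C => _ [M _ <-].
have cv := nondecreasing_cvgn nd bd; set l := sup _ in cv.
have lC : l <= C by apply: ge_sup; [exists (coef_energy c 0), 0%N|move=> _ [M _ <-]].
have E1 : (\int[mu]_(p in D) limn_einf (u^~ p))%E = (bnorm f ^+ 2)%:E.
  rewrite -fin //; apply: eq_integral => p; rewrite inE => pD.
  have cu : (fun M => u M p) @ \oo --> (normc (f (cop p)) ^+ 2)%:E.
    apply: cvg_EFin; first exact: nearW.
    apply: (@cvg_comp _ _ _ (fun M => normc (psum c (cop p) M)) (fun x : R => x ^+ 2));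
      last exact: exprn_continuous.
    have := hc _ pD => /cvgrPdist_lt h; apply/cvgrPdist_lt => e e0.
    apply: filterS (h e e0) => M; rewrite sub0r normrN ger0_norm // => H1.
    by apply: le_lt_trans H1; rewrite distrC normc_sub_le.
  by have [-> _] := cvg_limn_einf_sup cu.
have E2 : limn_einf (fun M => \int[mu]_(p in D) u M p)%E = l%:E.
  have cu : (fun M => (\int[mu]_(p in D) u M p)%E) @ \oo --> l%:E.
    rewrite (_ : (fun M => _) = fun M => (coef_energy c M)%:E).
      by apply: cvg_EFin => //; exact: nearW.
    apply/funext => M; rewrite -sqr_bnorm_psum.
    exact: (fin (fun z => psum c z M) (disc_L2_psum c M)).
  by have [-> _] := cvg_limn_einf_sup cu.
by move: H; rewrite E1 E2 lee_fin => h; exact: le_trans lC.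
Qed.

End BergmanCoefficients.

(** * Dividing out the nodes of one level *)

Section VanishingOnNodes.
Context {R : realType}.
Implicit Types (z w a : R[i]) (c b : nat -> R[i]) (r rho sigma s W V B e : R).

Lemma cvg_sum0 (u : nat -> nat -> R) k : (forall l, (l < k)%N -> u l @ \oo --> (0 : R)) ->
  (fun n => \sum_(l < k) u l n) @ \oo --> (0 : R).
Proof.
elim: k => [|k IH] h.
  rewrite (_ : (fun n => _) = fun=> 0); first exact: cvg_cst.
  by apply/funext => n; rewrite big_ord0.
rewrite (_ : (fun n => _) = fun n => \sum_(l < k) u l n + u k n).
  by rewrite -[X in _ --> X](addr0 (0 : R)); apply: cvgD; [apply: IH => l /ltnW; exact: h|exact: h].
by apply/funext => n; rewrite big_ord_recr.
Qed.

Lemma sum_blocks (F : nat -> R[i]) N Q :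
  \sum_(m < Q * N) F m = \sum_(j < Q) \sum_(i < N) F (j * N + i)%N.
Proof.
elim: Q => [|Q IH]; first by rewrite mul0n !big_ord0.
rewrite big_ord_recr /= -IH -!(big_mkord xpredT F).
rewrite (big_cat_nat (n := Q * N)) //=; last by rewrite leq_mul2r leqnSn orbT.
congr (_ + _); rewrite mulSnr -{1}[(Q * N)%N]add0n big_addn addKn big_mkord.
by apply: eq_bigr => i _; rewrite addnC.
Qed.

(* The discrete Fourier transform over the N points isolates the coefficients of
   index congruent to m0 modulo N. *)
Lemma vanishing_residue c N r m0 : (m0 < N)%N -> 0 < r ->
  (forall l, (l < N)%N -> psum_cvg c (r%:C * unity_root N ^+ l) 0) ->
  psum_cvg (fun j => c (m0 + j * N)%N) ((r ^+ N)%:C) 0.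
Proof.
move=> mN r0 hv; have N0 : (0 < N)%N by exact: leq_ltn_trans mN.
pose w : R[i] := unity_root N.
(* The exponent N - m0 stands for - m0 modulo N. Truncating at a multiple of N leaves only complete
   blocks, each contributing exactly one term of the residue class. *)
have E Q : (r ^+ m0)%:C * psum (fun j => c (m0 + j * N)%N) ((r ^+ N)%:C) Q =
    N%:R^-1 * \sum_(l < N) w ^+ (l * (N - m0)) * psum c (r%:C * w ^+ l) (Q * N).
  have -> : \sum_(l < N) w ^+ (l * (N - m0)) * psum c (r%:C * w ^+ l) (Q * N) =
      \sum_(m < Q * N) c m * r%:C ^+ m * \sum_(l < N) w ^+ (l * (m + (N - m0))).
    under eq_bigr => l _ do rewrite /psum mulr_sumr.
    rewrite exchange_big /=; apply: eq_bigr => m _; rewrite mulr_sumr; apply: eq_bigr => l _.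
    by rewrite exprMn mulnDr exprD [w ^+ (l * m)]exprM; ring.
  rewrite (sum_blocks (fun m => c m * r%:C ^+ m * \sum_(l < N) w ^+ (l * (m + (N - m0))))).
  rewrite /psum mulr_sumr [RHS]mulr_sumr; apply: eq_bigr => j _.
  rewrite (bigD1 (Ordinal mN)) //= [X in _ * (_ + X)]big1 ?addr0; last first.
    move=> i im; rewrite sum_unity_root // ifN ?mulr0 //.
    have iN := ltn_ord i; have {}im : (i : nat) <> m0 by move=> h; move/eqP: im; apply; exact: val_inj.
    rewrite -addnA dvdn_addr ?dvdn_mull //; apply/negP => /dvdnP[k hk].
    (* The number i + (N - m0) lies strictly between 0 and 2 N, which leaves only N itself, that is
       i = m0. *)
    have : (k = 1)%N by nia.
    by move=> k1; apply: im; lia.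
  rewrite sum_unity_root // ifT; last first.
    rewrite -addnA subnKC ?(ltnW mN) // dvdn_addr ?dvdnn ?dvdn_mull //.
  rewrite [(j * N + m0)%N]addnC exprD !rmorphXn /= -exprM [(N * j)%N]mulnC.
  by field; rewrite pnatr_eq0 -lt0n.
have rm0 : 0 < r ^+ m0 by rewrite exprn_gt0.
have bnd Q : normc (psum (fun j => c (m0 + j * N)%N) ((r ^+ N)%:C) Q - 0) <=
    (r ^+ m0)^-1 * \sum_(l < N) normc (psum c (r%:C * w ^+ l) (Q * N) - 0).
  rewrite subr0 mulrC ler_pdivlMr // mulrC.
  have -> : r ^+ m0 = normc ((r ^+ m0)%:C) by rewrite normc_real gtr0_norm.
  rewrite -normcM E normcM normcV -(rmorph_nat (real_complex R)) normc_real ger0_norm //.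
  apply: (@le_trans _ _ (\sum_(l < N) normc (w ^+ (l * (N - m0)) * psum c (r%:C * w ^+ l) (Q * N)))).
    apply: le_trans (normc_sum _ _ _); rewrite ler_piMl // invf_le1 ?ltr0n // ler1n //.
  apply: ler_sum => l _; rewrite subr0 normcM normcX normc_unity_root expr1n mul1r //.
have h : (fun Q => (r ^+ m0)^-1 * \sum_(l < N) normc (psum c (r%:C * w ^+ l) (Q * N) - 0)) @ \oo --> (0 : R).
  rewrite -[X in _ --> X](mulr0 (r ^+ m0)^-1); apply: cvgMr.
  apply: (@cvg_sum0 (fun l Q => normc (psum c (r%:C * w ^+ l) (Q * N) - 0))) => l lN.
  have /cvgrPdist_lt hl := hv l lN; apply/cvgrPdist_lt => e e0.
  have [M _ hM] := hl e e0; exists M => // Q MQ; apply: hM => /=.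
  by apply: leq_trans MQ _; rewrite leq_pmulr.
apply: (squeeze_cvgr (f := fun=> 0) _ _ h); last exact: cvg_cst.
by near=> Q; rewrite normc_ge0 bnd.
Unshelve. all: by end_near. Qed.

(** Coefficients of the quotient by z^N - s. In each residue class modulo N this is formal division
    by X - s with X = z^N, whose q-th coefficient is - (c_0 + ... + c_q s^q) / s^(q+1) in terms of
    the coefficients of the class. *)
Definition factor_coef c N s m : R[i] :=
  - psum (fun j => c (m %% N + j * N)%N) s%:C (m %/ N).+1 / s%:C ^+ (m %/ N).+1.

(** * Division of one coefficient sequence by z^N - s *)

Section Factor.
Context (c : nat -> R[i]) (N : nat) (s : R) (N0 : (0 < N)%N) (s0 : 0 < s).
Local Notation b := (factor_coef c N s).

Let sc0 : s%:C != 0 :> R[i].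
Proof. by rewrite -normc_gt0 normc_real gtr0_norm. Qed.

Lemma factor_coef_low m : (m < N)%N -> c m = - (s%:C * b m).
Proof.
move=> mN; rewrite /factor_coef divn_small // modn_small // /psum big_ord_recr big_ord0 /=.
by rewrite mul0n addn0 expr0 expr1 add0r mulr1; field.
Qed.

Lemma factor_coef_high m : c (m + N)%N = b m - s%:C * b (m + N)%N.
Proof.
rewrite /factor_coef modnDr divnDr // divnn N0 addn1.
pose d j := c (m %% N + j * N)%N; set A := psum _ _ (m %/ N).+1.
have dE : d (m %/ N).+1 = c (m + N)%N.
  by congr c; rewrite {3}(divn_eq m N); lia.
have -> : psum d s%:C (m %/ N).+2 = A + c (m + N)%N * s%:C ^+ (m %/ N).+1.
  by rewrite /psum big_ord_recr /= dE.
rewrite [s%:C ^+ (m %/ N).+2]exprS.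
by field; rewrite sc0 expf_neq0.
Qed.

(** The product (z^N - s) b read on partial sums; multiplication by z^N shifts indices by N, hence
    the two lengths. *)
Lemma factor_coef_psum z M : psum c z (M + N) = z ^+ N * psum b z M - s%:C * psum b z (M + N).
Proof.
have split_psum (d : nat -> R[i]) : psum d z (M + N) = psum d z N + \sum_(m < M) d (m + N)%N * z ^+ (m + N).
  rewrite /psum -!(big_mkord xpredT (fun m => d m * z ^+ m)).
  rewrite (big_cat_nat (n := N)) //= ?leq_addl //; congr (_ + _).
  by rewrite -{1}[N]add0n big_addn addnK big_mkord.
rewrite !split_psum mulrDr opprD addrCA; congr (_ + _).
  rewrite /psum mulr_sumr -sumrN; apply: eq_bigr => m _.
  by rewrite {1}(factor_coef_low (ltn_ord m)); ring.
rewrite /psum !mulr_sumr -sumrN -big_split /=; apply: eq_bigr => m _.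
by rewrite (factor_coef_high m) exprD; ring.
Qed.

Context (rho W : R) (rho0 : 0 < rho) (srho : s < rho ^+ N)
  (cW : forall m, normc (c m) * rho ^+ m <= W).

(** The formula divides by s^(q+1), which alone would be ruinous. Since the series of each class
    vanishes at s, the partial sum is minus its tail, of order (s / rho^N)^(q+1), and the powers of
    s cancel. *)
Lemma factor_coef_bound :
  (forall m0, (m0 < N)%N -> psum_cvg (fun j => c (m0 + j * N)%N) s%:C 0) ->
  forall m, normc (b m) * rho ^+ m <= W / (rho ^+ N - s).
Proof.
move=> hv m; pose q := (m %/ N)%N; pose m0 := (m %% N)%N.
have m0N : (m0 < N)%N by rewrite ltn_pmod.
have rN : 0 < rho ^+ N by rewrite exprn_gt0.
have ns : normc s%:C = s by rewrite normc_real gtr0_norm.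
have hB j : normc (c (m0 + j * N)%N) * (rho ^+ N) ^+ j <= W / rho ^+ m0.
  rewrite ler_pdivlMr ?exprn_gt0 // -mulrA -exprM -exprD mulnC addnC; exact: cW.
have := psum_tail_bound q.+1 rN (_ : normc s%:C < _) hB (hv m0 m0N).
rewrite ns sub0r normc_opp => /(_ srho) h.
rewrite /factor_coef -/q -/m0 normcM normcV normcX ns normc_opp.
have {1}-> : m = (m0 + q * N)%N by rewrite /m0 /q addnC -divn_eq.
have sq : 0 < s ^+ q.+1 by rewrite exprn_gt0.
rewrite mulrAC ler_pdivrMr //.
apply: le_trans (ler_wpM2r _ h) _; first by rewrite exprn_ge0 // ltW.
rewrite le_eqVlt; apply/orP; left; apply/eqP.
rewrite exprD mulnC exprM expr_div_n !exprS.
have d0 : rho ^+ N - s != 0 by rewrite subr_eq0 gt_eqF.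
have r0 : rho != 0 by rewrite gt_eqF.
by field; rewrite d0 !expf_neq0.
Qed.

(** Zeros away from the roots of z^N = s survive the division: the partial sums of b of lengths M
    and M + N differ by a geometrically small term, so the relation with c can be solved for b. *)
Lemma factor_coef_vanish z : (forall m, normc (b m) * rho ^+ m <= W / (rho ^+ N - s)) ->
  normc z < rho -> z ^+ N != s%:C -> psum_cvg c z 0 -> psum_cvg b z 0.
Proof.
move=> hb zr zN hc; pose B := W / (rho ^+ N - s) / (1 - normc z / rho).
pose k := normc (z ^+ N - s%:C).
have k0 : 0 < k by rewrite normc_gt0 subr_eq0.
have q0 : 0 <= normc z / rho by rewrite divr_ge0 // ltW.
have q1 : normc z / rho < 1 by rewrite ltr_pdivrMr // mul1r.
have bnd M : normc (psum b z M - 0) <= k^-1 * (normc (psum c z (M + N) - 0) +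
    s * ((normc z / rho) ^+ M * B)).
  rewrite !subr0 mulrC ler_pdivlMr // -normcM.
  have -> : psum b z M * (z ^+ N - s%:C) = psum c z (M + N) + s%:C * (psum b z (M + N) - psum b z M).
    by rewrite factor_coef_psum; ring.
  apply: le_trans (normc_triangle _ _) _; rewrite lerD2l normcM normc_real gtr0_norm //.
  rewrite ler_pM2l //; apply: le_trans (psum_cauchy_bound rho0 zr hb (leq_addr N M)) _.
  by rewrite le_eqVlt; apply/orP; left; apply/eqP; rewrite /B; ring.
have h : (fun M => k^-1 * (normc (psum c z (M + N) - 0) +
    s * ((normc z / rho) ^+ M * B))) @ \oo --> (0 : R).
  rewrite -[X in _ --> X](mulr0 k^-1); apply: cvgMr.
  rewrite -[X in _ --> X](addr0 (0 : R)); apply: cvgD.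
    have /cvgrPdist_lt hl := hc; apply/cvgrPdist_lt => e e0.
    have [M _ hM] := hl e e0; exists M => // Q MQ; apply: hM => /=.
    by apply: leq_trans MQ _; rewrite leq_addr.
  rewrite -[X in _ --> X](mulr0 s); apply: cvgMr.
  rewrite -[X in _ --> X](mul0r B); apply: cvgMl.
  by apply: cvg_expr; rewrite ger0_norm.
apply: (squeeze_cvgr (f := fun=> 0) _ _ h); last exact: cvg_cst.
by near=> Q; rewrite normc_ge0 bnd.
Unshelve. all: by end_near. Qed.

End Factor.

Lemma factor_coef_norm c N s sigma V : (0 < N)%N -> 0 < s -> 0 <= sigma ->
  (forall m, normc (factor_coef c N s m) * sigma ^+ m <= V) ->
  forall m, normc (c m) * sigma ^+ m <= (sigma ^+ N + s) * V.
Proof.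
move=> N0 s0 sg hb m.
have V0 : 0 <= V by apply: le_trans (hb 0%N); rewrite mulr_ge0 ?exprn_ge0.
have ns : normc s%:C = s by rewrite normc_real gtr0_norm.
have [mN|Nm] := ltnP m N.
  rewrite (factor_coef_low c s0 mN) normc_opp normcM ns -mulrA.
  apply: (@le_trans _ _ (s * V)); first by rewrite ler_pM2l.
  by rewrite ler_wpM2r // lerDr exprn_ge0.
rewrite -(subnK Nm) (factor_coef_high c N0 s0).
set k := (m - N)%N; rewrite mulrDl.
apply: (@le_trans _ _ ((normc (factor_coef c N s k) + s * normc (factor_coef c N s (k + N))) * sigma ^+ (k + N))).
  rewrite ler_wpM2r ?exprn_ge0 //; apply: le_trans (normc_triangle _ _) _.
  by rewrite lerD2l normc_opp normcM ns.
rewrite mulrDl; apply: lerD.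
  by rewrite exprD mulrA mulrC ler_wpM2l ?exprn_ge0.
by rewrite -mulrA ler_pM2l.
Qed.

End VanishingOnNodes.

(** * Decay of functions vanishing at the nodes *)

Section NodeEstimates.
Context {R : realType}.
Implicit Types (c b : nat -> R[i]) (r rho sigma s x W V B e : R).
Local Notation radius := (@Defs.radius R).

Lemma bernoulli_le x n : 0 <= x -> x <= 1 -> 1 - n%:R * x <= (1 - x) ^+ n.
Proof.
move=> x0 x1; elim: n => [|n IH]; first by rewrite mul0r subr0 expr0.
have h : 0 <= 1 - x by rewrite subr_ge0.
have := ler_wpM2l h IH; rewrite -exprS; apply: le_trans.
have := mulr_ge0 (mulr_ge0 (ler0n R n) x0) x0.
rewrite -natr1; set k := n%:R; lra.
Qed.

Lemma bernoulli_ge x n : 0 <= x -> 1 + n%:R * x <= (1 + x) ^+ n.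
Proof.
move=> x0; elim: n => [|n IH]; first by rewrite mul0r addr0 expr0.
have h : 0 <= 1 + x by rewrite addr_ge0.
have := ler_wpM2l h IH; rewrite -exprS; apply: le_trans.
have := mulr_ge0 (mulr_ge0 (ler0n R n) x0) x0.
rewrite -natr1; set k := n%:R; lra.
Qed.

Lemma pow4_gt0 k : 0 < 4 ^+ k :> R. Proof. by rewrite exprn_gt0. Qed.
Lemma pow4_ge1 k : 1 <= 4 ^+ k :> R. Proof. by rewrite exprn_ege1 // ler1n. Qed.

Lemma radiusE k : radius k = 1 - 2 / (4 ^+ k + 1) :> R.
Proof.
rewrite /Defs.radius; have y0 : 2 ^+ k != 0 :> R by rewrite expf_neq0.
have -> : 4 ^+ k = 2 ^+ k * 2 ^+ k :> R by rewrite -exprMn; congr (_ ^+ k); ring.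
have y1 : 0 < 2 ^+ k * 2 ^+ k + 1 :> R by rewrite ltr_wpDl // mulr_ge0 ?exprn_ge0.
by field; rewrite y0 gt_eqF.
Qed.

Lemma radius_gt0 k : (0 < k)%N -> 0 < radius k :> R.
Proof.
case: k => // k _; rewrite radiusE subr_gt0 ltr_pdivrMr ?mul1r ?addr_gt0 ?pow4_gt0 //.
by have := pow4_ge1 k; rewrite exprS; lra.
Qed.

Lemma radius_ge0 k : 0 <= radius k :> R.
Proof.
case: k => [|k]; last by rewrite ltW ?radius_gt0.
by rewrite /Defs.radius expr0 invr1 subrr mul0r.
Qed.

Lemma radius_le k : radius k <= 1 - (4 ^+ k)^-1 :> R.
Proof.
rewrite radiusE lerD2l lerN2 -[X in X <= _]mul1r ler_pdivrMr ?pow4_gt0 //.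
rewrite mulrAC ler_pdivlMr ?addr_gt0 ?pow4_gt0 // mul1r.
have := pow4_ge1 k; lra.
Qed.

Lemma radius_lt1 k : radius k < 1 :> R.
Proof. by apply: le_lt_trans (radius_le k) _; rewrite ltrBlDr ltrDl invr_gt0 pow4_gt0. Qed.

Lemma radius_lt j k : (j < k)%N -> radius j < radius k :> R.
Proof.
move=> jk; rewrite !radiusE ltrD2l ltrN2 ltr_pM2l // ltf_pV2 ?posrE ?addr_gt0 ?pow4_gt0 //.
by rewrite ltrD2r ltr_eXn2l // ltr1n.
Qed.

(** Agrees with [level_size k] for k > 0. Level 0 has the single node 0 instead of 8, so the
    division argument starts at level 1. *)
Definition node_count k : nat := (2 ^ (2 * k + 3))%N.

Lemma node_count_gt0 k : (0 < node_count k)%N.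
Proof. by rewrite expn_gt0. Qed.

Lemma node_countE k : (node_count k)%:R = 8 * 4 ^+ k :> R.
Proof. by rewrite /node_count natrX exprD exprM mulrC; congr (_ * _ ^+ k); ring. Qed.

Lemma nodeE k l : node k l = (radius k)%:C * unity_root (node_count k) ^+ l :> R[i].
Proof.
rewrite /node -cisMn -/(cis _); congr (_ * cis _).
by rewrite /node_count natrX; ring.
Qed.

Lemma normc_node k l : normc (node k l) = radius k :> R.
Proof.
by rewrite nodeE normcM normcX normc_unity_root expr1n mulr1 normc_real ger0_norm ?radius_ge0.
Qed.

(** The common value of z^(N_k) at all nodes of level k. *)
Definition node_power k : R := radius k ^+ node_count k.

Lemma node_power_gt0 k : (0 < k)%N -> 0 < node_power k.
Proof. by move=> k0; rewrite exprn_gt0 // radius_gt0. Qed.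

(* (1 - x)^n (1 + x)^n <= 1 gives (1 - 1/4^k)^(4^k) <= 1/2, to the eighth power *)
Lemma node_power_le k : node_power k <= 256^-1.
Proof.
pose x : R := (4 ^+ k)^-1; have x0 : 0 < x by rewrite invr_gt0 pow4_gt0.
have x1 : x <= 1 by rewrite invf_le1 ?pow4_gt0 ?pow4_ge1.
have h : (1 - x) ^+ (4 ^ k)%N <= 2^-1.
  have h2 := bernoulli_ge (4 ^ k)%N (ltW x0).
  rewrite natrX mulfV ?gt_eqF ?pow4_gt0 // in h2.
  have h1 : (1 - x) ^+ (4 ^ k)%N * (1 + x) ^+ (4 ^ k)%N <= 1.
    rewrite -exprMn exprn_ile1 //; first by rewrite mulr_ge0 ?subr_ge0 ?addr_ge0 // ltW.
    by have := sqr_ge0 x; lra.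
  rewrite -[leRHS]mul1r ler_pdivlMr //; apply: le_trans h1.
  apply: ler_wpM2l; first by rewrite exprn_ge0 // subr_ge0.
  by apply: le_trans h2; lra.
have e8 : (256^-1 : R) = 2^-1 ^+ 8 by rewrite exprVn; congr (_^-1); ring.
have -> : node_power k = (radius k ^+ (4 ^ k)%N) ^+ 8.
  by rewrite -exprM /node_power /node_count expnD expnM.
rewrite e8 lerXn2r ?nnegrE ?exprn_ge0 ?radius_ge0 ?invr_ge0 //.
apply: le_trans h; rewrite lerXn2r ?nnegrE ?radius_ge0 ?subr_ge0 //.
exact: radius_le.
Qed.

(** For k <= n, level k has at most 8 * 4^n nodes, so this gap makes their number times 1 - rho at
    most 1/2, and Bernoulli's inequality gives rho^(N_k) >= 1/2. With a gap 4^-(n+1) Bernoulli would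
    give nothing positive at level n. *)
Definition outer_radius n : R := 1 - (4 ^+ n.+2)^-1.

Lemma outer_radius_lt1 n : outer_radius n < 1.
Proof. by rewrite ltrBlDr ltrDl invr_gt0 pow4_gt0. Qed.

Lemma outer_radius_gt n k : (k <= n)%N -> radius k < outer_radius n.
Proof.
move=> kn; apply: le_lt_trans (radius_le k) _; rewrite ltrD2l ltrN2.
rewrite ltf_pV2 ?posrE ?pow4_gt0 // ltr_eXn2l ?ltr1n //.
by apply: leq_trans (_ : n.+1 <= _)%N.
Qed.

Lemma outer_radius_gt0 n : 0 < outer_radius n.
Proof. exact: le_lt_trans (radius_ge0 0) (outer_radius_gt (leq0n n)). Qed.

Lemma outer_radius_pow n k : (k <= n)%N -> 2^-1 <= outer_radius n ^+ node_count k.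
Proof.
move=> kn; have x0 := pow4_gt0 n.+2.
apply: le_trans (bernoulli_le (node_count k) _ _); last 2 first.
- by rewrite invr_ge0 ltW.
- by rewrite invf_le1 // pow4_ge1.
rewrite node_countE; have h : 8 * 4 ^+ k / 4 ^+ n.+2 <= 2^-1 :> R.
  rewrite ler_pdivrMr // !exprS.
  have : 4 ^+ k <= 4 ^+ n :> R by rewrite ler_weXn2l // ler1n.
  lra.
lra.
Qed.

(** The levels are divided out from the outermost inwards: at a node z of a lower level |z|^N is
    strictly below s, so that its zero survives. The radius rho stays fixed throughout, which is why
    it must exceed all the node radii. *)
Lemma vanishing_decay n c rho sigma W : 0 < sigma -> sigma <= rho ->
  (forall k, (0 < k <= n)%N -> radius k < rho) ->
  (forall k, (0 < k <= n)%N -> node_power k < rho ^+ node_count k) ->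
  (forall m, normc (c m) * rho ^+ m <= W) ->
  (forall k l, (0 < k <= n)%N -> (l < node_count k)%N -> psum_cvg c (node k l) 0) ->
  forall m, normc (c m) * sigma ^+ m <=
    W * \prod_(k < n) ((sigma ^+ node_count k.+1 + node_power k.+1) /
                       (rho ^+ node_count k.+1 - node_power k.+1)).
Proof.
move=> sg0 sr; have rho0 : 0 < rho by exact: lt_le_trans sr.
elim: n c W => [|n IH] c W rr pr cW hv m.
  rewrite big_ord0 mulr1; apply: le_trans (cW m).
  by rewrite ler_wpM2l // lerXn2r ?nnegrE // ltW.
pose N := node_count n.+1; pose s := node_power n.+1.
have N0 : (0 < N)%N := node_count_gt0 _.
have s0 : 0 < s by exact: node_power_gt0.
have srho : s < rho ^+ N by apply: pr; rewrite ltnS leqnn.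
have hres m0 : (m0 < N)%N -> psum_cvg (fun j => c (m0 + j * N)%N) s%:C 0.
  move=> m0N; apply: vanishing_residue => //; first exact: radius_gt0.
  by move=> l lN; rewrite -nodeE; apply: hv => //; rewrite ltnS leqnn.
have hb := factor_coef_bound N0 s0 rho0 srho cW hres.
rewrite big_ord_recr /= -/N -/s.
have le1 k : (0 < k <= n)%N -> (0 < k <= n.+1)%N.
  by case/andP=> -> kn; rewrite (leq_trans kn).
have := IH (factor_coef c N s) _ (fun k h => rr k (le1 k h)) (fun k h => pr k (le1 k h)) hb.
move=> /(_ _)/(factor_coef_norm N0 s0 (ltW sg0)) H.
rewrite mulrA mulrCA mulrA [X in _ <= X](_ : _ = (sigma ^+ N + s) *
   (W / (rho ^+ N - s) * \prod_(k < n) ((sigma ^+ node_count k.+1 + node_power k.+1) /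
                       (rho ^+ node_count k.+1 - node_power k.+1)))); last by ring.
apply: H => k l kn lk.
have zr : normc (node k l : R[i]) < rho by rewrite normc_node; apply: rr; exact: le1.
apply: (factor_coef_vanish N0 s0 rho0 hb zr); last by apply: hv => //; exact: le1.
apply/eqP => /(congr1 (@normc R)); rewrite normcX normc_node normc_real gtr0_norm // => h.
have : radius k ^+ N < s.
  rewrite /s /node_power -/N ltr_pXn2r ?nnegrE ?radius_ge0 //.
  by apply: radius_lt; case/andP: kn.
by rewrite h ltxx.
Qed.

(** The crude estimate |c m| <= B (m + 1) is enough: (m + 1) rho^m is at most a geometric sum, so
    only one power of 1 / (1 - rho) is lost. *)
Lemma coef_energy_bound c B rho m : 0 <= B -> 0 <= rho -> rho < 1 ->
  (forall M, coef_energy c M <= B ^+ 2) -> normc (c m) * rho ^+ m <= B / (1 - rho).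
Proof.
move=> B0 r0 r1 hc; have d0 : 0 < 1 - rho by rewrite subr_gt0.
have c1 : normc (c m) <= B * m.+1%:R.
  rewrite -(ler_pXn2r (n := 2)) ?nnegrE ?mulr_ge0 // exprMn.
  have m0 : 0 < m.+1%:R :> R by rewrite ltr0n.
  have h : normc (c m) ^+ 2 / m.+1%:R <= B ^+ 2.
    apply: le_trans (hc m.+1); rewrite /coef_energy big_ord_recr /= lerDr.
    by apply: sumr_ge0 => i _; rewrite divr_ge0 // exprn_ge0.
  move: h; rewrite ler_pdivrMr // => h; apply: le_trans h _.
  by rewrite ler_wpM2l ?sqr_ge0 // expr2; apply: ler_peMr; rewrite ?ler1n.
apply: le_trans (ler_wpM2r (exprn_ge0 m r0) c1) _; rewrite -mulrA ler_wpM2l //.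
have := geometric_tail r0 r1 (leq0n m.+1); rewrite expr0 div1r big_mkord; apply: le_trans.
have -> : m.+1%:R * rho ^+ m = \sum_(j < m.+1) rho ^+ m.
  by rewrite sumr_const card_ord mulr_natl.
by apply: ler_sum => j _; apply: ler_wiXn2l; [|exact: ltW|rewrite -ltnS].
Qed.

Lemma prod_cvg0 (x : nat -> R) (k0 : nat) : (forall k, 0 <= x k) ->
  (forall k, (k0 <= k)%N -> x k <= 2^-1) ->
  (fun n => \prod_(k < n) x k) @ \oo --> (0 : R).
Proof.
move=> x0 xh; pose P0 := \prod_(k < k0) x k.
have P00 : 0 <= P0 by apply: prodr_ge0.
have bnd n : \prod_(k < k0 + n) x k <= P0 * 2^-1 ^+ n.
  elim: n => [|n IH]; first by rewrite addn0 expr0 mulr1.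
  rewrite addnS big_ord_recr /= exprSr mulrA; apply: ler_pM => //.
    by apply: prodr_ge0.
  by apply: xh; rewrite leq_addr.
have h : (fun n => P0 * 2^-1 ^+ n) @ \oo --> (0 : R).
  rewrite -[X in _ --> X](mulr0 P0); apply: cvgMr; apply: cvg_expr.
  by rewrite ger0_norm // invf_lt1 // ltr1n.
rewrite -(cvg_shiftn k0).
apply: (squeeze_cvgr (f := fun=> 0) _ _ h); last exact: cvg_cst.
near=> n; rewrite prodr_ge0 //= addnC; exact: bnd.
Unshelve. all: by end_near. Qed.

Lemma coef_decay sigma B e : 0 < sigma -> sigma < 1 -> 0 <= B -> 0 < e ->
  exists n0, forall n c, (n0 <= n)%N -> (forall M, coef_energy c M <= B ^+ 2) ->
    (forall k l, (0 < k <= n)%N -> (l < node_count k)%N -> psum_cvg c (node k l) 0) ->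
    forall m, normc (c m) * sigma ^+ m <= e.
Proof.
move=> sg0 sg1 B0 e0.
(* The growth 4^n is shared out, a factor 4 per level. The constant 127 / 256 = 1/2 - 1/256 bounds
   rho^N - s from below. *)
pose a k : R := 4 * ((sigma ^+ node_count k.+1 + 256^-1) * (256 / 127)).
have a0 k : 0 <= a k.
  by have := exprn_ge0 (node_count k.+1) (ltW sg0); rewrite /a; lra.
have [k0 hk0] : exists k0, forall k, (k0 <= k)%N -> a k <= 2^-1.
  have : (fun n => sigma ^+ n) @ \oo --> (0 : R) by apply: cvg_expr; rewrite gtr0_norm.
  (* Once sigma^N is below 1/256, a k is at most 4 * (2/256) * (256/127) = 8/127. *)
  have q0 : 0 < 256^-1 :> R by rewrite invr_gt0 ltr0n.
  move=> /cvgrPdist_lt /(_ _ q0)[K _ hK].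
  exists K => k Kk; have kN : (K <= node_count k.+1)%N.
    apply: leq_trans Kk _; apply: leq_trans (ltnW (ltn_expl k (ltnSn 1))) _.
    by rewrite /node_count leq_exp2l //; lia.
  have := hK _ kN; rewrite sub0r normrN gtr0_norm ?exprn_gt0 // /a; lra.
have P := prod_cvg0 a0 hk0.
have : (fun n => B * 16 * \prod_(k < n) a k) @ \oo --> (0 : R).
  by rewrite -[X in _ --> X](mulr0 (B * 16)); exact: cvgMr.
move=> /cvgrPdist_lt /(_ e e0)[n1 _ hn1].
have [n2 hn2] : exists n2, forall n, (n2 <= n)%N -> sigma <= outer_radius n.
  have : (fun n => 4^-1 ^+ n) @ \oo --> (0 : R).
    by apply: cvg_expr; rewrite ger0_norm // invf_lt1 // ltr1n.
  have d0 : 0 < 1 - sigma by rewrite subr_gt0.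
  move=> /cvgrPdist_lt /(_ _ d0)[n2 _ h2]; exists n2 => n nn.
  have /= := h2 n.+2 (leq_trans nn (leq_addl 2 n)).
  rewrite sub0r normrN ger0_norm ?exprn_ge0 ?invr_ge0 // exprVn /outer_radius; lra.
exists (maxn n1 n2) => n c; rewrite geq_max => /andP[nn1 nn2] hc hv m.
have rho0 := outer_radius_gt0 n; have rho1 := outer_radius_lt1 n.
have cW j := coef_energy_bound j B0 (ltW rho0) rho1 hc.
have half k : (0 < k <= n)%N -> 2^-1 <= outer_radius n ^+ node_count k.
  by case/andP=> _; exact: outer_radius_pow.
apply: le_trans (vanishing_decay sg0 (hn2 n nn2) _ _ cW hv m) _.
- by move=> k /andP[_ kn]; exact: outer_radius_gt.
- by move=> k kn; have := half k kn; have := node_power_le k; lra.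
have := hn1 n nn1; rewrite sub0r normrN ger0_norm; last first.
  by rewrite !mulr_ge0 // prodr_ge0.
move=> /ltW; apply: le_trans.
have -> : B / (1 - outer_radius n) = B * 16 * 4 ^+ n.
  by rewrite /outer_radius opprB addrC subrK invrK !exprS; ring.
rewrite -mulrA ler_wpM2l ?mulr_ge0 //.
have -> : 4 ^+ n = \prod_(k < n) (4 : R) by rewrite prodr_const card_ord.
rewrite -big_split /=; apply: ler_prod => k _.
have kn : (0 < k.+1 <= n)%N by rewrite ltn_ord.
have h1 := half _ kn; have h2 := node_power_le k.+1; have h3 := node_power_gt0 (ltn0Sn k).
have h4 : 0 < sigma ^+ node_count k.+1 by rewrite exprn_gt0.
have d0 : 0 < outer_radius n ^+ node_count k.+1 - node_power k.+1 by lra.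
rewrite mulr_ge0 ?divr_ge0 ?(ltW d0) //=; last by lra.
rewrite ler_wpM2l //; apply: ler_pM.
- lra.
- by rewrite invr_ge0 ltW.
- lra.
have -> : 256 / 127 = (127 / 256)^-1 :> R by rewrite invf_div.
have p0 : 0 < 127 / 256 :> R by lra.
rewrite lef_pV2 ?posrE; [lra|exact: d0|exact: p0].
Qed.

End NodeEstimates.

(** * Gram-Schmidt *)

Section GramSchmidt.
Context {R : realType}.
Implicit Types (f g v e : R[i] -> R[i]) (vs es : seq (R[i] -> R[i])) (a : nat -> R[i]).
Local Notation fun0 := (fun _ : R[i] => 0 : R[i]).

Definition lincomb a (F : nat -> R[i] -> R[i]) n : R[i] -> R[i] :=
  fun z => \sum_(i < n) a i * F i z.

Lemma bergman_lincomb a F n : (forall i, bergman (F i)) -> bergman (lincomb a F n).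
Proof.
move=> hF; elim: n => [|n IH].
  rewrite (_ : lincomb a F 0 = fun0); first exact: bergman0.
  by apply/funext => z; rewrite /lincomb big_ord0.
rewrite (_ : lincomb a F n.+1 = fun z => lincomb a F n z + a n * F n z).
  by apply: bergmanD => //; exact: bergmanZ.
by apply/funext => z; rewrite /lincomb big_ord_recr.
Qed.

Lemma inner_lincombl a F n g : (forall i, bergman (F i)) -> bergman g ->
  inner (lincomb a F n) g = \sum_(i < n) a i * inner (F i) g.
Proof.
move=> hF hg; have gL := bergman_disc_L2 hg.
rewrite /lincomb (@inner_suml _ n (fun i z => a i * F i z)) //.
  by apply: eq_bigr => i _; rewrite innerZl //; exact: bergman_disc_L2.
by move=> i; apply: disc_L2Z; exact: bergman_disc_L2.
Qed.

Lemma inner_lincombr a F n g : (forall i, bergman (F i)) -> bergman g ->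
  inner g (lincomb a F n) = \sum_(i < n) (a i)^* * inner g (F i).
Proof.
move=> hF hg; have gL := bergman_disc_L2 hg.
rewrite /lincomb (@inner_sumr _ n (fun i z => a i * F i z)) //.
  by apply: eq_bigr => i _; rewrite innerZr //; exact: bergman_disc_L2.
by move=> i; apply: disc_L2Z; exact: bergman_disc_L2.
Qed.

Definition seq_proj es f : R[i] -> R[i] := fun z => \sum_(e <- es) inner f e * e z.

Lemma seq_projE es f :
  seq_proj es f = lincomb (fun i => inner f (nth fun0 es i)) (nth fun0 es) (size es).
Proof.
by apply/funext => z; rewrite /seq_proj /lincomb (big_nth fun0) big_mkord.
Qed.

Lemma bergman_seq_proj es f : (forall i, bergman (nth fun0 es i)) -> bergman (seq_proj es f).
Proof. by move=> hes; rewrite seq_projE; exact: bergman_lincomb. Qed.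

Lemma seq_proj_rcons es e f z : seq_proj (rcons es e) f z = seq_proj es f z + inner f e * e z.
Proof. by rewrite /seq_proj big_rcons. Qed.

Lemma bergman_inner_sub f g e : bergman f -> bergman g -> bergman e ->
  inner (fun z => f z - g z) e = inner f e - inner g e.
Proof. by move=> hf hg he; apply: innerBl; exact: bergman_disc_L2. Qed.

Lemma inner_eq0_sym f g : bergman f -> bergman g -> inner f g = 0 -> inner g f = 0.
Proof.
by move=> hf hg h; rewrite (inner_conj (bergman_disc_L2 hf) (bergman_disc_L2 hg)) h conjC0.
Qed.

Definition proj_residual es f : R[i] -> R[i] := fun z => f z - seq_proj es f z.

(* A linearly dependent input gives the zero vector (division by 0 is 0), which
   does not disturb the orthogonality relations. *)
Lemma gram_schmidt_orthogonal vs : (forall i, bergman (nth fun0 vs i)) ->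
  let es := gram_schmidt vs in
  [/\ size es = size vs, (forall i, bergman (nth fun0 es i)),
    (forall f i, bergman f -> inner (proj_residual es f) (nth fun0 es i) = 0) &
    (forall f i, bergman f -> inner (proj_residual es f) (nth fun0 vs i) = 0)].
Proof.
elim/last_ind: vs => [|vs v IH] hvs /=.
  split; [by []|move=> i|move=> f i _|move=> f i _].
  - by rewrite nth_nil; exact: bergman0.
  - by rewrite nth_nil; exact: inner0r.
  - by rewrite nth_nil; exact: inner0r.
have hvs' i : bergman (nth fun0 vs i).
  have [i_lt|i_ge] := ltnP i (size vs); last by rewrite nth_default //; exact: bergman0.
  by have := hvs i; rewrite nth_rcons i_lt.
have hv : bergman v by have := hvs (size vs); rewrite nth_rcons ltnn eqxx.
have [] := IH hvs'; rewrite /gram_schmidt foldl_rcons -/(gram_schmidt vs).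
set es := gram_schmidt vs => sz hes oes ovs.
have hP f : bergman (seq_proj es f) by exact: bergman_seq_proj.
have hres f : bergman f -> bergman (proj_residual es f) by move=> hf; exact: bergmanB.
pose u := proj_residual es v; have hu : bergman u := hres v hv.
pose k : R[i] := (bnorm u)%:C^-1; pose e : R[i] -> R[i] := fun z => k * u z.
have he : bergman e by exact: bergmanZ.
have stepE : gram_schmidt_step es v = rcons es e.
  rewrite /gram_schmidt_step; congr rcons; apply/funext => z; rewrite mulrC; congr (_ * _).
rewrite stepE.
have hes' i : bergman (nth fun0 (rcons es e) i).
  rewrite nth_rcons; case: ifP => _; first exact: hes.
  by case: ifP => _ //; exact: bergman0.
have ueq : forall z, unit_disc z -> u z = (bnorm u)%:C * e z.
  move=> z zD; rewrite /e /k.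
  have [b0|b0] := eqVneq (bnorm u) 0; first by rewrite b0 mul0r bnorm0_eq0.
  by rewrite mulrA mulfV ?mul1r //; apply: contra b0 => /eqP/complexI ->.
have e_orth g : bergman g -> inner u g = 0 -> inner e g = 0.
  by move=> hg h; rewrite innerZl ?h ?mulr0 //; exact: bergman_disc_L2.
have e_es i : inner e (nth fun0 es i) = 0 by apply: e_orth => //; exact: oes.
have e_vs i : inner e (nth fun0 vs i) = 0 by apply: e_orth => //; exact: ovs.
have Pe f : inner (seq_proj es f) e = 0.
  rewrite seq_projE inner_lincombl //; apply: big1 => i _.
  by rewrite (inner_eq0_sym he (hes i) (e_es i)) mulr0.
(* Covers both cases: the norm of e is 1, or e vanishes on the disc and both sides are 0. *)
have ee f : bergman f -> inner f e * inner e e = inner f e.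
  move=> hf; have eL := bergman_disc_L2 he; have uL := bergman_disc_L2 hu.
  have -> : inner e e = k * (k^* * (bnorm u ^+ 2)%:C).
    by rewrite {1}/e innerZl // innerZr // inner_sqr_bnorm.
  rewrite /k.
  have [b0|b0] := eqVneq (bnorm u) 0; last first.
    have b1 : (bnorm u)%:C != 0 :> R[i] by apply: contra b0 => /eqP/complexI ->.
    have -> : ((bnorm u)%:C^-1)^* = (bnorm u)%:C^-1.
      by rewrite fmorphV; congr (_^-1); apply: complex_ext; rewrite ?cRe_conj ?cIm_conj //= oppr0.
    by rewrite expr2 (rmorphM (real_complex R)) /=; field.
  rewrite b0 rmorph0 invr0 mul0r mulr0; apply/esym.
  have e0 : inner f (fun=> 0) = inner f e by apply: eq_inner => // z zD; rewrite /e /k b0 rmorph0 invr0 mul0r.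
  by rewrite -e0 inner0r.
have resE f : proj_residual (rcons es e) f = fun z => proj_residual es f z - inner f e * e z.
  by apply/funext => z; rewrite /proj_residual seq_proj_rcons opprD addrA.
have res_inner f g : bergman f -> bergman g -> inner (proj_residual (rcons es e) f) g =
    inner (proj_residual es f) g - inner f e * inner e g.
  move=> hf hg; rewrite resE (bergman_inner_sub (hres f hf) (bergmanZ _ he) hg).
  by rewrite (innerZl _ (bergman_disc_L2 he) (bergman_disc_L2 hg)).
have hres' f : bergman f -> bergman (proj_residual (rcons es e) f).
  by move=> hf; rewrite resE; apply: bergmanB; [exact: hres|exact: bergmanZ].
have res_es f i : bergman f -> inner (proj_residual (rcons es e) f) (nth fun0 es i) = 0.
  by move=> hf; rewrite res_inner // oes // e_es mulr0 subr0.
have res_e f : bergman f -> inner (proj_residual (rcons es e) f) e = 0.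
  by move=> hf; rewrite res_inner // ee // bergman_inner_sub // Pe subr0 subrr.
split=> //.
- by rewrite !size_rcons sz.
- move=> f i hf; rewrite nth_rcons; case: ifP => _; first exact: res_es.
  by case: ifP => _; [exact: res_e|exact: inner0r].
move=> f i hf; rewrite nth_rcons; case: ifP => _.
  by rewrite res_inner // ovs // e_vs mulr0 subr0.
case: ifP => _; last exact: inner0r.
have -> : inner (proj_residual (rcons es e) f) v =
    inner (proj_residual (rcons es e) f) (fun z => (bnorm u)%:C * e z + seq_proj es v z).
  by apply: eq_inner => // z zD; rewrite -ueq // /u /proj_residual subrK.
have rL := bergman_disc_L2 (hres' f hf); have eL := bergman_disc_L2 he.
rewrite (innerDr (disc_L2Z _ eL) (bergman_disc_L2 (hP v)) rL) (innerZr _ eL rL).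
rewrite (res_e f hf) mulr0 add0r seq_projE (inner_lincombr _ _ hes (hres' f hf)).
by apply: big1 => j _; rewrite res_es // mulr0.
Qed.

Lemma size_gram_schmidt vs : size (gram_schmidt vs) = size vs.
Proof.
elim/last_ind: vs => // vs v IH.
by rewrite /gram_schmidt foldl_rcons -/(gram_schmidt vs) /gram_schmidt_step !size_rcons IH.
Qed.

(** The triangular shape of the coefficients is not recorded: membership in the span of all inputs
    is what places the projection in the resolution space. *)
Lemma gram_schmidt_span vs i : (i < size vs)%N -> exists a, forall z,
  nth fun0 (gram_schmidt vs) i z = lincomb a (nth fun0 vs) (size vs) z.
Proof.
elim/last_ind: vs i => [//|vs v IH] i; rewrite size_rcons ltnS => i_le.
rewrite /gram_schmidt foldl_rcons -/(gram_schmidt vs) /gram_schmidt_step.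
set es := gram_schmidt vs.
have ext a z : lincomb a (nth fun0 vs) (size vs) z =
    \sum_(j < size vs) a j * nth fun0 (rcons vs v) j z.
  by apply: eq_bigr => j _; rewrite nth_rcons ltn_ord.
rewrite nth_rcons size_gram_schmidt; case: ltnP => [i_lt|i_ge].
  have [a ha] := IH i i_lt; exists (fun j => if (j < size vs)%N then a j else 0) => z.
  rewrite ha ext /lincomb big_ord_recr /= ltnn mul0r addr0.
  by apply: eq_bigr => j _; rewrite ltn_ord.
have -> : (i == size vs) by rewrite eqn_leq i_le.
have /choice[A hA] : forall j, exists a, forall z, (j < size vs)%N ->
    nth fun0 es j z = lincomb a (nth fun0 vs) (size vs) z.
  move=> j; have [j_lt|j_ge] := ltnP j (size vs); last by exists (fun=> 0).
  by have [a ha] := IH j j_lt; exists a => z _; exact: ha.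
pose k : R[i] := (bnorm (fun z => v z - \sum_(e <- es) inner v e * e z))%:C^-1.
exists (fun j => if (j < size vs)%N then
  - k * \sum_(i < size vs) inner v (nth fun0 es i) * A i j else k) => z.
rewrite /lincomb big_ord_recr /= ltnn nth_rcons ltnn eqxx -/k.
rewrite mulrBl addrC [v z * k]mulrC; congr (_ + _).
rewrite (big_nth fun0) big_mkord size_gram_schmidt.
transitivity (- k * \sum_(i < size vs) \sum_(j < size vs)
   inner v (nth fun0 es i) * A i j * nth fun0 vs j z).
  rewrite mulNr [k * _]mulrC; congr (- (_ * _)); apply: eq_bigr => m _.
  rewrite (hA m z (ltn_ord m)) /lincomb mulr_sumr; apply: eq_bigr => j _.
  by rewrite mulrA.
rewrite exchange_big /= mulr_sumr; apply: eq_bigr => j _.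
by rewrite ltn_ord nth_rcons ltn_ord -mulr_suml mulrA.
Qed.

Lemma gram_schmidt_prefix vs ws i : (i < size vs)%N ->
  nth fun0 (gram_schmidt (vs ++ ws)) i = nth fun0 (gram_schmidt vs) i.
Proof.
move=> ivs; elim/last_ind: ws => [|ws w IH]; first by rewrite cats0.
rewrite -rcons_cat {1}/gram_schmidt foldl_rcons -/(gram_schmidt (vs ++ ws)).
rewrite nth_rcons size_gram_schmidt size_cat ltn_addr //.
Qed.

End GramSchmidt.

(** * Enumeration of the nodes *)

Section NodeEnumeration.
Context {R : realType}.
Implicit Types (f : R[i] -> R[i]) (k l n : nat).
Local Notation fun0 := (fun _ : R[i] => 0 : R[i]).
Local Notation nodes n := (@nodes_upto R n).
Local Notation kernels n := [seq bergman_kernel a | a <- nodes n].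

Definition offset n : nat := \sum_(j < n) level_size j.

Lemma offsetS n : offset n.+1 = (offset n + level_size n)%N.
Proof. by rewrite /offset big_ord_recr. Qed.

Lemma nodes_uptoS n :
  nodes n.+1 = nodes n ++ [seq node n.+1 l | l <- iota 0 (level_size n.+1)].
Proof.
by rewrite /nodes_upto -addn1 iotaD map_cat flatten_cat /= cats0.
Qed.

Lemma size_nodes_upto n : size (nodes n) = offset n.+1.
Proof.
elim: n => [|n IH]; first by rewrite /nodes_upto /= offsetS /offset big_ord0.
by rewrite nodes_uptoS size_cat IH size_map size_iota [in RHS]offsetS.
Qed.

Lemma nodes_upto_prefix k n : (k <= n)%N -> exists t, nodes n = nodes k ++ t.
Proof.
move=> kn; rewrite -(subnK kn); elim: (n - k)%N => [|j [t IH]].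
  by exists [::]; rewrite cats0.
rewrite addSn nodes_uptoS IH -catA; eexists; reflexivity.
Qed.

Lemma offset_lt k l : (l < level_size k)%N -> (offset k + l < offset k.+1)%N.
Proof. by rewrite offsetS ltn_add2l. Qed.

Lemma nth_nodes_upto k l n : (k <= n)%N -> (l < level_size k)%N ->
  nth 0 (nodes n) (offset k + l) = node k l.
Proof.
move=> kn lk; have [t ->] := nodes_upto_prefix kn.
rewrite nth_cat size_nodes_upto offset_lt //.
case: k lk {kn} => [|k] lk; first by rewrite /offset big_ord0 add0n; case: l lk.
rewrite nodes_uptoS nth_cat size_nodes_upto ltnNge leq_addr /= addKn.
by rewrite (nth_map 0%N) ?size_iota // nth_iota.
Qed.

Lemma sum_offset (G : nat -> R[i]) n :
  \sum_(i < offset n) G i = \sum_(k < n) \sum_(l < level_size k) G (offset k + l)%N.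
Proof.
elim: n => [|n IH]; first by rewrite /offset !big_ord0.
by rewrite offsetS big_split_ord IH big_ord_recr.
Qed.

Lemma node_unit_disc k l : unit_disc (node k l : R[i]).
Proof. by rewrite /unit_disc /mkset normc_node radius_lt1. Qed.

Lemma nodes_upto_unit_disc n i : (i < size (nodes n))%N -> unit_disc (nth 0 (nodes n) i).
Proof.
elim: n i => [|n IH] i.
  by rewrite /nodes_upto /= ltnS leqn0 => /eqP ->; exact: node_unit_disc.
rewrite nodes_uptoS size_cat nth_cat => h; case: ltnP => [/IH //|hi].
have {}h : (i - size (nodes n) < level_size n.+1)%N.
  by move: h; rewrite size_map size_iota ltn_subLR.
by rewrite (nth_map 0%N) ?size_iota // nth_iota //; exact: node_unit_disc.
Qed.

Lemma nth_kernels n i : (i < size (nodes n))%N ->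
  nth fun0 (kernels n) i = bergman_kernel (nth 0 (nodes n) i).
Proof. by move=> h; rewrite (nth_map 0). Qed.

Lemma bergman_kernels n i : bergman (nth fun0 (kernels n) i).
Proof.
have [h|h] := ltnP i (size (nodes n)).
  by rewrite nth_kernels //; apply: bergman_kernel_bergman; exact: nodes_upto_unit_disc.
by rewrite nth_default ?size_map //; exact: bergman0.
Qed.

(** Reads all the functions up to level n off one and the same orthonormalization. *)
Lemma psiE k l n : (k <= n)%N -> (l < level_size k)%N ->
  psi k l = nth fun0 (gram_schmidt (kernels n)) (offset k + l).
Proof.
move=> kn lk; rewrite /psi; have [t ->] := nodes_upto_prefix kn.
by rewrite map_cat gram_schmidt_prefix // size_map size_nodes_upto offset_lt.
Qed.

Lemma bergman_projE n f : bergman_proj n f = seq_proj (gram_schmidt (kernels n)) f.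
Proof.
apply/funext => z; rewrite seq_projE /lincomb size_gram_schmidt size_map size_nodes_upto.
rewrite (sum_offset (fun i => inner f (nth fun0 (gram_schmidt (kernels n)) i) *
  nth fun0 (gram_schmidt (kernels n)) i z)).
apply: eq_bigr => k _; apply: eq_bigr => l _.
by rewrite (@psiE k l n) // -ltnS.
Qed.

Lemma bergman_bergman_proj n f : bergman (bergman_proj n f).
Proof.
rewrite bergman_projE; apply: bergman_seq_proj.
by have [] := gram_schmidt_orthogonal (bergman_kernels n).
Qed.

Lemma bergman_residual n f : bergman f -> bergman (fun z => f z - bergman_proj n f z).
Proof. by move=> hf; apply: bergmanB => //; exact: bergman_bergman_proj. Qed.

Lemma residual_orthogonal_kernel n f k l : bergman f -> (k <= n)%N -> (l < level_size k)%N ->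
  inner (fun z => f z - bergman_proj n f z) (bergman_kernel (node k l)) = 0.
Proof.
move=> hf kn lk; have [_ _ _ h] := gram_schmidt_orthogonal (bergman_kernels n).
have := h f (offset k + l)%N hf; rewrite nth_kernels ?nth_nodes_upto //.
  by rewrite bergman_projE.
have [t ->] := nodes_upto_prefix kn; rewrite size_cat size_nodes_upto.
exact: leq_trans (offset_lt lk) (leq_addr _ _).
Qed.

End NodeEnumeration.

(** * The projections *)

Section Projection.
Context {R : realType}.
Implicit Types (f g h : R[i] -> R[i]) (k l n : nat).
Local Notation fun0 := (fun _ : R[i] => 0 : R[i]).
Local Notation kernels n := [seq bergman_kernel a | a <- @nodes_upto R n].
Local Notation residual n f := (fun z => f z - bergman_proj n f z).

Lemma phi_bergman_kernel k l (z : R[i]) :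
  phi k l z = (1 - Defs.radius k ^+ 2)%:C * bergman_kernel (node k l) z.
Proof. by rewrite /phi /bergman_kernel mulrA mulr1. Qed.

Lemma bergman_proj_kernels n f : exists a : nat -> R[i], forall z,
  bergman_proj n f z = \sum_(k < n.+1) \sum_(l < level_size k)
    a (offset k + l)%N * bergman_kernel (node k l) z.
Proof.
pose m := size (kernels n).
have /choice[A hA] : forall i, exists a, forall z, (i < m)%N ->
    nth fun0 (gram_schmidt (kernels n)) i z = lincomb a (nth fun0 (kernels n)) m z.
  move=> i; have [im|im] := ltnP i m; last by exists (fun=> 0).
  by have [a ha] := gram_schmidt_span im; exists a => z _; exact: ha.
pose a j := \sum_(i < m) inner f (nth fun0 (gram_schmidt (kernels n)) i) * A i j.
have mE : m = offset n.+1 by rewrite /m size_map size_nodes_upto.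
exists a => z.
transitivity (\sum_(j < m) a j * nth fun0 (kernels n) j z).
  rewrite bergman_projE seq_projE /lincomb size_gram_schmidt -/m /a.
  under [RHS]eq_bigr => j _ do rewrite mulr_suml.
  rewrite exchange_big /=; apply: eq_bigr => i _.
  rewrite (hA i z (ltn_ord i)) /lincomb mulr_sumr; apply: eq_bigr => j _; exact: mulrA.
rewrite mE (sum_offset (fun j => a j * nth fun0 (kernels n) j z)).
apply: eq_bigr => k _; apply: eq_bigr => l _; congr (_ * _).
have kn : (k <= n)%N by rewrite -ltnS.
have [t E] := @nodes_upto_prefix R k n kn.
rewrite nth_kernels ?nth_nodes_upto // E size_cat size_nodes_upto.
exact: leq_trans (offset_lt (ltn_ord l)) (leq_addr _ _).
Qed.

Lemma inner_kernel_sum n (a : nat -> nat -> R[i]) g : bergman g ->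
  (forall k l, (k <= n)%N -> (l < level_size k)%N ->
     inner g (bergman_kernel (node k l)) = 0) ->
  inner g (fun z => \sum_(k < n.+1) \sum_(l < level_size k)
    a k l * bergman_kernel (node k l) z) = 0.
Proof.
move=> hg h0; have gL := bergman_disc_L2 hg.
have KL k l : disc_L2 (bergman_kernel (node k l) : R[i] -> R[i]).
  exact/bergman_disc_L2/bergman_kernel_bergman/node_unit_disc.
rewrite (@inner_sumr _ n.+1 (fun k z => \sum_(l < level_size k) a k l * bergman_kernel (node k l) z)) //.
  apply: big1 => k _.
  rewrite (@inner_sumr _ _ (fun l z => a k l * bergman_kernel (node k l) z)) //.
    by apply: big1 => l _; rewrite innerZr // h0 ?mulr0 // -ltnS.
  by move=> l; exact: disc_L2Z.
move=> k; apply: (@disc_L2_sum _ _ (fun l z => a k l * bergman_kernel (node k l) z)) => l.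
exact: disc_L2Z.
Qed.

Lemma resolution_space_proj n f : resolution_space n (bergman_proj n f).
Proof.
have [a ha] := bergman_proj_kernels n f.
exists (fun k l => a (offset k + l)%N / (1 - Defs.radius k ^+ 2)%:C) => z _.
rewrite ha; apply: eq_bigr => k _; apply: eq_bigr => l _.
rewrite phi_bergman_kernel mulrA divfK //.
rewrite -normc_gt0 normc_real normr_gt0 subr_eq0 eq_sym lt_eqF //.
by rewrite exprn_ilt1 // ?radius_ge0 ?radius_lt1.
Qed.

Lemma residual_orthogonal n f h : bergman f -> resolution_space n h ->
  inner (residual n f) h = 0.
Proof.
move=> hf [c hc].
rewrite -(@inner_kernel_sum n (fun k l => c k l * (1 - Defs.radius k ^+ 2)%:C) (residual n f)).
- apply: eq_inner => // z zD; rewrite hc //; apply: eq_bigr => k _; apply: eq_bigr => l _.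
  by rewrite phi_bergman_kernel mulrA.
- exact: bergman_residual.
- by move=> k l kn lk; exact: residual_orthogonal_kernel.
Qed.

Lemma residual_node n f k l : bergman f -> (k <= n)%N -> (l < level_size k)%N ->
  f (node k l) - bergman_proj n f (node k l) = 0.
Proof.
move=> hf kn lk; have := residual_orthogonal_kernel hf kn lk.
by rewrite bergman_reproducing //; [exact: bergman_residual|exact: node_unit_disc].
Qed.

Lemma bergman_proj_interpolates n f : bergman f -> interpolates n f (bergman_proj n f).
Proof. by move=> hf k l kn lk; apply/esym/subr0_eq; exact: residual_node. Qed.

(* h - P_n f vanishes at the nodes, hence is orthogonal to the kernels there. *)
Lemma interpolant_pythagoras n f h : bergman f -> bergman h -> interpolates n f h ->
  bnorm h ^+ 2 = bnorm (fun z => h z - bergman_proj n f z) ^+ 2 + bnorm (bergman_proj n f) ^+ 2.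
Proof.
move=> hf hh hi; have hP := bergman_bergman_proj n f; have hd := bergmanB hh hP.
have o : inner (fun z => h z - bergman_proj n f z) (bergman_proj n f) = 0.
  have [a ha] := bergman_proj_kernels n f; rewrite {2}(funext ha).
  apply: (@inner_kernel_sum n (fun k l => a (offset k + l)%N)) => // k l kn lk.
  rewrite bergman_reproducing //; last exact: node_unit_disc.
  by rewrite hi // bergman_proj_interpolates // subrr.
have E : h = fun z => (h z - bergman_proj n f z) + bergman_proj n f z.
  by apply/funext => z; rewrite subrK.
rewrite {1}E sqr_bnormD; [|exact: bergman_disc_L2|exact: bergman_disc_L2].
by rewrite o mulr0 addr0.
Qed.

Lemma bergman_proj_min_norm n f : bergman f ->
  is_min_norm_interpolant n f (bergman_proj n f) /\
  forall g, is_min_norm_interpolant n f g -> eq_on_disc g (bergman_proj n f).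
Proof.
move=> hf; have hP := bergman_bergman_proj n f; have iP := @bergman_proj_interpolates n f hf.
split.
  split=> // h hh hi; rewrite -(ler_pXn2r (n := 2)) ?nnegrE ?bnorm_ge0 //.
  by rewrite (interpolant_pythagoras hf hh hi) lerDr sqr_ge0.
move=> g [hg gi gmin] z zD; apply: subr0_eq.
have d0 : bnorm (fun z => g z - bergman_proj n f z) = 0.
  have := gmin _ hP iP; rewrite -(ler_pXn2r (n := 2)) ?nnegrE ?bnorm_ge0 //.
  rewrite (interpolant_pythagoras hf hg gi) => h.
  apply/eqP; rewrite -sqrf_eq0 eq_le sqr_ge0 andbT; lra.
exact: (bnorm0_eq0 (bergmanB hg hP) d0 zD).
Qed.

Lemma bnorm_residual_le n f : bergman f -> bnorm (residual n f) ^+ 2 <= bnorm f ^+ 2.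
Proof.
move=> hf; have fi : interpolates n f f by [].
by rewrite (interpolant_pythagoras hf hf fi) lerDl sqr_ge0.
Qed.

(** * Decay of the residuals on compact sets and in norm *)

Section Convergence.
Context (f : R[i] -> R[i]) (hf : bergman f) (c : nat -> nat -> R[i])
  (hc : forall n z, unit_disc z -> psum_cvg (c n) z (residual n f z)).

Lemma residual_coef_decay (sigma e : R) : 0 < sigma -> sigma < 1 -> 0 < e ->
  exists n0, forall n, (n0 <= n)%N -> forall m, normc (c n m) * sigma ^+ m <= e.
Proof.
move=> s0 s1 e0; have [n0 h0] := coef_decay s0 s1 (bnorm_ge0 f) e0.
exists n0 => n nn; apply: (h0 n) => //.
  move=> M; apply: le_trans (bnorm_residual_le n hf).
  by apply: bessel; [exact/bergman_disc_L2/bergman_residual|exact: hc].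
(* Only levels k > 0 are concerned, where [node_count] and [level_size] coincide. *)
move=> [|k] l //= kn lk; have := hc n (node_unit_disc k.+1 l).
by rewrite residual_node.
Qed.

Lemma residual_uniform_small (tau e : R) : 0 <= tau -> tau < 1 -> 0 < e ->
  exists n0, forall n z, (n0 <= n)%N -> normc z <= tau -> normc (residual n f z) <= e.
Proof.
move=> t0 t1 e0; pose s := (tau + 1) / 2.
have ts : tau < s by rewrite /s; lra.
have s1 : s < 1 by rewrite /s; lra.
have s0 : 0 < s by exact: le_lt_trans ts.
have q1 : tau / s < 1 by rewrite ltr_pdivrMr // mul1r.
have d0 : 0 < 1 - tau / s by rewrite subr_gt0.
have [n0 h0] := residual_coef_decay s0 s1 (mulr_gt0 e0 d0).
exists n0 => n z nn zt; have zs : normc z < s by exact: le_lt_trans ts.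
have zD : unit_disc z by exact: lt_trans s1.
have := psum_tail_bound 0 s0 zs (h0 n nn) (hc n zD).
rewrite /psum big_ord0 subr0 expr0 mulr1; move/le_trans; apply.
have dz : 0 < 1 - normc z / s by rewrite subr_gt0 ltr_pdivrMr // mul1r.
by rewrite ler_pdivrMr // ler_pM2l // lerD2l lerN2 ler_pM2r ?invr_gt0.
Qed.

(** Convergence to 0 against a fixed polynomial, since only finitely many coefficients of the
    residual enter and each tends to 0. *)
Lemma residual_inner_psum_small (a : nat -> R[i]) M (e : R) : 0 < e ->
  exists n0, forall n, (n0 <= n)%N ->
    normc (inner (residual n f) (fun z => psum a z M)) <= e.
Proof.
(* Decay at radius 1/2 gives |c n m| <= (e / A) 2^m, whence the powers of 2; the summand 1 keeps A
   positive when the polynomial is 0. *)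
move=> e0; pose A := 1 + \sum_(m < M) normc (a m) * 2 ^+ m.
have A0 : 0 < A.
  by rewrite ltr_wpDr // sumr_ge0 // => m _; rewrite mulr_ge0 // exprn_ge0.
have h2 : (2^-1 : R) < 1 by rewrite invf_lt1 // ltr1n.
have h20 : 0 < (2^-1 : R) by rewrite invr_gt0.
have [n0 h0] := residual_coef_decay h20 h2 (divr_gt0 e0 A0).
exists n0 => n nn; have rL := bergman_disc_L2 (bergman_residual n hf).
rewrite (@inner_sumr _ M (fun m z => a m * power m z)) //; last first.
  by move=> m; apply: disc_L2Z; exact: disc_L2_power.
apply: le_trans (normc_sum _ _ _) _.
apply: (@le_trans _ _ (\sum_(m < M) (e / A) * (normc (a m) * 2 ^+ m))).
  apply: ler_sum => m _; rewrite innerZr //; last exact: disc_L2_power.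
  rewrite (inner_power_coef _ rL (hc n)) !normcM normc_conj normcV.
  rewrite -(rmorph_nat (real_complex R)) normc_real ger0_norm //.
  rewrite [leRHS]mulrCA ler_wpM2l //; have := h0 n nn m; rewrite exprVn ler_pdivrMr ?exprn_gt0 //.
  apply: le_trans; rewrite ler_piMr // invf_le1 ?ltr0n // ler1n //.
rewrite -mulr_sumr -mulrA ler_piMr ?(ltW e0) // mulrC ler_pdivrMr // mul1r /A.
by rewrite lerDr.
Qed.

(* Pairing the residual with itself amounts to pairing it with f, since P_n f is
   orthogonal to it; f is then replaced by a Taylor polynomial. *)
Lemma sqr_bnorm_residual_le n g h : disc_L2 g -> disc_L2 h ->
  eq_on_disc f (fun z => g z + h z) ->
  bnorm (residual n f) ^+ 2 <= 2 * complex.Re (inner (residual n f) g) + bnorm h ^+ 2.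
Proof.
move=> gL hL E; have hP := bergman_bergman_proj n f; have PL := bergman_disc_L2 hP.
have [r rE fE] : exists2 r, r = residual n f & forall z, f z = r z + bergman_proj n f z.
  by exists (residual n f) => // z; rewrite subrK.
have hr := bergman_residual n hf; have rP := residual_orthogonal hf (resolution_space_proj n f).
rewrite -rE in hr rP *; have rL := bergman_disc_L2 hr.
have e1 : inner r f = (bnorm r ^+ 2)%:C.
  rewrite -inner_sqr_bnorm -[RHS]addr0 -rP -(innerDr rL PL rL).
  by apply: eq_inner => // z _; exact: fE.
have e2 : inner r f = inner r g + inner r h by rewrite -(innerDr gL hL rL); exact: eq_inner.
(* Here |r|^2 = Re <r, g> + Re <r, h>, and |r - h|^2 >= 0 gives 2 Re <r, h> <= |r|^2 + |h|^2; one
   |r|^2 is absorbed on the left, with no recourse to Cauchy-Schwarz. *)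
have := sqr_ge0 (bnorm (fun z => r z + (-1) * h z)).
rewrite (sqr_bnormD rL (disc_L2Z _ hL)) (sqr_bnormZ _ hL) (innerZr _ hL rL).
have -> : (-1 : R[i])^* = -1 by rewrite rmorphN1.
rewrite mulN1r normc_opp normc1 expr1n mul1r.
have : complex.Re (inner r f) = bnorm r ^+ 2 by rewrite e1.
rewrite e2; case: (inner r g) => x y; case: (inner r h) => x' y' /=; lra.
Qed.

Lemma bnorm_residual_cvg0 : (fun n => bnorm (residual n f)) @ \oo --> (0 : R).
Proof.
have fL := bergman_disc_L2 hf; have [a ha] := bergman_series hf.
(* The final bound is 2 (e^2 / 4) from the Taylor polynomial plus e^2 / 4 from its remainder, below
   e^2. *)
apply/cvgrPdist_lt => e e0; have e20 : 0 < e ^+ 2 / 4 by rewrite divr_gt0 // exprn_gt0.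
have [M hM] : exists M, bnorm f ^+ 2 - coef_energy a M <= e ^+ 2 / 4.
  apply: contrapT => no; have : bnorm f ^+ 2 <= bnorm f ^+ 2 - e ^+ 2 / 4.
    apply: (parseval_le fL ha) => M; rewrite leNgt; apply/negP => hlt; apply: no.
    by exists M; lra.
  lra.
have [n0 h0] := residual_inner_psum_small a M e20.
exists n0 => // n nn /=; rewrite sub0r normrN ger0_norm ?bnorm_ge0 //.
rewrite -(ltr_pXn2r (n := 2)) ?nnegrE ?bnorm_ge0 ?(ltW e0) //.
have sL := disc_L2_psum a M.
have hL : disc_L2 (fun z => f z - psum a z M).
  have := disc_L2D fL (disc_L2Z (-1) sL); rewrite (_ : (fun z => f z + _) = fun z => f z - psum a z M) //.
  by apply/funext => z; rewrite mulN1r.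
have := @sqr_bnorm_residual_le n _ _ sL hL (fun z _ => esym (subrKC _ _)).
rewrite (sqr_bnorm_sub_psum M fL ha).
have := le_trans (Re_normc _) (h0 n nn); rewrite ler_norml => /andP[_ h1]; lra.
Qed.

End Convergence.

Lemma compact_unit_disc_radius (K : set R[i]^o) : compact K -> K `<=` unit_disc ->
  exists tau : R, [/\ 0 <= tau, tau < 1 & forall z, K z -> normc z <= tau].
Proof.
move=> cK KD; have [K0|K0] := pselect (K !=set0); last first.
  by exists 0; split=> // z Kz; exfalso; apply: K0; exists z.
have cn : continuous (fun z : R[i]^o => normc (z : R[i])).
  move=> z; apply/(@cvgrPdist_lt _ _ _ (nbhs (z : R[i]^o))) => e e0.
  have e0' : (0 : R[i]) < e%:C by rewrite ltcR.
  exists (e%:C : R[i]) => // y /=; rewrite -[`|z - y|]/((normc (z - y))%:C) ltcR => H.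
  exact: le_lt_trans (normc_sub_le _ _) H.
have [z0 z0K hz0] := compact_EVT_max K0 cK (continuous_subspaceT cn).
rewrite inE in z0K; exists (normc z0); split; [exact: normc_ge0|exact: KD|].
by move=> z Kz; apply: hz0; rewrite inE.
Qed.

End Projection.

Theorem theorem2p2 (R : realType) (f : R[i] -> R[i]) (hf : bergman f) :
  (forall n : nat, is_orthogonal_projection n f (bergman_proj n f)) /\
  (forall n : nat, interpolates n f (bergman_proj n f)) /\
  ((fun n : nat => bnorm (fun z => f z - bergman_proj n f z)) @ \oo --> (0 : R)) /\
  (forall K : set R[i]^o, compact K -> K `<=` unit_disc ->
     {uniform K, ((fun n : nat => bergman_proj n f : R[i]^o -> R[i]^o) @ \oo)
        --> (f : R[i]^o -> R[i]^o)}) /\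
  (forall n : nat, is_min_norm_interpolant n f (bergman_proj n f) /\
     forall g : R[i] -> R[i], is_min_norm_interpolant n f g ->
       eq_on_disc g (bergman_proj n f)).
Proof.
have /choice[c hc] : forall n, exists c, forall z, unit_disc z ->
    psum_cvg c z (f z - bergman_proj n f z).
  by move=> n; exact/bergman_series/bergman_residual.
split; first by move=> n; split; [exact: resolution_space_proj|move=> h; exact: residual_orthogonal].
split; first by move=> n; exact: bergman_proj_interpolates.
split; first exact: bnorm_residual_cvg0 hc.
split; last by move=> n; exact: bergman_proj_min_norm.
move=> K cK KD; have [tau [t0 t1 hK]] := compact_unit_disc_radius cK KD.
move=> P /uniform_nbhs[E [entE subP]].
move: entE; rewrite -entourage_ballE => -[e /= e0 hE].
(* The radius of the entourage is a positive complex number, hence real; it is halved below because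
   the residual estimate is not strict. *)
have e1 : e = (complex.Re e)%:C by rewrite RRe_real ?gtr0_real.
rewrite e1 ltcR in e0.
have e20 : 0 < complex.Re e / 2 by rewrite divr_gt0.
have [n0 h0] := residual_uniform_small hf hc t0 t1 e20.
exists n0 => // n /= nn; apply: subP => z Kz; apply: hE => /=.
rewrite -ball_normE /= -[`|f z - bergman_proj n f z|]/((normc (f z - bergman_proj n f z))%:C) e1 ltcR.
apply: le_lt_trans (h0 n z nn (hK z Kz)) _.
by rewrite ltr_pdivrMr // ltr_pMr // ltr1n.
Qed.
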